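(* Assume the Strict Degree Condition $a<\frac4{n+2}$. Suppose $\Upsilon_2=1+\int_0^\infty f(t)dt$, $\Upsilon_3=1+\sup_{t\in[0,\infty)}\|\psi(t)\|_{L^\infty(\Gamma)}$ and $\Upsilon_7=1+\sup_{t\ge2}\int_{t-2}^t\tilde f(\tau)d\tau$ are finite. Then $$\limsup_{t\to\infty}\|\bar P(t)\|_{L^\infty(U')}\le C\Upsilon_9\Big(|\vec a^{(1)}-\vec a^{(2)}|+|\vec a^{(1)}-\vec a^{(2)}|^{\frac{\gamma_1}{\gamma_1+1}}\Big)^{1/2},$$ where $\Upsilon_9=\eta_4\mathcal A_2^{\frac{\mu_7}{\mu_6}+\frac{b+1}2}$ with $\eta_4=\big[L_{12}'\Upsilon_2^{\frac1{2\mu}}\Upsilon_3^{\frac{\mu_4((2-a)\mu+a-2)}{2\mu}}\big]^{\frac1{\gamma_1+1}}$, $L'_{12}=\big\{\sum_{i=1,2}L_3\big((2-a)\mu+a;p_i(\cdot,0)\big)\big\}^{\frac1{2\mu}}$, and $\mathcal A_2=1+A^{\frac2{2-a}}+\limsup_{t\to\infty}\int_{t-1}^t\tilde f(\tau)d\tau$.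
   Context: Let $n\ge2$ and $U\subset\mathbb R^n$ be a bounded, open, connected set with $C^2$ boundary $\Gamma$, outward unit normal $\nu$, volume $|U|$; let $U'\Subset U$. Fix $N\ge1$ and real exponents $0=\alpha_0<\dots<\alpha_N$. For a coefficient vector $\vec a=(a_0,\dots,a_N)$ with $a_0,a_N>0$, $a_1,\dots,a_{N-1}\ge0$, let $g(s,\vec a)=\sum_ja_js^{\alpha_j}$, let $s(\xi,\vec a)\ge0$ solve $s g(s,\vec a)=\xi$ and $K(\xi,\vec a)=1/g(s(\xi,\vec a),\vec a)$, and $\chi(\vec a)=\max\{a_0,\dots,a_N,1/a_0,1/a_N\}$. Let $\mathbf D$ be a compact subset of such coefficient vectors and $\vec a^{(1)},\vec a^{(2)}\in\mathbf D$. Let $a=\alpha_N/(1+\alpha_N)$, $b=\frac{a}{2-a}$. For $k=1,2$ let $p_k$ be a sufficiently regular solution (for all $t\ge0$) of $\partial_tp_k=\nabla\cdot(K(|\nabla p_k|,\vec a^{(k)})\nabla p_k)$ in $U\times(0,\infty)$, $-K(|\nabla p_k|,\vec a^{(k)})\nabla p_k\cdot\nu=\psi$ on $\Gamma\times(0,\infty)$ (same smooth flux $\psi$), with smooth initial data $p_k(\cdot,0)$. Let $\bar p_k=p_k-\frac1{|U|}\int_Up_k\,dx$ and $\bar P=\bar p_1-\bar p_2$. Let $f(t)=\|\psi(t)\|_{L^\infty(\Gamma)}^2+\|\psi(t)\|_{L^\infty(\Gamma)}^{\frac{2-a}{1-a}}$, $\tilde f(t)=\|\psi_t(t)\|_{L^\infty(\Gamma)}^2+\|\psi_t(t)\|_{L^\infty(\Gamma)}^{\frac{2-a}{1-a}}$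 (both continuous), $A=\limsup_{t\to\infty}f(t)$. Exponents: $(2-a)^*=\frac{n(2-a)}{n-(2-a)}$, $\mu_5=4(1-\frac1{(2-a)^*})$, $\mu_6=1-\frac2{\mu_5}$, $\mu_7=\frac2{\mu_5(2-a)}$, $\mu_4=\frac4{(2-a)(4-a(n+2))}$; $\mu$ is a fixed number with $\mu>\frac{\mu_5}{\mu_5-2}$ and $\gamma_1=\mu_6-\frac1\mu$. For a function $q_0$ on $U$ with $\bar q_0=q_0-\frac1{|U|}\int_Uq_0$ and $r\ge2$: $L_3(r;q_0)=\big(1+\|\bar q_0\|_{L^\infty(U)}+\|\bar q_0\|_{L^2(U)}^{\mu_4(2-a)}\big)^{r-2}\big\{1+\int_U|\nabla q_0|^{\max\{2,r-2\}}dx\big\}$. The constant $C$ depends on $n,U,U',N,\vec\alpha,\mu$ and $\max_{\vec a\in\mathbf D}\chi(\vec a)$. *)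

(* Defs.v *)
From HB Require Import structures.
From mathcomp Require Import all_boot all_order all_algebra.
From mathcomp Require Import all_classical all_reals all_analysis.
Set Implicit Arguments. Unset Strict Implicit. Unset Printing Implicit Defensive.
Import Order.TTheory GRing.Theory Num.Theory.
Import numFieldNormedType.Exports.
Local Open Scope classical_set_scope.
Local Open Scope ring_scope.

Section Defs.
Context {R : realType}.

Definition ebasis {n} (i : 'I_n) : 'rV[R]_n := delta_mx 0 i.
Definition enorm {n} (x : 'rV[R]_n) : R := Num.sqrt (\sum_i x 0 i ^+ 2).
Definition dotp {n} (x y : 'rV[R]_n) : R := \sum_i x 0 i * y 0 i.
Definition partial {n} (i : 'I_n) (f : 'rV[R]_n -> R) : 'rV[R]_n -> R :=
  fun x => derive f x (ebasis i).
Definition grad {n} (f : 'rV[R]_n -> R) (x : 'rV[R]_n) : 'rV[R]_n :=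
  \row_i partial i f x.
Fixpoint iter_partial {n} (s : seq 'I_n) (f : 'rV[R]_n -> R) : 'rV[R]_n -> R :=
  match s with [::] => f | i :: s' => partial i (iter_partial s' f) end.
Definition Ck {n} (k : nat) (f : 'rV[R]_n -> R) : Prop :=
  forall s : seq 'I_n, (size s <= k)%N ->
    continuous (iter_partial s f) /\
    ((size s < k)%N -> forall i x, derivable (iter_partial s f) x (ebasis i)).
Definition Cinf {n} (f : 'rV[R]_n -> R) : Prop := forall k, Ck k f.

Definition st {n} (x : 'rV[R]_n) (t : R) : 'rV[R]_(n + 1) :=
  row_mx x (const_mx t : 'rV[R]_1).
Definition time_deriv {n} (P : 'rV[R]_(n + 1) -> R) (x : 'rV[R]_n) (t : R) : R :=
  derive (fun s : R => P (st x s)) t 1.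
Definition gradx {n} (P : 'rV[R]_(n + 1) -> R) (t : R) (y : 'rV[R]_n) : 'rV[R]_n :=
  grad (fun z => P (st z t)) y.

(* iterated Lebesgue integral over R^n (Fubini); used only for bounded,
   compactly supported, piecewise continuous integrands *)
Fixpoint iter_int (n : nat) : ('rV[R]_n -> R) -> R :=
  match n return ('rV[R]_n -> R) -> R with
  | 0 => fun h => h 0
  | m.+1 => fun h => Rintegral (@lebesgue_measure R) setT
        (fun s : R => iter_int (fun y : 'rV[R]_m => h (row_mx (const_mx s : 'rV[R]_1) y)))
  end.
Definition integral_over {n} (U : set 'rV[R]_n) (h : 'rV[R]_n -> R) : R :=
  iter_int (fun x => if `[< U x >] then h x else 0).
Definition vol {n} (U : set 'rV[R]_n) : R := integral_over U (fun _ => 1).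
Definition mean_free {n} (U : set 'rV[R]_n) (q : 'rV[R]_n -> R) : 'rV[R]_n -> R :=
  fun x => q x - (vol U)^-1 * integral_over U q.

(* sup of |h| over a set (L^infinity norm of a continuous function) *)
Definition esup_abs {T} (A : set T) (h : T -> R) : \bar R :=
  ereal_sup [set (`|h x|)%:E | x in A].
Definition sup_abs {T} (A : set T) (h : T -> R) : R := fine (esup_abs A h).
Definition L2norm {n} (U : set 'rV[R]_n) (h : 'rV[R]_n -> R) : R :=
  Num.sqrt (integral_over U (fun x => h x ^+ 2)).

Definition limsup_oo (g : R -> \bar R) : \bar R :=
  ereal_inf [set ereal_sup [set g t | t in [set t | T <= t]] | T in setT].
Definition eint (s1 s2 : R) (h : R -> R) : \bar R :=
  (\int[@lebesgue_measure R]_(x in [set x | (s1 <= x <= s2)%R]) (h x)%:E)%E.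

Definition bdry {n} (U : set 'rV[R]_n) : set 'rV[R]_n := closure U `\` U.
(* U has C^2 boundary and nu is its outward unit normal: near each boundary
   point U = {rho < 0} for a C^2 function rho with nonvanishing gradient,
   and nu = grad rho / |grad rho| on the boundary. *)
Definition C2_boundary_normal {n} (U : set 'rV[R]_n) (nu : 'rV[R]_n -> 'rV[R]_n) : Prop :=
  forall x0, bdry U x0 -> exists r : R, 0 < r /\
    exists rho : 'rV[R]_n -> R, Ck 2 rho /\
      (forall x, ball x0 r x -> grad rho x != 0) /\
      (forall x, ball x0 r x -> (U x <-> rho x < 0)) /\
      (forall x, ball x0 r x -> bdry U x ->
         nu x = (enorm (grad rho x))^-1 *: grad rho x).

Definition admissible {N} (av : 'rV[R]_N.+1) : Prop :=
  0 < av 0 0 /\ 0 < av 0 ord_max /\ (forall j, 0 <= av 0 j).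
Definition gfun {N} (al : 'I_N.+1 -> R) (av : 'rV[R]_N.+1) (s : R) : R :=
  \sum_j av 0 j * s `^ al j.
Definition sfun {N} (al : 'I_N.+1 -> R) (av : 'rV[R]_N.+1) (xi : R) : R :=
  xget 0 [set s | 0 <= s /\ s * gfun al av s = xi].
Definition Kfun {N} (al : 'I_N.+1 -> R) (av : 'rV[R]_N.+1) (xi : R) : R :=
  (gfun al av (sfun al av xi))^-1.
Definition chi {N} (av : 'rV[R]_N.+1) : R :=
  Num.max (\big[Num.max/av 0 0]_j av 0 j)
          (Num.max (av 0 0)^-1 (av 0 ord_max)^-1).

Definition flux {n N} (al : 'I_N.+1 -> R) (av : 'rV[R]_N.+1)
  (P : 'rV[R]_(n + 1) -> R) (t : R) (y : 'rV[R]_n) : 'rV[R]_n :=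
  Kfun al av (enorm (gradx P t y)) *: gradx P t y.

Definition is_solution {n N} (U : set 'rV[R]_n) (nu : 'rV[R]_n -> 'rV[R]_n)
  (al : 'I_N.+1 -> R) (av : 'rV[R]_N.+1) (Psi P : 'rV[R]_(n + 1) -> R) : Prop :=
  Ck 2 P /\
  (exists q0 : 'rV[R]_n -> R, Cinf q0 /\ forall x, closure U x -> P (st x 0) = q0 x) /\
  (forall x t, U x -> 0 < t ->
     (forall i, derivable (fun y => flux al av P t y 0 i) x (ebasis i)) /\
     time_deriv P x t = \sum_i partial i (fun y => flux al av P t y 0 i) x) /\
  (forall x t, bdry U x -> 0 < t ->
     - dotp (flux al av P t x) (nu x) = Psi (st x t)).

Definition aexp {N} (al : 'I_N.+1 -> R) : R := al ord_max / (1 + al ord_max).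
Definition bexp (a : R) : R := a / (2 - a).
Definition star_exp (n : nat) (a : R) : R := n%:R * (2 - a) / (n%:R - (2 - a)).
Definition mu5 n a : R := 4 * (1 - (star_exp n a)^-1).
Definition mu6 n a : R := 1 - 2 / mu5 n a.
Definition mu7 n a : R := 2 / (mu5 n a * (2 - a)).
Definition mu4 n a : R := 4 / ((2 - a) * (4 - a * (n%:R + 2))).
Definition gamma1 n a (mu : R) : R := mu6 n a - mu^-1.

Definition psi_norm {n} (U : set 'rV[R]_n) (Psi : 'rV[R]_(n + 1) -> R) (t : R) : R :=
  sup_abs (bdry U) (fun x => Psi (st x t)).
Definition psit_norm {n} (U : set 'rV[R]_n) (Psi : 'rV[R]_(n + 1) -> R) (t : R) : R :=
  sup_abs (bdry U) (fun x => time_deriv Psi x t).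
Definition f_data {n} (U : set 'rV[R]_n) a Psi (t : R) : R :=
  psi_norm U Psi t ^+ 2 + psi_norm U Psi t `^ ((2 - a) / (1 - a)).
Definition ft_data {n} (U : set 'rV[R]_n) a Psi (t : R) : R :=
  psit_norm U Psi t ^+ 2 + psit_norm U Psi t `^ ((2 - a) / (1 - a)).
Definition A_lim {n} (U : set 'rV[R]_n) a Psi : \bar R :=
  limsup_oo (fun t => (f_data U a Psi t)%:E).
Definition Ups2 {n} (U : set 'rV[R]_n) a Psi : \bar R :=
  (1 + \int[@lebesgue_measure R]_(t in [set t : R | (0 <= t)%R]) (f_data U a Psi t)%:E)%E.
Definition Ups3 {n} (U : set 'rV[R]_n) Psi : \bar R :=
  (1 + ereal_sup [set (psi_norm U Psi t)%:E | t in [set t : R | (0 <= t)%R]])%E.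
Definition Ups7 {n} (U : set 'rV[R]_n) a Psi : \bar R :=
  (1 + ereal_sup [set eint (t - 2) t (ft_data U a Psi) | t in [set t : R | (2 <= t)%R]])%E.
Definition calA2 {n} (U : set 'rV[R]_n) a Psi : R :=
  1 + fine (A_lim U a Psi) `^ (2 / (2 - a))
    + fine (limsup_oo (fun t => eint (t - 1) t (ft_data U a Psi))).

Definition L3 {n} (U : set 'rV[R]_n) (a m4 r : R) (q0 : 'rV[R]_n -> R) : R :=
  (1 + sup_abs U (mean_free U q0) + L2norm U (mean_free U q0) `^ (m4 * (2 - a))) `^ (r - 2)
  * (1 + integral_over U (fun x => enorm (grad q0 x) `^ Num.max 2 (r - 2))).

Definition init {n} (P : 'rV[R]_(n + 1) -> R) : 'rV[R]_n -> R := fun x => P (st x 0).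

Definition L12' {n} (U : set 'rV[R]_n) (a m4 mu : R) (P1 P2 : 'rV[R]_(n + 1) -> R) : R :=
  (L3 U a m4 ((2 - a) * mu + a) (init P1) + L3 U a m4 ((2 - a) * mu + a) (init P2))
    `^ (1 / (2 * mu)).

Definition eta4 {n} (U : set 'rV[R]_n) (a mu : R) (Psi P1 P2 : 'rV[R]_(n + 1) -> R) : R :=
  (L12' U a (mu4 n a) mu P1 P2 * fine (Ups2 U a Psi) `^ (1 / (2 * mu))
    * fine (Ups3 U Psi) `^ (mu4 n a * ((2 - a) * mu + a - 2) / (2 * mu)))
  `^ (1 / (gamma1 n a mu + 1)).

Definition Ups9 {n} (U : set 'rV[R]_n) (a mu : R) (Psi P1 P2 : 'rV[R]_(n + 1) -> R) : R :=
  eta4 U a mu Psi P1 P2 * calA2 U a Psi `^ (mu7 n a / mu6 n a + (bexp a + 1) / 2).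

Definition barP {n} (U : set 'rV[R]_n) (P1 P2 : 'rV[R]_(n + 1) -> R) (t : R) : 'rV[R]_n -> R :=
  fun x => mean_free U (fun y => P1 (st y t)) x - mean_free U (fun y => P2 (st y t)) x.

End Defs.

(* Main.v *)
(** The hypotheses force the left-hand side to vanish, so the constant C = 0 is enough.

    Since f is integrable on [0, oo) and psi_t is uniformly locally square integrable, psi is
    equicontinuous in time uniformly on the boundary, so the flux tends to 0. In
    non-divergence form the equation reads
    p_t = K(|Dp|) (tr D^2 p - th(|Dp|) <e, D^2 p e>) with e = Dp / |Dp|, where th takes values
    in [0, a], tends to a at infinity, and a < 1. Everything else is the maximum principle.
    Doubling of variables with a square root penalty lowers the oscillation of p on a small
    ball by an amount independent of the size of the oscillation over U; barriers (persistence
    in time, expansion of balls inside U and across boundary caps) spread this gain to the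
    whole connected domain within bounded time, as long as the flux is small. Hence the
    oscillation of p_1(t) and of p_2(t) tends to 0. A mean-free function is bounded by its
    oscillation, so both mean-free parts tend to 0 uniformly. *)
Require Import Defs.
From HB Require Import structures.
From mathcomp Require Import all_boot all_order all_algebra.
From mathcomp Require Import all_classical all_reals all_analysis.
From mathcomp Require Import measurable_realfun ring lra.
Import Order.TTheory GRing.Theory Num.Theory.
Import numFieldNormedType.Exports.
Local Open Scope classical_set_scope.
Local Open Scope ring_scope.
Set Implicit Arguments.
Unset Strict Implicit.
Unset Printing Implicit Defensive.

(** No bound on p or its gradient is available beforehand, and K(|Dp|) tends to 0 as |Dp| grows, so
    a gain depending on the size of the oscillation might fade before the oscillation does. The
    doubling therefore penalises only a top part of fixed height 2 eta. Its steep penalty makes the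
    gradients at the two points of a positive maximum large while their difference stays bounded.
    There the two operators differ by a factor close to 1: K by the monotonicity of K and of xi
    K(xi), and th because it is near its limit. Concavity of the square root produces a negative
    second derivative of order om = |Dp| / |x - y| along the gradient; ellipticity keeps the share 1
    - a of it, and |x - y| <= 1 turns the diffusion term into at least a multiple of K(|Dp|) |Dp|,
    which is unbounded. This outweighs the degeneracy for any oscillation. The later gains do not
    depend on the time or on the size of the oscillation either, so every two units of time lower it
    by a fixed amount until it falls below eta. *)

(** * Quadratic forms *)

Section Euclid.
Context {R : realType} {n : nat}.
Implicit Types (x y z u v w : 'rV[R]_n) (H Q : 'M[R]_n) (c : R).

Lemma dotpC x y : dotp x y = dotp y x.
Proof. by apply: eq_bigr => i _; rewrite mulrC. Qed.

Lemma dotpDl x y z : dotp (x + y) z = dotp x z + dotp y z.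
Proof. by rewrite -big_split; apply: eq_bigr => i _; rewrite mxE mulrDl. Qed.

Lemma dotpZl c x y : dotp (c *: x) y = c * dotp x y.
Proof. by rewrite /dotp mulr_sumr; apply: eq_bigr => i _; rewrite mxE mulrA. Qed.

Lemma dotpNl x y : dotp (- x) y = - dotp x y.
Proof. by rewrite -scaleN1r dotpZl mulN1r. Qed.

Lemma dotpBl x y z : dotp (x - y) z = dotp x z - dotp y z.
Proof. by rewrite dotpDl dotpNl. Qed.

Lemma dotpDr x y z : dotp z (x + y) = dotp z x + dotp z y.
Proof. by rewrite dotpC dotpDl !(dotpC z). Qed.

Lemma dotpZr c x y : dotp y (c *: x) = c * dotp y x.
Proof. by rewrite dotpC dotpZl (dotpC y). Qed.

Lemma dotpNr x y : dotp y (- x) = - dotp y x.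
Proof. by rewrite dotpC dotpNl (dotpC y). Qed.

Lemma dotpBr x y z : dotp z (x - y) = dotp z x - dotp z y.
Proof. by rewrite dotpDr dotpNr. Qed.

Lemma dotp0l x : dotp 0 x = 0.
Proof. by rewrite -(scale0r x) dotpZl mul0r. Qed.

Lemma dotp_ebasis x i : dotp x (ebasis i) = x 0 i.
Proof.
rewrite /dotp (bigD1 i) //= big1 => [|j /negPf ji].
  by rewrite /ebasis mxE !eqxx mulr1 addr0.
by rewrite /ebasis mxE ji andbF mulr0.
Qed.

Lemma dotp_ge0 x : 0 <= dotp x x.
Proof. by apply: sumr_ge0 => i _; rewrite -expr2 sqr_ge0. Qed.

Lemma enorm_ge0 x : 0 <= enorm x. Proof. exact: sqrtr_ge0. Qed.

Lemma sqr_enorm x : enorm x ^+ 2 = dotp x x.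
Proof.
rewrite sqr_sqrtr; first by apply: eq_bigr => i _; rewrite expr2.
by apply: sumr_ge0 => i _; exact: sqr_ge0.
Qed.

Lemma enormE x : enorm x = Num.sqrt (dotp x x).
Proof. by rewrite -sqr_enorm sqrtr_sqr ger0_norm ?enorm_ge0. Qed.

Lemma enorm0 : enorm (0 : 'rV[R]_n) = 0.
Proof. by rewrite enormE dotp0l sqrtr0. Qed.

Lemma enormZ c x : enorm (c *: x) = `|c| * enorm x.
Proof. by rewrite !enormE dotpZl dotpZr mulrA sqrtrM -?expr2 ?sqr_ge0// sqrtr_sqr. Qed.

Lemma enormN x : enorm (- x) = enorm x.
Proof. by rewrite -scaleN1r enormZ normrN1 mul1r. Qed.

Lemma enorm_eq0 x : (enorm x == 0) = (x == 0).
Proof.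
apply/idP/eqP => [/eqP h|->]; last by rewrite enorm0.
have := sqr_enorm x; rewrite h expr0n /= => /esym/eqP.
rewrite /dotp psumr_eq0 => [/allP hx|i _]; last by rewrite -expr2 sqr_ge0.
apply/rowP => i; rewrite mxE; have := hx i (mem_index_enum _).
by rewrite -expr2 sqrf_eq0 => /eqP.
Qed.

Lemma enorm_gt0 x : (0 < enorm x) = (x != 0).
Proof. by rewrite lt_def enorm_eq0 enorm_ge0 andbT. Qed.

Lemma dotp_le_enorm x y : dotp x y <= enorm x * enorm y.
Proof.
have [->|x0] := eqVneq x 0; first by rewrite dotp0l enorm0 mul0r.
have [->|y0] := eqVneq y 0; first by rewrite dotpC dotp0l enorm0 mulr0.
have a0 : 0 < enorm x by rewrite enorm_gt0.
have b0 : 0 < enorm y by rewrite enorm_gt0.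
have := dotp_ge0 (enorm y *: x - enorm x *: y).
rewrite !(dotpBl, dotpBr, dotpZl, dotpZr) -!sqr_enorm (dotpC y x).
set a := enorm x in a0 *; set b := enorm y in b0 *; set d := dotp x y => h.
have : 0 <= (2 * (a * b)) * (a * b - d) by nra.
by rewrite pmulr_rge0 ?subr_ge0// ?mulr_gt0 ?mulr_gt0//.
Qed.

Lemma norm_dotp_le x y : `|dotp x y| <= enorm x * enorm y.
Proof.
rewrite ler_norml dotp_le_enorm andbT lerNl -dotpNl.
by rewrite (le_trans (dotp_le_enorm _ _))// enormN.
Qed.

Lemma enormD x y : enorm (x + y) <= enorm x + enorm y.
Proof.
rewrite -(@ler_pXn2r _ 2)// ?nnegrE ?addr_ge0 ?enorm_ge0//.
rewrite sqr_enorm !(dotpDl, dotpDr) (dotpC y x) -!sqr_enorm.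
have := dotp_le_enorm x y; nra.
Qed.

Lemma enormB_sub x y : enorm x - enorm y <= enorm (x - y).
Proof. by rewrite lerBlDr -{1}(subrK y x) enormD. Qed.

Lemma enorm_distC x y : enorm (x - y) = enorm (y - x).
Proof. by rewrite -enormN opprB. Qed.

Lemma coord_le_enorm x i : `|x 0 i| <= enorm x.
Proof.
rewrite -(@ler_pXn2r _ 2)// ?nnegrE ?enorm_ge0// real_normK ?num_real// sqr_enorm.
rewrite /dotp (bigD1 i)//= -expr2 lerDl.
by apply: sumr_ge0 => j _; rewrite -expr2 sqr_ge0.
Qed.

Lemma norm_le_enorm x : `|x| <= enorm x.
Proof.
rewrite [leLHS]/Num.norm/= mx_normrE (bigmax_le _ (enorm_ge0 x))//= => -[i j] _.
by rewrite /= ord1 coord_le_enorm.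
Qed.

Lemma coord_le_norm x i : `|x 0 i| <= `|x|.
Proof.
rewrite [leRHS]/Num.norm/= mx_normrE.
by apply/bigmax_geP; right => /=; exists (0, i).
Qed.

Lemma enorm_le_norm x : enorm x <= n%:R * `|x|.
Proof.
rewrite -(@ler_pXn2r _ 2)// ?nnegrE ?mulr_ge0 ?enorm_ge0// sqr_enorm.
have h : dotp x x <= \sum_(i < n) `|x| ^+ 2.
  apply: ler_sum => i _; rewrite -expr2 -[leLHS]real_normK ?num_real//.
  by rewrite lerXn2r ?nnegrE// coord_le_norm.
apply: (le_trans h); rewrite sumr_const card_ord exprMn -[leLHS]mulr_natl.
rewrite ler_wpM2r ?sqr_ge0// expr2 -natrM ler_nat; by case: (n) => // k; exact: leq_pmulr.
Qed.

Definition bf H u v : R := (u *m H *m v^T) 0 0.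
Definition qf H w : R := bf H w w.

Lemma bfDl H u v w : bf H (u + v) w = bf H u w + bf H v w.
Proof. by rewrite /bf !mulmxDl mxE. Qed.

Lemma bfDr H u v w : bf H w (u + v) = bf H w u + bf H w v.
Proof. by rewrite /bf linearD/= mulmxDr mxE. Qed.

Lemma bfZl H c u v : bf H (c *: u) v = c * bf H u v.
Proof. by rewrite /bf -!scalemxAl mxE. Qed.

Lemma bfZr H c u v : bf H u (c *: v) = c * bf H u v.
Proof. by rewrite /bf linearZ/= -scalemxAr mxE. Qed.

Lemma qfZ H c w : qf H (c *: w) = c ^+ 2 * qf H w.
Proof. by rewrite /qf bfZl bfZr mulrA -expr2. Qed.

Lemma qfDH H Q w : qf (H + Q) w = qf H w + qf Q w.
Proof. by rewrite /qf /bf mulmxDr mulmxDl mxE. Qed.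

Lemma qfZH H c w : qf (c *: H) w = c * qf H w.
Proof. by rewrite /qf /bf -scalemxAr -scalemxAl mxE. Qed.

Lemma qfNH H w : qf (- H) w = - qf H w.
Proof. by rewrite -scaleN1r qfZH mulN1r. Qed.

Lemma qfBH H Q w : qf (H - Q) w = qf H w - qf Q w.
Proof. by rewrite qfDH qfNH. Qed.

Lemma qf_scalar c w : qf c%:M w = c * dotp w w.
Proof.
rewrite /qf /bf mul_mx_scalar -scalemxAl mxE; congr (_ * _).
by rewrite mxE; apply: eq_bigr => i _; rewrite mxE.
Qed.

Lemma qf_outer y w : qf (y^T *m y) w = dotp y w ^+ 2.
Proof.
rewrite /qf /bf mulmxA -mulmxA mxE big_ord1.
have -> : (w *m y^T) 0 0 = dotp y w.
  by rewrite mxE; apply: eq_bigr => i _; rewrite mxE mulrC.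
rewrite [X in _ * X](_ : _ = dotp y w) ?expr2//.
by rewrite mxE; apply: eq_bigr => i _; rewrite mxE.
Qed.

Lemma tr_outer y : \tr (y^T *m y) = dotp y y.
Proof. by apply: eq_bigr => i _; rewrite mxE big_ord1 mxE. Qed.

Lemma bf_sum H u v : bf H u v = \sum_i \sum_j H i j * u 0 i * v 0 j.
Proof.
rewrite /bf mxE exchange_big /=; apply: eq_bigr => j _.
rewrite !mxE mulr_suml; apply: eq_bigr => i _.
by rewrite [in LHS]mulrC [RHS]mulrC mulrC -mulrA (mulrC _ (u _ _)); ring.
Qed.

Lemma bf_ebasis H i j : bf H (ebasis i) (ebasis j) = H i j.
Proof. by rewrite /bf /ebasis trmx_delta -rowE -colE !mxE. Qed.

(* The sum of the form over all e_j d_i - e_i d_j. *)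
Lemma psd_le_tr H w : (forall v, 0 <= qf H v) -> qf H w <= \tr H * dotp w w.
Proof.
move=> h.
have : 0 <= \sum_i \sum_j qf H (w 0 j *: ebasis i - w 0 i *: ebasis j).
  by apply: sumr_ge0 => i _; apply: sumr_ge0 => j _.
have -> : \sum_i \sum_j qf H (w 0 j *: ebasis i - w 0 i *: ebasis j) =
    \sum_i \sum_j (w 0 j ^+ 2 * H i i + w 0 i ^+ 2 * H j j
      - H i j * w 0 i * w 0 j - H j i * w 0 j * w 0 i).
  apply: eq_bigr => i _; apply: eq_bigr => j _.
  by rewrite -scaleNr /qf !(bfDl, bfDr, bfZl, bfZr) !bf_ebasis; ring.
rewrite (eq_bigr (fun i => H i i * dotp w w + w 0 i ^+ 2 * \tr H
   - \sum_j H i j * w 0 i * w 0 j - \sum_j H j i * w 0 j * w 0 i)); last first.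
  move=> i _; rewrite /mxtrace /dotp !mulr_sumr -!big_split/= -!sumrB.
  by apply: eq_bigr => j _; rewrite expr2; ring.
rewrite 2!sumrB big_split /= -!mulr_suml [X in _ - X]exchange_big /= -!bf_sum.
have -> : \sum_i w 0 i ^+ 2 = dotp w w by apply: eq_bigr => i _; rewrite expr2.
by rewrite -[\sum_i H i i]/(\tr H) -/(qf H w); lra.
Qed.

End Euclid.

(** * Second order expansions on lines *)

Section Calculus.
Context {R : realType}.
Implicit Types (f g : R -> R) (a b c d e h k s : R).

Lemma continuous_epsP (V : normedModType R) (f : V -> R) x :
  {for x, continuous f} <->
  forall e, 0 < e -> exists2 d : R, 0 < d & forall y, `|y - x| < d -> `|f y - f x| < e.
Proof.
split=> [/cvgrPdist_lt fx e e0|h].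
  have /nbhs_ballP[d d0 hd] := fx e e0; exists d => // y yx.
  by rewrite distrC; apply: hd; rewrite -ball_normE /= distrC.
apply/cvgrPdist_lt => e e0; have [d d0 hd] := h e e0.
apply/nbhs_ballP; exists d => // y; rewrite -ball_normE /= => yx.
by rewrite distrC; apply: hd; rewrite distrC.
Qed.

Lemma derivable_line (V : normedModType R) (f : V -> R) (y v : V) s :
  derivable f (y + s *: v) v ->
  is_derive s 1 (fun r : R => f (y + r *: v)) ('D_v f (y + s *: v)).
Proof.
have E : (fun h : R => h^-1 *: (((fun r : R => f (y + r *: v)) \o shift s) (h *: 1)
      - f (y + s *: v))) =
    (fun h : R => h^-1 *: ((f \o shift (y + s *: v)) (h *: v) - f (y + s *: v))).
  apply/funext => h /=; congr (_ *: (f _ - _)).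
  by rewrite -[h *: 1]/(h * 1) mulr1 scalerDl addrCA.
by move=> df; apply: DeriveDef; rewrite /derivable /derive E.
Qed.

Lemma is_derive_eps f (x df : R) : is_derive x 1 f df <->
  forall e, 0 < e -> exists2 d : R, 0 < d & forall h, `|h| < d ->
    `|f (x + h) - f x - df * h| <= e * `|h|.
Proof.
have E : (fun h : R => h^-1 *: ((f \o shift x) (h *: 1) - f x)) =
    (fun h : R => h^-1 * (f (x + h) - f x)).
  by apply/funext => h /=; rewrite -[h *: 1]/(h * 1) mulr1 (addrC h).
split=> [[dx dfE] e e0|h].
  move: dx; rewrite /derivable E => dx.
  move: dfE; rewrite /derive E => dfE.
  have {dx dfE} : (h^-1 * (f (x + h) - f x) @[h --> 0^']) --> df by rewrite -dfE.
  move=> /cvgrPdist_lt/(_ e e0); rewrite near_withinE => /nbhs_ballP[d d0 hd].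
  exists d => // h hd'; have [->|h0] := eqVneq h 0.
    by rewrite addr0 subrr mulr0 subr0 normr0 mulr0.
  have := hd h; rewrite -ball_normE /= sub0r normrN => /(_ hd' h0)/ltW.
  have hp : 0 < `|h| by rewrite normr_gt0.
  move=> /(ler_wpM2r (ltW hp)); rewrite distrC -normrM mulrBl mulrAC mulVf// mul1r.
  by [].
have cv : (h^-1 * (f (x + h) - f x) @[h --> 0^']) --> df.
  apply/cvgrPdist_le => e e0; rewrite near_withinE; have [d d0 hd] := h e e0.
  apply/nbhs_ballP; exists d => // k; rewrite -ball_normE /= sub0r normrN => /hd {}hd k0.
  have kp : 0 < `|k| by rewrite normr_gt0.
  rewrite -(ler_pM2r kp) distrC -normrM; apply: le_trans hd.
  by rewrite mulrBl mulrAC mulVf// mul1r.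
apply: DeriveDef; rewrite /derivable /derive E; first by apply/cvg_ex; exists df.
exact/cvg_lim.
Qed.

(** Second order Taylor expansion at 0 in Peano form, [b] being the second derivative. It is asked
    at one point only, which is all that a test at a maximum uses. *)
Definition jet2 f a b := forall e, 0 < e -> exists2 d : R, 0 < d &
  forall h, `|h| < d -> `|f h - f 0 - a * h - b / 2 * h ^+ 2| <= e * h ^+ 2.

(* Upper expansions suffice for barriers, which may be minima of smooth functions;
   [ujet1] is used backwards in time and inwards at the boundary, hence one-sided. *)
Definition ujet2 f a b := forall e, 0 < e -> exists2 d : R, 0 < d &
  forall h, `|h| < d -> f h - f 0 - a * h - b / 2 * h ^+ 2 <= e * h ^+ 2.

Definition ujet1 f a := forall e, 0 < e -> exists2 d : R, 0 < d &
  forall h, 0 < h < d -> f h - f 0 - a * h <= e * h.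

Lemma jet2_ujet2 f a b : jet2 f a b -> ujet2 f a b.
Proof.
move=> j e /j[d d0 hd]; exists d => // h /hd; exact: le_trans (ler_norm _).
Qed.

Lemma ujet2_ujet1 f a b : ujet2 f a b -> ujet1 f a.
Proof.
move=> j e e0; have [d d0 hd] := j 1 ltr01.
have b0 : 0 < 1 + `|b| by rewrite ltr_pwDl.
exists (Num.min d (e / (1 + `|b|))); first by rewrite lt_min d0 divr_gt0.
move=> h /andP[h0]; rewrite lt_min => /andP[hdl]; rewrite ltr_pdivlMr// => he.
have := hd h; rewrite gtr0_norm// => /(_ hdl) hh.
have h1 : h * (h * (1 + `|b|)) <= h * e by rewrite ler_wpM2l ?ltW.
have h2 : b / 2 * h ^+ 2 <= `|b| * h ^+ 2.
  by rewrite ler_wpM2r ?sqr_ge0//; have := ler_norm b; have := normr_ge0 b; lra.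
by lra.
Qed.

Lemma jet2N f a b : jet2 f a b -> jet2 (fun h => - f h) (- a) (- b).
Proof.
move=> j e /j[d d0 hd]; exists d => // h /hd; rewrite -normrN.
by rewrite [X in _ -> `|X| <= _](_ : _ = - (f h - f 0 - a * h - b / 2 * h ^+ 2)); [|ring].
Qed.

Lemma jet2D f g a b c (d : R) : jet2 f a b -> jet2 g c d ->
  jet2 (fun h => f h + g h) (a + c) (b + d).
Proof.
move=> jf jg e e0; have e20 : 0 < e / 2 by lra.
have [d1 d10 h1] := jf _ e20; have [d2 d20 h2] := jg _ e20.
exists (Num.min d1 d2) => [|h]; first by rewrite lt_min d10.
rewrite lt_min => /andP[/h1 {}h1 /h2 {}h2].
apply: le_trans (_ : _ <= `|f h - f 0 - a * h - b / 2 * h ^+ 2| +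
                          `|g h - g 0 - c * h - d / 2 * h ^+ 2|) _; last by lra.
apply: le_trans (ler_normD _ _); rewrite le_eqVlt; apply/orP; left; apply/eqP.
by congr `|_|; ring.
Qed.

Lemma ujet2D f g a b c (d : R) : ujet2 f a b -> ujet2 g c d ->
  ujet2 (fun h => f h + g h) (a + c) (b + d).
Proof.
move=> jf jg e e0; have e20 : 0 < e / 2 by lra.
have [d1 d10 h1] := jf _ e20; have [d2 d20 h2] := jg _ e20.
exists (Num.min d1 d2) => [|h]; first by rewrite lt_min d10.
by rewrite lt_min => /andP[/h1 {}h1 /h2 {}h2]; lra.
Qed.

Lemma jet2Z (k : R) f a b : jet2 f a b -> jet2 (fun h => k * f h) (k * a) (k * b).
Proof.
move=> j e e0; have k0 : 0 < 1 + `|k| by rewrite ltr_pwDl.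
have [d d0 hd] := j (e / (1 + `|k|)) (divr_gt0 e0 k0).
exists d => // h /hd {}hd.
rewrite (_ : _ - _ = k * (f h - f 0 - a * h - b / 2 * h ^+ 2)); last by ring.
rewrite normrM; apply: le_trans (ler_wpM2l (normr_ge0 k) hd) _.
rewrite mulrA ler_wpM2r ?sqr_ge0// mulrA ler_pdivrMr// mulrC.
by rewrite ler_wpM2l ?ltW// ltrDr.
Qed.

Lemma jet2_poly a b c : jet2 (fun h => c + a * h + b / 2 * h ^+ 2) a b.
Proof.
move=> e e0; exists 1 => // h _.
rewrite (_ : _ - b / 2 * h ^+ 2 = 0); last by rewrite expr0n/=; ring.
by rewrite normr0 mulr_ge0 ?sqr_ge0 ?ltW.
Qed.

Lemma ujet2_le f g a b (d : R) : f 0 = g 0 -> 0 < d ->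
  (forall h, `|h| < d -> f h <= g h) -> ujet2 g a b -> ujet2 f a b.
Proof.
move=> f0 d0 fg j e /j[d' d'0 hd]; exists (Num.min d d'); first by rewrite lt_min d0.
move=> h; rewrite lt_min => /andP[/fg fgh /hd]; rewrite f0; lra.
Qed.

Lemma ujet1_le f g a (d : R) : f 0 = g 0 -> 0 < d ->
  (forall h, 0 < h < d -> f h <= g h) -> ujet1 g a -> ujet1 f a.
Proof.
move=> f0 d0 fg j e /j[d' d'0 hd]; exists (Num.min d d'); first by rewrite lt_min d0.
move=> h; rewrite lt_min => /andP[h0 /andP[hd1 hd2]].
have := fg h; rewrite h0 hd1 => /(_ erefl) fgh.
have := hd h; rewrite h0 hd2 => /(_ erefl); rewrite f0; lra.
Qed.

(** Admits a remainder of third order, the form in which the bounds for the square root penalty come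
    out. *)
Lemma ujet2_cubic f a b c (d : R) : 0 < d ->
  (forall h, `|h| < d -> f h <= f 0 + a * h + b / 2 * h ^+ 2 + c * `|h| ^+ 3) ->
  ujet2 f a b.
Proof.
move=> d0 hf e e0; have c0 : 0 < 1 + `|c| by rewrite ltr_pwDl.
exists (Num.min d (e / (1 + `|c|))); first by rewrite lt_min d0 divr_gt0.
move=> h; rewrite lt_min ltr_pdivlMr// => /andP[/hf hfh he].
have : c * `|h| ^+ 3 <= e * h ^+ 2; last by lra.
rewrite -(real_normK (num_real h)) exprS mulrA ler_wpM2r ?sqr_ge0//.
have := ler_norm c; have := normr_ge0 h; nra.
Qed.

Lemma small_linear_le0 a : (forall e, 0 < e -> exists2 d : R, 0 < d &
    forall h, 0 < h < d -> a * h <= e * h) -> a <= 0.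
Proof.
move=> H; rewrite leNgt; apply/negP => a0.
have /H[d d0 hd] : 0 < a / 2 by rewrite divr_gt0.
have := hd (d / 2); rewrite divr_gt0//= ltr_pdivrMr// ltr_pMr// ltr1n => /(_ erefl).
by rewrite ler_pM2r ?divr_gt0// => ?; lra.
Qed.

Lemma small_quadratic_le0 a b : (forall e, 0 < e -> exists2 d : R, 0 < d &
    forall h, `|h| < d -> a * h + b * h ^+ 2 <= e * h ^+ 2) -> a = 0 /\ b <= 0.
Proof.
move=> H.
have one s : `|s| = 1 -> s * a <= 0.
  move=> s1; apply: small_linear_le0 => e e0; have [d d0 hd] := H 1 ltr01.
  have b0 : 0 < 1 + `|b| by rewrite ltr_pwDl.
  exists (Num.min d (e / (1 + `|b|))); first by rewrite lt_min d0 divr_gt0.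
  move=> h /andP[h0]; rewrite lt_min ltr_pdivlMr// => /andP[hdd he].
  have := hd (s * h); rewrite normrM s1 !mul1r gtr0_norm// => /(_ hdd).
  have s2 : s ^+ 2 = 1 by rewrite -(real_normK (num_real s)) s1 expr1n.
  rewrite exprMn s2 !mul1r => hb.
  have h1 : h * (h * (1 + `|b|)) <= h * e by rewrite ler_wpM2l ?ltW.
  have h2 : - b * h ^+ 2 <= `|b| * h ^+ 2.
    by rewrite ler_wpM2r ?sqr_ge0// -normrN ler_norm.
  by lra.
have a0 : a = 0.
  apply/eqP; rewrite eq_le; have := one 1 (normr1 _); rewrite mul1r => ->/=.
  by have := one (- 1) (normrN1 _); rewrite mulN1r oppr_le0.
split => //; apply: small_linear_le0 => e /H[d d0 hd].
(* With the linear term gone, the inequality is read at the square root of h, where it becomes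
   linear; h < d^2 keeps that root below d. *)
exists (Num.min d (d ^+ 2)); first by rewrite lt_min d0 exprn_gt0.
move=> h /andP[h0]; rewrite lt_min => /andP[_ hdd].
have := hd (Num.sqrt h); rewrite ger0_norm ?sqrtr_ge0// (sqr_sqrtr (ltW h0)).
rewrite a0 mul0r add0r; apply; rewrite -(@ltr_pXn2r _ 2)// ?nnegrE ?(ltW d0) ?sqrtr_ge0//.
by rewrite (sqr_sqrtr (ltW h0)).
Qed.

(** The lower half of the expansion of f is played against the upper expansion of g. Both signs of h
    are allowed, so the first order terms must agree before the second order terms can be
    compared. *)
Lemma jet2_max f g a b c (b' d : R) : 0 < d ->
  (forall h, `|h| < d -> f h - g h <= f 0 - g 0) ->
  jet2 f a b -> ujet2 g c b' -> a = c /\ b <= b'.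
Proof.
move=> d0 hmax jf jg.
have [] := @small_quadratic_le0 (a - c) ((b - b') / 2).
  move=> e e0; have e20 : 0 < e / 2 by lra.
  have [d1 d10 h1] := jf _ e20; have [d2 d20 h2] := jg _ e20.
  exists (Num.min d (Num.min d1 d2)) => [|h]; first by rewrite !lt_min d0 d10.
  rewrite !lt_min => /and3P[/hmax hm /h1 {}h1 /h2 {}h2].
  by move: h1; rewrite ler_norml => /andP[h1 _]; lra.
by move=> h1 h2; split; lra.
Qed.

Lemma ujet1_max f g a c (d : R) : 0 < d ->
  (forall h, 0 < h < d -> f h - g h <= f 0 - g 0) ->
  ujet1 (fun h => - f h) (- a) -> ujet1 g c -> a <= c.
Proof.
move=> d0 hmax jf jg; rewrite -subr_le0; apply: small_linear_le0 => e e0.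
have e20 : 0 < e / 2 by lra.
have [d1 d10 h1] := jf _ e20; have [d2 d20 h2] := jg _ e20.
exists (Num.min d (Num.min d1 d2)) => [|h]; first by rewrite !lt_min d0 d10.
rewrite !lt_min => /andP[h0 /and3P[hd hd1 hd2]].
have := hmax h; rewrite h0 hd => /(_ erefl).
have := h1 h; rewrite h0 hd1 => /(_ erefl).
have := h2 h; rewrite h0 hd2 => /(_ erefl).
lra.
Qed.

Lemma mean_value f (df : R -> R) a b : (forall x : R, is_derive x 1 f (df x)) ->
  exists2 c, `|c - a| <= `|b - a| & f b - f a = df c * (b - a).
Proof.
move=> hf; have cf : continuous f.
  by move=> x; apply: differentiable_continuous; apply/derivable1_diffP; have [] := hf x.
have [ab|ba] := leP a b.
  have [c] := MVT_segment ab (fun x _ => hf x) (continuous_subspaceT cf).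
  rewrite in_itv /= => /andP[ac cb] E; exists c => //.
  by rewrite (ger0_norm (_ : 0 <= c - a)) ?ger0_norm; lra.
have [c] := MVT_segment (ltW ba) (fun x _ => hf x) (continuous_subspaceT cf).
rewrite in_itv /= => /andP[bc ca] E; exists c; last first.
  by apply: oppr_inj; rewrite opprB E; ring.
by rewrite (ler0_norm (_ : c - a <= 0)) ?ler0_norm; lra.
Qed.

Lemma quadratic_is_derive a b c (y : R) :
  is_derive y 1 (fun h => c + a * h + b * h ^+ 2) (a + 2 * b * y).
Proof.
apply/is_derive_eps => e e0; have b1 : 0 < `|b| + 1 by rewrite ltr_wpDl.
exists (e / (`|b| + 1)) => [|k]; first by rewrite divr_gt0.
rewrite ltr_pdivlMr// => hk.
set D := (X in `|X| <= _); have -> : D = b * k * k by rewrite /D; ring.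
rewrite !normrM ler_wpM2r//; apply: ltW; apply: le_lt_trans hk.
by rewrite mulrC ler_wpM2l// lerDl.
Qed.

(** Mean value theorem for f minus its second order polynomial: the derivative of the difference is
    o(h), so the difference is o(h^2). *)
Lemma jet2_is_derive f (f1 : R -> R) b : (forall h : R, is_derive h 1 f (f1 h)) ->
  is_derive (0 : R) 1 f1 b -> jet2 f (f1 0) b.
Proof.
move=> hf /is_derive_eps hb e e0; have [d d0 hd] := hb e e0; exists d => // h hlt.
have hg (y : R) : is_derive y 1 (fun y => f y - (0 + f1 0 * y + b / 2 * y ^+ 2))
    (f1 y - (f1 0 + b * y)).
  have -> : b * y = 2 * (b / 2) * y by field.
  exact: (is_deriveB (hf y) (quadratic_is_derive (f1 0) (b / 2) 0 y)).
have [c] := mean_value 0 h hg; rewrite !subr0 => cx.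
rewrite expr0n/= !mulr0 !addr0 subr0 => E.
have -> : f h - f 0 - f1 0 * h - b / 2 * h ^+ 2 =
   f h - (0 + f1 0 * h + b / 2 * h ^+ 2) - f 0 by ring.
rewrite E normrM.
have := hd c (le_lt_trans cx hlt); rewrite add0r => hc.
have -> : f1 c - (f1 0 + b * c) = f1 c - f1 0 - b * c by ring.
rewrite -(real_normK (num_real h)) expr2 mulrA ler_wpM2r//.
by apply: le_trans hc _; rewrite ler_wpM2l// ltW.
Qed.

Lemma jet2_expR c a b : jet2 (fun h => expR (c + a * h + b * h ^+ 2))
  (a * expR c) ((2 * b + a ^+ 2) * expR c).
Proof.
pose q (h : R) := c + a * h + b * h ^+ 2.
have dq (h : R) : is_derive h 1 q (a + 2 * b * h) by exact: quadratic_is_derive.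
have de (h : R) : is_derive h 1 (expR \o q) ((a + 2 * b * h) * expR (q h)).
  by apply: is_derive_eq; rewrite mulrC.
have q0 : q 0 = c by rewrite /q expr0n/= !mulr0 !addr0.
have := @jet2_is_derive (expR \o q) (fun h => (a + 2 * b * h) * expR (q h))
   ((2 * b + a ^+ 2) * expR c) de.
rewrite /= q0 mulr0 addr0; apply.
have dl : is_derive (0 : R) 1 (fun h => a + 2 * b * h + 0 * h ^+ 2) (2 * b + 2 * 0 * 0).
  exact: quadratic_is_derive.
have -> : (fun h => (a + 2 * b * h) * expR (q h)) =
   (fun h => a + 2 * b * h + 0 * h ^+ 2) * (expR \o q).
  by apply/funext => h; rewrite [RHS]/GRing.mul /= mul0r addr0.
apply: (is_derive_eq (is_deriveM dl (de 0))); rewrite /GRing.scale /= q0; ring.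
Qed.

End Calculus.

(** * Functions with continuous partial derivatives *)

Section C1.
Context {R : realType}.

Definition trunc_row m (k : nat) (w : 'rV[R]_m) : 'rV[R]_m :=
  \row_i (if (i < k)%N then w 0 i else 0).

Lemma trunc_rowS m (k : 'I_m) (w : 'rV[R]_m) :
  trunc_row k.+1 w = trunc_row k w + w 0 k *: ebasis k.
Proof.
apply/rowP => i; rewrite !mxE eqxx /= ltnS leq_eqVlt.
have [->|ik] := eqVneq i k; first by rewrite eqxx ltnn mulr1 add0r.
have ik' : (i == k :> nat) = false by exact/negbTE.
by rewrite ik' mulr0 addr0.
Qed.

Lemma norm_trunc_row m (k : 'I_m) (w : 'rV[R]_m) (c : R) : `|c| <= `|w 0 k| ->
  `|trunc_row k w + c *: ebasis k| <= `|w|.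
Proof.
move=> cw; rewrite [leLHS]/Num.norm/= mx_normrE (bigmax_le _ (normr_ge0 _))//= => -[i j] _.
rewrite /= ord1 !mxE eqxx /=; have [->|jk] := eqVneq j k.
  by rewrite ltnn add0r mulr1 (le_trans cw)// coord_le_norm.
by rewrite mulr0 addr0; case: ifP; rewrite ?coord_le_norm ?normr0.
Qed.

(** The coordinates of w are switched on one at a time and each increment obeys the mean value
    theorem along one axis. By [norm_trunc_row] all intermediate points stay within |w| of x, where
    the partial derivatives vary little. *)
Lemma C1_expansion m (f : 'rV[R]_m -> R) :
  (forall i (x : 'rV[R]_m), derivable f x (ebasis i)) ->
  (forall i, continuous (partial i f)) ->
  forall (x : 'rV[R]_m) (e : R), 0 < e ->
  exists2 d : R, 0 < d & forall w, `|w| < d ->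
    `|f (x + w) - f x - dotp (grad f x) w| <= e * `|w|.
Proof.
move=> df cf x e e0.
have e1 : 0 < e / (1 + m%:R) by rewrite divr_gt0// ltr_pwDl.
have h i : \forall y \near x, `|partial i f y - partial i f x| < e / (1 + m%:R).
  have /cvgrPdist_lt/(_ _ e1)/filterS := cf i x.
  by apply => y; rewrite distrC.
have := filter_forall (nbhs_filter x) h; rewrite /prop_near1.
move=> /nbhs_ballP[d d0 hd]; exists d => // w wd.
have -> : f (x + w) - f x - dotp (grad f x) w =
    \sum_(k < m) (f (x + trunc_row k.+1 w) - f (x + trunc_row k w)
       - partial k f x * w 0 k).
  rewrite sumrB; congr (_ - _); last by apply: eq_bigr => i _; rewrite mxE.
  rewrite -(big_mkord xpredT (fun k => f (x + trunc_row k.+1 w) - f (x + trunc_row k w))).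
  rewrite telescope_sumr//; congr (f _ - f _); apply/rowP => i; rewrite !mxE ?addr0//.
  by rewrite ltn_ord.
have {}h (k : 'I_m) : `|f (x + trunc_row k.+1 w) - f (x + trunc_row k w) - partial k f x * w 0 k|
   <= e / (1 + m%:R) * `|w|.
  rewrite trunc_rowS addrA; set y := x + trunc_row k w.
  have [c] := mean_value 0 (w 0 k)
    (fun s => derivable_line (df k (y + s *: ebasis k))).
  rewrite !subr0 scale0r addr0 => cw ->.
  rewrite -mulrBl normrM; apply: ler_pM => //; last exact: coord_le_norm.
  apply/ltW/hd; rewrite -ball_normE /= /y opprD addrA opprD addrA subrr add0r -opprD.
  by rewrite normrN (le_lt_trans _ wd)// norm_trunc_row.
apply: (le_trans (ler_norm_sum _ _ _)); apply: (le_trans (ler_sum _ (fun k _ => h k))).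
rewrite sumr_const card_ord -[leLHS]mulr_natl mulrA ler_wpM2r// mulrCA ler_piMr ?ltW//.
by rewrite ltr_pdivrMr ?mul1r ?ltr_pwDl// ltrDr.
Qed.

Lemma C1_is_derive m (f : 'rV[R]_m -> R) :
  (forall i (x : 'rV[R]_m), derivable f x (ebasis i)) ->
  (forall i, continuous (partial i f)) ->
  forall (x w : 'rV[R]_m) (s : R), is_derive s 1 (fun r : R => f (x + r *: w)) (dotp (grad f (x + s *: w)) w).
Proof.
move=> df cf x w s; apply/is_derive_eps => e e0.
have w0 : 0 < 1 + `|w| by rewrite ltr_pwDl.
have [d d0 hd] := C1_expansion df cf (x + s *: w) (divr_gt0 e0 w0).
exists (d / (1 + `|w|)); first exact: divr_gt0.
move=> h; rewrite ltr_pdivlMr// => hh.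
have {}hh : `|h *: w| < d.
  by rewrite normrZ; apply: le_lt_trans hh; rewrite ler_wpM2l// lerDr.
rewrite scalerDl addrA -[dotp _ _ * h]mulrC -dotpZr (le_trans (hd _ hh))//.
rewrite normrZ [`|h| * _]mulrC mulrA ler_wpM2r// -mulrA ler_piMr ?(ltW e0)//.
by rewrite ler_pdivrMl// mulr1 lerDr.
Qed.

Lemma C1_continuous m (f : 'rV[R]_m -> R) :
  (forall i (x : 'rV[R]_m), derivable f x (ebasis i)) ->
  (forall i, continuous (partial i f)) -> continuous f.
Proof.
move=> df cf x; apply/continuous_epsP => e e0.
have [d d0 hd] := C1_expansion df cf x ltr01.
have g0 : 0 < 2 + m%:R * enorm (grad f x) by rewrite ltr_pwDl// mulr_ge0// enorm_ge0.
exists (Num.min d (e / (2 + m%:R * enorm (grad f x)))); first by rewrite lt_min d0 divr_gt0.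
move=> y; rewrite lt_min ltr_pdivlMr// => /andP[/hd {}hd yx].
move: hd; rewrite mul1r [x + _]addrC subrK => hd.
have h2 : `|dotp (grad f x) (y - x)| <= enorm (grad f x) * (m%:R * `|y - x|).
  apply: le_trans (norm_dotp_le _ _) _.
  by rewrite ler_wpM2l ?enorm_ge0// enorm_le_norm.
have h3 : `|f y - f x| <= `|f y - f x - dotp (grad f x) (y - x)| +
    `|dotp (grad f x) (y - x)|.
  by apply: le_trans (ler_normD _ _); rewrite subrK.
have : 0 <= `|y - x| by [].
lra.
Qed.

End C1.

(** * Smooth functions of space and time *)

Section SpaceTime.
Context {R : realType} {n : nat}.
Implicit Types (x w : 'rV[R]_n) (t h : R) (P : 'rV[R]_(n + 1) -> R).

Definition hess P t x : 'M[R]_n :=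
  \matrix_(i, j) partial (lshift 1 j) (partial (lshift 1 i) P) (st x t).

Lemma st_line x w t h : st (x + h *: w) t = st x t + h *: row_mx w 0.
Proof. by rewrite /st scale_row_mx add_row_mx scaler0 addr0. Qed.

Lemma st_time x t h : st x (t + h) = st x t + h *: ebasis (rshift n ord0).
Proof.
rewrite /st; have -> : ebasis (rshift n ord0) = row_mx 0 (const_mx 1) :> 'rV[R]_(n + 1).
  apply/rowP => i; rewrite !mxE; case: split_ordP => j ->; rewrite eqxx ?eq_lrshift ?eq_rshift mxE//=.
  by rewrite ord1 eqxx.
rewrite scale_row_mx add_row_mx scaler0 addr0; congr row_mx.
by apply/rowP => i; rewrite !mxE mulr1.
Qed.

Lemma ebasis_lshift (i : 'I_n) : ebasis (lshift 1 i) = row_mx (ebasis i) 0 :> 'rV[R]_(n + 1).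
Proof.
apply/rowP => k; rewrite !mxE; case: split_ordP => j ->; rewrite eqxx ?eq_lshift ?eq_rlshift !mxE//=.
Qed.

Lemma gradxE P t x i : gradx P t x 0 i = partial (lshift 1 i) P (st x t).
Proof.
rewrite mxE /partial /derive.
have -> : (fun h : R => h^-1 *: (((fun z => P (st z t)) \o shift x) (h *: ebasis i) - P (st x t)))
   = (fun h : R => h^-1 *: ((P \o shift (st x t)) (h *: ebasis (lshift 1 i)) - P (st x t))).
  by apply/funext => h /=; rewrite ebasis_lshift [_ *: ebasis i + x]addrC st_line [st x t + _]addrC.
by [].
Qed.

Lemma dotp_row_mx0 (v : 'rV[R]_(n + 1)) w :
  dotp v (row_mx w 0) = \sum_i v 0 (lshift 1 i) * w 0 i.
Proof.
rewrite /dotp big_split_ord /= [X in _ + X]big1 ?addr0 => [|i _].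
  by apply: eq_bigr => i _; rewrite row_mxEl.
by rewrite row_mxEr mxE mulr0.
Qed.

Section C2.
Variable P : 'rV[R]_(n + 1) -> R.
Hypothesis C2P : Ck 2 P.

Lemma C2_partial_derivable i (y : 'rV[R]_(n + 1)) : derivable P y (ebasis i).
Proof. by have [_ h] := @C2P [::] isT; apply: h. Qed.

Lemma C2_partial_continuous i : continuous (partial i P).
Proof. by have [h _] := @C2P [:: i] isT. Qed.

Lemma C2_partial2_derivable i j (y : 'rV[R]_(n + 1)) :
  derivable (partial i P) y (ebasis j).
Proof. by have [_ h] := @C2P [:: i] isT; apply: h. Qed.

Lemma C2_partial2_continuous i j : continuous (partial j (partial i P)).
Proof. by have [h _] := @C2P [:: j; i] isT. Qed.

Lemma C2_continuous : continuous P.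
Proof. by have [] := @C2P [::] isT. Qed.

Lemma C2_space_is_derive x w t (s : R) :
  is_derive s 1 (fun r => P (st (x + r *: w) t)) (dotp (gradx P t (x + s *: w)) w).
Proof.
have := C1_is_derive C2_partial_derivable C2_partial_continuous (st x t) (row_mx w 0) s.
have -> : (fun r => P (st x t + r *: row_mx w 0)) = (fun r => P (st (x + r *: w) t)).
  by apply/funext => r; rewrite st_line.
rewrite -st_line dotp_row_mx0; congr (is_derive _ _ _ _).
by apply: eq_bigr => i _; rewrite mxE gradxE.
Qed.

Lemma C2_gradx_is_derive x w t (s : R) i :
  is_derive s 1 (fun r => gradx P t (x + r *: w) 0 i)
    (\sum_j hess P t (x + s *: w) i j * w 0 j).
Proof.
have := C1_is_derive (@C2_partial2_derivable (lshift 1 i))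
  (@C2_partial2_continuous (lshift 1 i)) (st x t) (row_mx w 0) s.
have -> : (fun r => partial (lshift 1 i) P (st x t + r *: row_mx w 0)) =
    (fun r => gradx P t (x + r *: w) 0 i).
  by apply/funext => r; rewrite gradxE st_line.
rewrite -st_line dotp_row_mx0; congr (is_derive _ _ _ _).
by apply: eq_bigr => j _; rewrite !mxE.
Qed.

Lemma C2_jet2 x w t :
  jet2 (fun r => P (st (x + r *: w) t)) (dotp (gradx P t x) w) (qf (hess P t x) w).
Proof.
have := jet2_is_derive (C2_space_is_derive x w t).
rewrite scale0r addr0; apply.
have -> : (fun s => dotp (gradx P t (x + s *: w)) w) =
    \sum_i w 0 i *: (fun s => gradx P t (x + s *: w) 0 i).
  apply/funext => s; rewrite fct_sumE; apply: eq_bigr => i _.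
  by rewrite mulrC.
have h i := C2_gradx_is_derive x w t 0 i.
apply: is_derive_eq; rewrite /qf bf_sum scale0r addr0; apply: eq_bigr => i _.
rewrite /GRing.scale /= mulr_sumr; apply: eq_bigr => j _; ring.
Qed.

Lemma C2_time_is_derive x t :
  is_derive t 1 (fun s => P (st x s)) (time_deriv P x t).
Proof.
have [d _] := derivable_line (@C2_partial_derivable (rshift n ord0) (st x 0 + t *: ebasis (rshift n ord0))).
move: d; have -> : (fun r => P (st x 0 + r *: ebasis (rshift n ord0))) =
  (fun r => P (st x r)) by apply/funext => r; rewrite -st_time add0r.
by move=> d; apply: DeriveDef.
Qed.

End C2.

Lemma st_continuous : continuous (fun z : 'rV[R]_n * R => st z.1 z.2).
Proof.
move=> [x t]; apply/cvgrPdist_lt => e e0.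
near=> z.
have [h1 h2] : `|x - z.1| < e /\ `|t - z.2| < e.
  split; near: z.
    have : {for (x, t), continuous (fst : 'rV[R]_n * R -> 'rV[R]_n)} by exact: cvg_fst.
    by move=> /cvgrPdist_lt/(_ e e0).
  have : {for (x, t), continuous (snd : 'rV[R]_n * R -> R)} by exact: cvg_snd.
  by move=> /cvgrPdist_lt/(_ e e0).
rewrite [ltLHS]/Num.norm/= mx_normrE (bigmax_lt _ e0)//= => -[i j] _ /=.
rewrite ord1 !mxE; case: split_ordP => k _.
  by apply: le_lt_trans h1; have := coord_le_norm (x - z.1) k; rewrite !mxE.
by rewrite !mxE.
Unshelve. all: by end_near. Qed.

End SpaceTime.

(** * The diffusivity K *)

(* [th xi] stands for - xi K'(xi) / K(xi) and [a] for its limit at infinity. *)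
Record diffusivity {R : realType} (K th : R -> R) (a : R) : Prop := Diffusivity {
  diff_gt0 : forall xi, 0 <= xi -> 0 < K xi;
  diff_anti : forall xi1 xi2, 0 <= xi1 -> xi1 <= xi2 -> K xi2 <= K xi1;
  diff_flux_le : forall xi1 xi2, 0 <= xi1 -> xi1 <= xi2 -> xi1 * K xi1 <= xi2 * K xi2;
  diff_flux_infty : forall B, exists2 X, 0 < X & forall xi, X <= xi -> B <= xi * K xi;
  diff_lt1 : a < 1;
  diff_th : forall xi, 0 <= xi -> 0 <= th xi <= a;
  diff_th_infty : forall e, 0 < e -> exists2 X, 0 < X &
    forall xi, X <= xi -> `|th xi - a| <= e
}.

Section Forchheimer.
Context {R : realType} {N : nat}.
Variables (al : 'I_N.+1 -> R) (av : 'rV[R]_N.+1).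
Hypotheses (N1 : (1 <= N)%N) (al0 : al ord0 = 0)
  (al_lt : forall i j : 'I_N.+1, (i < j)%N -> al i < al j) (adm : admissible av).

Local Notation g := (gfun al av).
Local Notation sf := (Defs.sfun al av).
Local Notation K := (Kfun al av).
Local Notation alN := (al ord_max).

(** The derivative of s g(s). *)
Let dG (s : R) := \sum_j av 0 j * (1 + al j) * s `^ al j.
(** From xi = s g(s) one gets K = s / xi and s' = 1 / (s g)', hence - xi K' / K = 1 - xi s' / s = 1
    - g / (s g)'. *)
Definition theta (xi : R) : R := 1 - g (sf xi) / dG (sf xi).

Let av_ge0 j : 0 <= av 0 j. Proof. by case: adm => _ [_]. Qed.

Let al_ge0 j : 0 <= al j.
Proof.
have [->|j0] := eqVneq j ord0; first by rewrite al0.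
by apply/ltW; rewrite -al0; apply: al_lt; rewrite lt0n.
Qed.

Let al_le j : al j <= alN.
Proof.
have [->//|jm] := eqVneq j ord_max.
apply/ltW/al_lt; rewrite /= ltn_neqAle -ltnS ltn_ord andbT.
by apply: contra jm => /eqP jm; apply/eqP/val_inj.
Qed.

Let alN_gt0 : 0 < alN.
Proof. by rewrite -al0; apply: al_lt. Qed.

Let g_le s1 s2 : 0 <= s1 -> s1 <= s2 -> g s1 <= g s2.
Proof.
move=> s10 s12; apply: ler_sum => j _; rewrite ler_wpM2l//.
by rewrite ge0_ler_powR ?nnegrE// (le_trans s10).
Qed.

Let a0_le_g s : 0 <= s -> av 0 0 <= g s.
Proof.
move=> s0; rewrite /gfun (bigD1 ord0)//= al0 powRr0 mulr1 lerDl.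
by apply: sumr_ge0 => j _; rewrite mulr_ge0// powR_ge0.
Qed.

Let a0_gt0 : 0 < av 0 0. Proof. by case: adm. Qed.

Let g_gt0 s : 0 <= s -> 0 < g s.
Proof. by move=> /a0_le_g; exact: lt_le_trans. Qed.

Let G s := s * g s.

Let G_lt s1 s2 : 0 <= s1 -> s1 < s2 -> G s1 < G s2.
Proof.
move=> s10 s12; rewrite /G; apply: (@le_lt_trans _ _ (s1 * g s2)).
  by rewrite ler_wpM2l// g_le// ltW.
by rewrite ltr_pM2r// g_gt0// (le_trans s10)// ltW.
Qed.

Let G_le s1 s2 : 0 <= s1 -> s1 <= s2 -> G s1 <= G s2.
Proof.
by move=> s10; rewrite le_eqVlt => /orP[/eqP->//|s12]; apply/ltW/G_lt.
Qed.

Let G_inj s1 s2 : 0 <= s1 -> 0 <= s2 -> G s1 = G s2 -> s1 = s2.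
Proof.
move=> s10 s20 E; have [s12|s21|//] := ltgtP s1 s2.
  by have := G_lt s10 s12; rewrite E ltxx.
by have := G_lt s20 s21; rewrite E ltxx.
Qed.

Let is_derive_G (s : R) : 0 < s -> is_derive s 1 G (dG s).
Proof.
move=> s0; have -> : G = \sum_j av 0 j *: (id * (@powR R ^~ (al j))).
  apply/funext => r; rewrite fct_sumE /G /gfun mulr_sumr; apply: eq_bigr => j _.
  by rewrite !fctE mulrCA.
have h j := is_derive1_powR (al j) s0.
apply: is_derive_eq; apply: eq_bigr => j _.
have -> : s *: (al j * s `^ (al j - 1)) + s `^ al j *: (1 : R) = (1 + al j) * s `^ al j.
  have E : s * (al j * s `^ (al j - 1)) = al j * s `^ al j.
    have [->|aj] := eqVneq (al j) 0; first by rewrite !mul0r mulr0.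
    by rewrite mulrCA mulr_powRB1 ?(ltW s0)// lt_def aj al_ge0.
  by rewrite /GRing.scale /= E; ring.
by rewrite /GRing.scale /= mulrA.
Qed.

Let G_surj xi : 0 <= xi -> exists2 s, 0 <= s & G s = xi.
Proof.
rewrite le_eqVlt => /orP[/eqP<-|x0]; first by exists 0; rewrite // /G mul0r.
have g1 : 0 < g 1 by rewrite g_gt0.
(* The left end stays positive, since the powers need not be differentiable at 0; continuity on the
   segment is obtained from differentiability. *)
pose lo := Num.min 1 (xi / g 1).
have lo0 : 0 < lo by rewrite lt_min ltr01 divr_gt0.
have Glo : G lo <= xi.
  apply: (@le_trans _ _ (lo * g 1)).
    by rewrite /G ler_wpM2l ?(ltW lo0)// g_le ?(ltW lo0)// ge_min lexx.
  by rewrite -ler_pdivlMr// ge_min lexx orbT.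
pose hi := Num.max lo (xi / av 0 0).
have lohi : lo <= hi by rewrite le_max lexx.
have hi0 : 0 <= hi by rewrite (le_trans (ltW lo0)).
have Ghi : xi <= G hi.
  apply: (@le_trans _ _ (hi * av 0 0)); last by rewrite /G ler_wpM2l// a0_le_g.
  by rewrite -ler_pdivrMr// le_max lexx orbT.
have cG : {within `[lo, hi], continuous G}.
  apply: derivable_within_continuous => s; rewrite in_itv /= => /andP[los _].
  by have [] := is_derive_G (lt_le_trans lo0 los).
have [|c] := @IVT R G lo hi xi lohi cG; first by rewrite ge_min Glo le_max Ghi orbT.
by rewrite in_itv /= => /andP[loc _] <-; exists c => //; rewrite (le_trans (ltW lo0)).
Qed.

Let sfP xi : 0 <= xi -> 0 <= sf xi /\ G (sf xi) = xi.
Proof.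
move=> /G_surj[s s0 Gs]; rewrite /Defs.sfun.
by case: xgetP => [r _ //|h]; case: (h s).
Qed.

Let sf_ge0 xi : 0 <= xi -> 0 <= sf xi. Proof. by move=> /sfP[]. Qed.
Let sfK xi : 0 <= xi -> G (sf xi) = xi. Proof. by move=> /sfP[]. Qed.
Let GK s : 0 <= s -> sf (G s) = s.
Proof.
move=> s0; have Gs : 0 <= G s by rewrite /G mulr_ge0// ltW// g_gt0.
by apply: G_inj => //; [exact: sf_ge0|exact: sfK].
Qed.

Let sf_le x y : 0 <= x -> x <= y -> sf x <= sf y.
Proof.
move=> x0 xy; have y0 := le_trans x0 xy; rewrite leNgt; apply/negP => /G_lt.
by move=> /(_ (sf_ge0 y0)); rewrite !sfK// ltNge xy.
Qed.

Let KE xi : 0 <= xi -> xi * K xi = sf xi.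
Proof.
move=> x0; rewrite -{1}(sfK x0) /G /Kfun mulfK// gt_eqF// g_gt0//.
exact: sf_ge0.
Qed.

(** Termwise from 0 <= al_j <= al_N. The two sides become the bounds 0 and 1 - 1 / (1 + al_N) = a
    for [theta]. *)
Let dG_ge s : 0 <= s -> g s <= dG s <= (1 + alN) * g s.
Proof.
move=> s0; rewrite mulr_sumr; apply/andP; split; apply: ler_sum => j _.
  rewrite ler_wpM2r ?powR_ge0// -[leLHS]mulr1 ler_wpM2l// lerDl//.
rewrite mulrA ler_wpM2r ?powR_ge0// mulrC ler_wpM2r// lerD2l//.
Qed.

Let aE : aexp al = 1 - (1 + alN)^-1.
Proof. by rewrite /aexp; field; rewrite gt_eqF//; have := alN_gt0; lra. Qed.

Let theta_bd xi : 0 <= xi -> 0 <= theta xi <= aexp al.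
Proof.
move=> /sf_ge0 s0; have /andP[h1 h2] := dG_ge s0; have g0 := g_gt0 s0.
have d0 : 0 < dG (sf xi) by exact: lt_le_trans h1.
have N0 : 0 < 1 + alN by have := alN_gt0; lra.
rewrite /theta aE; apply/andP; split; first by rewrite subr_ge0 ler_pdivrMr// mul1r.
by rewrite lerD2l lerN2 ler_pdivlMr// ler_pdivrMl.
Qed.

Let g_lead s : 0 <= s -> alN_gt0 = alN_gt0 -> av 0 ord_max * s `^ alN <= g s.
Proof.
move=> s0 _; rewrite /gfun (bigD1 ord_max)//= lerDl.
by apply: sumr_ge0 => j _; rewrite mulr_ge0// powR_ge0.
Qed.

Let aN_gt0 : 0 < av 0 ord_max. Proof. by case: adm => _ []. Qed.

(* The terms below the leading one are eventually a small fraction of it. *)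
Let theta_infty_s e : 0 < e -> exists2 s0, 0 < s0 &
  forall xi, 0 <= xi -> s0 <= sf xi -> `|theta xi - aexp al| <= e.
Proof.
(* Once s^(al_N - al_j) exceeds [y j], the j-th term of (1 + al_N) g - (s g)' is at most e / (N + 1)
   times the leading term of g; [r j] is the corresponding threshold for s. *)
move=> e0; pose y j := av 0 j * alN * N.+1%:R / (e * av 0 ord_max).
have y0 j : 0 <= y j by rewrite /y divr_ge0 ?mulr_ge0 ?(ltW e0) ?(ltW aN_gt0) ?(ltW alN_gt0).
pose r j := if j == ord_max then 0 else y j `^ (alN - al j)^-1.
have r0 j : 0 <= r j by rewrite /r; case: ifP => // _; exact: powR_ge0.
exists (1 + \sum_j r j) => [|xi x0 hs]; first by rewrite ltr_pwDl ?sumr_ge0.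
have s0 := sf_ge0 x0; set s := sf xi in hs s0 *.
have sp : 0 < s by apply: lt_le_trans hs; rewrite ltr_pwDl ?sumr_ge0.
have /andP[d1 d2] := dG_ge s0; have g0 := g_gt0 s0.
have d0 : 0 < dG s by exact: lt_le_trans d1.
have N0 : 0 < 1 + alN by have := alN_gt0; lra.
have hj j : av 0 j * (alN - al j) * s `^ al j <= e / N.+1%:R * (av 0 ord_max * s `^ alN).
  have [->|jm] := eqVneq j ord_max.
    by rewrite subrr mulr0 mul0r !mulr_ge0 ?powR_ge0 ?invr_ge0 ?(ltW e0) ?(ltW aN_gt0).
  have bj : 0 < alN - al j.
    by rewrite subr_gt0; apply: al_lt; rewrite /= ltn_neqAle -ltnS ltn_ord andbT;
       apply: contra jm => /eqP jm; apply/eqP/val_inj.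
  have rs : r j <= s.
    apply: le_trans hs; rewrite (bigD1 j)//= addrCA lerDl addr_ge0//.
    by apply: sumr_ge0.
  have ys : y j <= s `^ (alN - al j).
    have -> : y j = r j `^ (alN - al j).
      by rewrite /r (negbTE jm) -powRrM mulVf ?powRr1// gt_eqF.
    by rewrite ge0_ler_powR ?nnegrE// ltW.
  have -> : s `^ alN = s `^ al j * s `^ (alN - al j).
    by rewrite -powRD ?(gt_eqF sp) ?implybT// addrC subrK.
  rewrite [leRHS](_ : _ = s `^ al j * (e / N.+1%:R * av 0 ord_max * s `^ (alN - al j))); last by ring.
  rewrite [leLHS]mulrC ler_wpM2l ?powR_ge0//.
  have -> : av 0 j * (alN - al j) = av 0 j * alN - av 0 j * al j by ring.
  apply: (@le_trans _ _ (av 0 j * alN)); first by rewrite gerBl mulr_ge0.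
  have -> : av 0 j * alN = e / N.+1%:R * av 0 ord_max * y j.
    by rewrite /y; field; rewrite !gt_eqF// ltr0n.
  by rewrite ler_wpM2l// !mulr_ge0 ?invr_ge0 ?(ltW e0) ?(ltW aN_gt0).
have hd : (1 + alN) * g s - dG s <= e * g s.
  rewrite mulr_sumr -sumrB; apply: (@le_trans _ _ (\sum_(j < N.+1) (e / N.+1%:R * (av 0 ord_max * s `^ alN)))).
    by apply: ler_sum => j _; apply: le_trans (hj j); rewrite le_eqVlt; apply/orP; left; apply/eqP; ring.
  rewrite sumr_const card_ord -[leLHS]mulr_natl.
  have -> : N.+1%:R * (e / N.+1%:R * (av 0 ord_max * s `^ alN)) =
      e * (av 0 ord_max * s `^ alN) by field; rewrite addrC natr1 pnatr_eq0.
  by rewrite ler_wpM2l ?(ltW e0)// g_lead.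
have -> : theta xi - aexp al = - (((1 + alN) * g s - dG s) / ((1 + alN) * dG s)).
  by rewrite /theta aE -/s; field; rewrite !gt_eqF.
have pp : 0 < (1 + alN) * dG s by rewrite mulr_gt0.
rewrite normrN ger0_norm; last by rewrite divr_ge0 ?(ltW pp)// subr_ge0.
rewrite ler_pdivrMr//; apply: (le_trans hd); rewrite ler_wpM2l ?(ltW e0)//.
by apply: (le_trans d1); rewrite ler_peMl ?(ltW d0)// lerDl ltW.
Qed.

(** Everything is read off the substitution xi = s g(s), under which K is 1 / g(s) and the flux xi
    K(xi) is s itself. *)
Lemma Kfun_diffusivity : diffusivity K theta (aexp al).
Proof.
split.
- by move=> xi x0; rewrite /Kfun invr_gt0 g_gt0 ?sf_ge0.
- move=> x y x0 xy; have y0 := le_trans x0 xy.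
  by rewrite /Kfun lef_pV2 ?posrE ?g_gt0 ?sf_ge0// g_le ?sf_ge0 ?sf_le.
- by move=> x y x0 xy; have y0 := le_trans x0 xy; rewrite !KE// sf_le.
- move=> B; exists (1 + G `|B|) => [|xi hx].
    by rewrite ltr_pwDl// /G mulr_ge0// ltW// g_gt0.
  have GB : 0 <= G `|B| by rewrite /G mulr_ge0// ltW// g_gt0.
  have x0 : 0 <= xi by apply: le_trans hx; rewrite addr_ge0.
  rewrite KE// (le_trans (ler_norm B))// -{1}(GK (normr_ge0 B)) sf_le//.
  by apply: le_trans hx; rewrite lerDr.
- by rewrite aE ltrBlDr ltrDl invr_gt0; have := alN_gt0; lra.
- exact: theta_bd.
- move=> e /theta_infty_s[s0 sp hs].
  have GB : 0 <= G s0 by rewrite /G mulr_ge0// ltW// ?g_gt0// ltW.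
  exists (1 + G s0) => [|xi hx]; first by rewrite ltr_pwDl.
  have x0 : 0 <= xi by apply: le_trans hx; rewrite addr_ge0.
  apply: hs => //; rewrite -(GK (ltW sp)) sf_le//.
  by apply: le_trans hx; rewrite lerDr.
Qed.

Lemma Kfun_is_derive (xi : R) : 0 < xi -> is_derive xi 1 K (- theta xi * K xi / xi).
Proof.
move=> x0; have s0 := sf_ge0 (ltW x0); have GS := sfK (ltW x0).
have sp : 0 < sf xi.
  rewrite lt_def s0 andbT; apply/eqP => E; move: x0.
  by rewrite -GS E /G mul0r ltxx.
have /andP[d1 _] := dG_ge s0; have g0 := g_gt0 s0.
have d0 : 0 < dG (sf xi) by exact: lt_le_trans d1.
have dS : is_derive xi 1 sf (dG (sf xi))^-1.
  rewrite -{1}GS; apply: (@is_derive_inverse _ G) => //; last by rewrite gt_eqF.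
  - near=> r; rewrite /= GK//; apply: ltW; near: r; exact: lt_nbhsr.
  - near=> r; have r0 : 0 < r by near: r; exact: lt_nbhsr.
    apply: differentiable_continuous; apply/derivable1_diffP.
    by have [] := is_derive_G r0.
  - exact: is_derive_G.
have dK : is_derive xi 1 (sf * (fun r : R => r^-1)) (- theta xi * K xi / xi).
  have di := @is_deriveV _ id xi 1 1 (lt0r_neq0 x0) (is_derive_id xi 1).
  apply: is_derive_eq; rewrite /GRing.scale /= mulr1.
  have := KE (ltW x0); rewrite /theta /Kfun => E.
  rewrite -[X in X * - _]E expr2 /theta.
  by field; rewrite !gt_eqF.
apply: near_eq_is_derive dK.
near=> r; have r0 : 0 < r by near: r; exact: lt_nbhsr.
by rewrite !fctE -(KE (ltW r0)) mulrAC divff ?mul1r// gt_eqF.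
Unshelve. all: by end_near. Qed.

(** Exponents below 1 may give K an infinite slope at 0, so continuity is what can be claimed there.
    It suffices because at that point K multiplies a vanishing gradient. *)
Lemma Kfun_continuous0 e : 0 < e -> exists2 d, 0 < d &
  forall xi, 0 <= xi -> xi < d -> `|K xi - K 0| <= e.
Proof.
move=> e0; have S0 : sf 0 = 0.
  by have := GK (lexx 0); rewrite /G mul0r.
have g0 : 0 < g 0 by rewrite g_gt0.
pose e' := e * g 0 ^+ 2; have e'0 : 0 < e' by rewrite mulr_gt0// exprn_gt0.
have hj j : \forall s \near 0^'+, av 0 j * s `^ al j <= av 0 j * 0 `^ al j + e' / N.+1%:R.
  have [->|aj] := eqVneq (al j) 0.
    by near=> s; rewrite !powRr0 lerDl divr_ge0// ltW.
  have aj0 : 0 < al j by rewrite lt_def aj al_ge0.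
  have e1 : 0 < e' / N.+1%:R / (1 + av 0 j).
    by rewrite !divr_gt0// ltr_pwDl.
  have /cvgrPdist_lt/(_ _ e1) := powR_cvg0 aj0.
  move=> /filterS; apply => s; rewrite sub0r normrN ger0_norm ?powR_ge0//.
  rewrite ltr_pdivlMr ?ltr_pwDl// => /ltW h; rewrite powR0// mulr0 add0r.
  by apply: le_trans h; rewrite mulrC ler_wpM2l ?powR_ge0// lerDr.
have := filter_forall (at_right_proper_filter 0) hj.
rewrite /prop_near1 /at_right /within /= => /nbhs_ballP[d /= d0 hd].
exists (d * av 0 0) => [|xi x0 xd]; first by rewrite mulr_gt0.
have s0 := sf_ge0 x0.
have sd : sf xi < d.
  have := sfK x0; rewrite /G => E; rewrite -(ltr_pM2r a0_gt0).
  by apply: le_lt_trans xd; rewrite -{2}E ler_wpM2l// a0_le_g.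
have gs : g (sf xi) <= g 0 + e'.
  move: s0; rewrite le_eqVlt => /orP[/eqP<-|sp]; first by rewrite lerDl ltW.
  have := hd (sf xi); rewrite -ball_normE /= sub0r normrN gtr0_norm// => /(_ sd sp) hs.
  rewrite /gfun; apply: le_trans (ler_sum _ (fun j _ => hs j)) _.
  rewrite big_split /= sumr_const card_ord -[X in _ + X]mulr_natl.
  have -> : N.+1%:R * (e' / N.+1%:R) = e' by field; rewrite addrC natr1 pnatr_eq0.
  by [].
have gg : g 0 <= g (sf xi) by rewrite g_le.
rewrite /Kfun S0 ler0_norm; last by rewrite subr_le0 lef_pV2 ?posrE// (lt_le_trans g0).
have gp : 0 < g (sf xi) by exact: lt_le_trans gg.
have -> : - ((g (sf xi))^-1 - (g 0)^-1) = (g (sf xi) - g 0) / (g 0 * g (sf xi)).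
  by field; rewrite !gt_eqF.
rewrite ler_pdivrMr ?mulr_gt0//; apply: (@le_trans _ _ e'); first by rewrite lerBlDl.
by rewrite /e' ler_wpM2l ?(ltW e0)// expr2 ler_wpM2l// ltW.
Unshelve. all: by end_near. Qed.

End Forchheimer.

(** * The equation in non-divergence form *)

Section Operator.
Context {R : realType} {n : nat}.
Variables (K th : R -> R) (a : R).
Implicit Types (xi w : 'rV[R]_n) (H Q : 'M[R]_n).

(* For F(xi) = K(|xi|) xi, the value of tr(DF(xi) H): the derivative of F is
   K (1 - th e^T e) with e = xi / |xi|; at xi = 0 the quotient is 0 / 0 = 0. *)
Definition Lop xi H : R :=
  K (enorm xi) * (\tr H - th (enorm xi) * (qf H xi / enorm xi ^+ 2)).

Lemma LopN xi H : Lop (- xi) (- H) = - Lop xi H.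
Proof.
have qfN : qf H (- xi) = qf H xi.
  by rewrite -[- xi]scaleN1r qfZ sqrrN expr1n mul1r.
by rewrite /Lop enormN linearN /= qfNH qfN; ring.
Qed.

Lemma LopDr xi H Q : Lop xi (H + Q) = Lop xi H + Lop xi Q.
Proof. by rewrite /Lop linearD /= qfDH; ring. Qed.

Lemma LopZr xi c H : Lop xi (c *: H) = c * Lop xi H.
Proof. by rewrite /Lop linearZ /= qfZH; ring. Qed.

Lemma LopBr xi H Q : Lop xi (H - Q) = Lop xi H - Lop xi Q.
Proof. by rewrite LopDr -scaleN1r LopZr mulN1r. Qed.

Lemma LopE xi H : xi != 0 -> Lop xi H =
  K (enorm xi) * (\tr H - th (enorm xi) * qf H ((enorm xi)^-1 *: xi)).
Proof. by rewrite /Lop qfZ exprVn mulrC => _; rewrite [_ / _]mulrC mulrC. Qed.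

Hypothesis dK : diffusivity K th a.

Lemma qf_div_tr_ge H xi : (forall w, 0 <= qf H w) ->
  0 <= qf H xi / enorm xi ^+ 2 <= \tr H.
Proof.
move=> psd; have [->|x0] := eqVneq xi 0.
  rewrite enorm0 expr0n /= invr0 mulr0 lexx.
  apply: sumr_ge0 => i _; rewrite -bf_ebasis; exact: psd.
have e0 : 0 < enorm xi ^+ 2 by rewrite exprn_gt0// enorm_gt0.
by rewrite divr_ge0 ?psd ?(ltW e0)//= ler_pdivrMr// sqr_enorm psd_le_tr.
Qed.

(** Ellipticity, uniform up to the factor K: the eigenvalues of 1 - th e^T e lie between 1 - a and
    1. *)
Lemma Lop_psd_bounds H xi : (forall w, 0 <= qf H w) ->
  (1 - a) * (K (enorm xi) * \tr H) <= Lop xi H <= K (enorm xi) * \tr H.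
Proof.
move=> psd; have /andP[q0 q1] := qf_div_tr_ge xi psd.
have /andP[t0 ta] := diff_th dK (enorm_ge0 xi).
have k0 := diff_gt0 dK (enorm_ge0 xi).
rewrite /Lop mulrCA !ler_pM2l//; set q := qf _ _ / _ in q0 q1 *.
by apply/andP; split; nra.
Qed.

Lemma Lop_psd_ge0 H xi : (forall w, 0 <= qf H w) -> 0 <= Lop xi H.
Proof.
move=> psd; have /andP[h _] := Lop_psd_bounds xi psd; apply: le_trans h.
have /andP[q0 q1] := qf_div_tr_ge xi psd.
rewrite !mulr_ge0 ?subr_ge0 ?(ltW (diff_lt1 dK)) ?(ltW (diff_gt0 dK (enorm_ge0 xi)))//.
exact: le_trans q1.
Qed.

Lemma Lop_le xi H Q : (forall w, qf H w <= qf Q w) -> Lop xi H <= Lop xi Q.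
Proof.
move=> HQ; rewrite -subr_ge0 -LopBr; apply: Lop_psd_ge0 => w.
by rewrite qfBH subr_ge0.
Qed.

Lemma Lop_scalar xi c : Lop xi c%:M = c * Lop xi 1%:M.
Proof. rewrite -LopZr; congr Lop; by rewrite scalemx1. Qed.

(* Both sides are s(|.|)-weighted: the flux s(|xi|) xi/|xi| is monotone. *)
Lemma flux_monotone xi v (lam : R) : 0 <= lam ->
  K (enorm xi) * dotp xi v <= K (enorm (xi + lam *: v)) * dotp (xi + lam *: v) v.
Proof.
rewrite le_eqVlt => /orP[/eqP<-|l0]; first by rewrite scale0r addr0.
set z := xi + lam *: v.
(* By Cauchy-Schwarz this is at least the product of the differences of xi K(xi) and of xi at the
   two norms, which is nonnegative as the flux is monotone. *)
have h : 0 <= (K (enorm z) * dotp z (z - xi)) - (K (enorm xi) * dotp xi (z - xi)).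
  rewrite !dotpBr -!sqr_enorm.
  have k1 := diff_gt0 dK (enorm_ge0 z); have k2 := diff_gt0 dK (enorm_ge0 xi).
  have c1 := dotp_le_enorm z xi; have c2 := dotp_le_enorm xi z.
  have h : 0 <= (enorm z * K (enorm z) - enorm xi * K (enorm xi)) * (enorm z - enorm xi).
    have [le|/ltW le] := leP (enorm xi) (enorm z).
      by rewrite mulr_ge0// subr_ge0//; apply: (diff_flux_le dK) => //; exact: enorm_ge0.
    by rewrite mulr_le0// subr_le0//; apply: (diff_flux_le dK) => //; exact: enorm_ge0.
  apply: (le_trans h); nra.
have E : z - xi = lam *: v by rewrite /z addrC addKr.
move: h; rewrite E !dotpZr mulrCA [X in _ - X]mulrCA -mulrBr pmulr_rge0//.
by rewrite subr_ge0.
Qed.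

End Operator.

(** * Differentiation of the flux *)

Section Divergence.
Context {R : realType} {n : nat}.
Variables (K th : R -> R) (a : R).
Hypothesis dK : diffusivity K th a.
Hypothesis K_derive : forall xi : R, 0 < xi -> is_derive xi 1 K (- th xi * K xi / xi).
Hypothesis K_cont0 : forall e, 0 < e -> exists2 d : R, 0 < d &
  forall xi, 0 <= xi -> xi < d -> `|K xi - K 0| <= e.

(** Away from 0 this is the chain rule through the square root. Where c vanishes the norm need not
    be differentiable; there c(h) = O(h), so continuity of K at 0 is enough, and the term with th is
    0 by the convention for division by 0. *)
Lemma flux_curve_is_derive (c : R -> 'rV[R]_n) (w : 'rV[R]_n) i :
  (forall j, is_derive (0 : R) 1 (fun h => c h 0 j) (w 0 j)) ->
  is_derive (0 : R) 1 (fun h => K (enorm (c h)) * c h 0 i)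
    (K (enorm (c 0)) * (w 0 i
      - th (enorm (c 0)) * (dotp (c 0) w * c 0 0 i / enorm (c 0) ^+ 2))).
Proof.
move=> hc.
pose q (h : R) := dotp (c h) (c h).
have dq : is_derive (0 : R) 1 q (2 * dotp (c 0) w).
  have -> : q = \sum_j (fun h => c h 0 j) ^+ 2.
    by apply/funext => h; rewrite fct_sumE; apply: eq_bigr => j _; rewrite !fctE expr2.
  apply: is_derive_eq; rewrite /dotp mulr_sumr; apply: eq_bigr => j _.
  by rewrite /GRing.scale /= expr1; ring.
have [c0|c0] := eqVneq (c 0) 0; last first.
  have e0 : 0 < enorm (c 0) by rewrite enorm_gt0.
  have q0 : 0 < q 0 by rewrite /q -sqr_enorm exprn_gt0.
  have ds := is_derive1_sqrt q0.
  have sq : Num.sqrt (q 0) = enorm (c 0) by rewrite enormE.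
  have de : is_derive (0 : R) 1 (Num.sqrt \o q) (dotp (c 0) w / enorm (c 0)).
    apply: is_derive_eq; rewrite /GRing.scale /= sq; field; rewrite gt_eqF//.
  have dKe : is_derive ((Num.sqrt \o q) 0) 1 K (- th (enorm (c 0)) * K (enorm (c 0)) / enorm (c 0)).
    by rewrite /= sq; exact: K_derive.
  have dKc : is_derive (0 : R) 1 (K \o (Num.sqrt \o q))
     (dotp (c 0) w / enorm (c 0) * (- th (enorm (c 0)) * K (enorm (c 0)) / enorm (c 0))).
    have := @is_derive1_comp _ K (Num.sqrt \o q) 0 _ _ dKe de.
    by rewrite mulrC.
  have -> : (fun h => K (enorm (c h)) * c h 0 i) =
      (K \o (Num.sqrt \o q)) * (fun h => c h 0 i).
    by apply/funext => h; rewrite fctE /= enormE.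
  have hi := hc i; apply: is_derive_eq; rewrite /GRing.scale /= sq.
  by field; rewrite gt_eqF.
rewrite c0 enorm0 dotp0l expr0n /= !mxE mulr0 mul0r mulr0 subr0.
apply/is_derive_eps => e e0; rewrite !c0 enorm0 mxE mulr0.
have cq : {for 0, continuous (Num.sqrt \o q)}.
  apply: continuous_comp; last exact: sqrt_continuous.
  by apply: differentiable_continuous; apply/derivable1_diffP; case: dq.
have k0 : 0 < K 0 by apply: (diff_gt0 dK).
have w1 : 0 < 2 * (1 + `|w 0 i|) by rewrite mulr_gt0// ltr_pwDl.
have [d1 d10 h1] := K_cont0 (divr_gt0 e0 w1).
have /continuous_epsP/(_ _ d10)[d2 d20 h2] := cq.
have /is_derive_eps hi := hc i.
have k1 : 0 < 2 * (1 + K 0) by rewrite mulr_gt0// addr_gt0.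
have [d3 d30 h3] := hi _ (divr_gt0 e0 k1).
have [d4 d40 h4] := hi _ ltr01.
exists (Num.min d2 (Num.min d3 d4)); first by rewrite !lt_min d20 d30.
move=> h; rewrite !lt_min => /and3P[hd2 /h3 {}h3 /h4 {}h4].
move: h3 h4; rewrite !add0r c0 mxE !subr0 => h3 h4.
have := h2 h; rewrite subr0 => /(_ hd2); rewrite /= /q -!enormE c0 enorm0 subr0.
rewrite ger0_norm ?enorm_ge0// => /(h1 _ (enorm_ge0 _)) hK.
have hci : `|c h 0 i| <= (1 + `|w 0 i|) * `|h|.
  apply: (@le_trans _ _ (`|c h 0 i - w 0 i * h| + `|w 0 i * h|)).
    by apply: le_trans (ler_normD _ _); rewrite subrK.
  by rewrite normrM mulrDl lerD2r.
have -> : K (enorm (c h)) * c h 0 i - K 0 * w 0 i * h =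
   (K (enorm (c h)) - K 0) * c h 0 i + K 0 * (c h 0 i - w 0 i * h) by ring.
apply: (le_trans (ler_normD _ _)); rewrite !normrM (gtr0_norm k0).
have t1 : `|K (enorm (c h)) - K 0| * `|c h 0 i| <= e / 2 * `|h|.
  apply: (le_trans (ler_pM (normr_ge0 _) (normr_ge0 _) hK hci)).
  by rewrite le_eqVlt; apply/orP; left; apply/eqP; field; rewrite gt_eqF// ltr_pwDl.
have t2 : K 0 * `|c h 0 i - w 0 i * h| <= e / 2 * `|h|.
  apply: (le_trans (ler_wpM2l (ltW k0) h3)).
  rewrite mulrA ler_wpM2r// mulrCA ler_wpM2l ?(ltW e0)//.
  rewrite ler_pdivrMr// mulrA mulVf ?pnatr_eq0// mul1r lerDr//.
by lra.
Qed.

Lemma derive_along (f : 'rV[R]_n -> R) x v df :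
  is_derive (0 : R) 1 (fun h : R => f (x + h *: v)) df -> 'D_v f x = df.
Proof.
move=> [_ <-]; rewrite /derive.
have -> // : (fun h : R => h^-1 *: ((f \o shift x) (h *: v) - f x)) =
  (fun h : R => h^-1 *: (((fun r : R => f (x + r *: v)) \o shift 0) (h *: 1) - f (x + (0 : R) *: v))).
by apply/funext => h /=; rewrite scale0r !addr0 -[h *: 1]/(h * 1) mulr1 [h *: v + x]addrC.
Qed.

End Divergence.

(** What the maximum principle uses of a solution. The class is stable under u -> -u by [flowN], so
    each upper bound below also serves as a lower bound. *)
Record flow {R : realType} {n : nat} (K th : R -> R) (U : set 'rV[R]_n)
    (nu : 'rV[R]_n -> 'rV[R]_n) (u psi : 'rV[R]_n -> R -> R) := Flow {
  fgrad : 'rV[R]_n -> R -> 'rV[R]_n;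
  fhess : 'rV[R]_n -> R -> 'M[R]_n;
  fdt : 'rV[R]_n -> R -> R;
  flow_continuous : continuous (fun z : 'rV[R]_n * R => u z.1 z.2);
  flow_jet2 : forall x t w, jet2 (fun h => u (x + h *: w) t)
    (dotp (fgrad x t) w) (qf (fhess x t) w);
  flow_dt : forall x (t : R), is_derive t 1 (u x) (fdt x t);
  flow_eq : forall x t, U x -> 0 < t -> fdt x t = Lop K th (fgrad x t) (fhess x t);
  flow_bdry : forall x t, bdry U x -> 0 < t ->
    K (enorm (fgrad x t)) * dotp (fgrad x t) (nu x) = - psi x t
}.

Section FlowOf.
Context {R : realType} {n : nat}.
Implicit Types (K th : R -> R) (U : set 'rV[R]_n) (nu : 'rV[R]_n -> 'rV[R]_n)
  (u psi : 'rV[R]_n -> R -> R).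

Lemma flowN K th U nu u psi : flow K th U nu u psi ->
  flow K th U nu (fun x t => - u x t) (fun x t => - psi x t).
Proof.
move=> [G H ut uc uj ud ue ub].
apply: (@Flow _ _ _ _ _ _ _ _ (fun x t => - G x t) (fun x t => - H x t)
  (fun x t => - ut x t)).
- by move=> z; apply: continuousN; exact: uc.
- by move=> x t w; rewrite dotpNl qfNH; apply: jet2N; exact: uj.
- by move=> x t Ux t0; rewrite LopN ue.
- by move=> x t bx t0; rewrite enormN dotpNl mulrN ub.
Qed.

Lemma flow_of_solution N U nu (al : 'I_N.+1 -> R) (av : 'rV[R]_N.+1)
    (Psi P : 'rV[R]_(n + 1) -> R) :
  (1 <= N)%N -> al ord0 = 0 -> (forall i j : 'I_N.+1, (i < j)%N -> al i < al j) ->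
  admissible av -> is_solution U nu al av Psi P ->
  flow (Kfun al av) (theta al av) U nu (fun x t => P (st x t)) (fun x t => Psi (st x t)).
Proof.
move=> N1 al0 allt adm [C2P [_ [eqn bd]]].
have dK := Kfun_diffusivity N1 al0 allt adm.
apply: (@Flow _ _ _ _ _ _ _ _ (fun x t => gradx P t x) (fun x t => hess P t x)
  (time_deriv P)).
- move=> z; apply: continuous_comp; first exact: st_continuous.
  exact: C2_continuous.
- by move=> x t w; exact: C2_jet2.
- by move=> x t; exact: C2_time_is_derive.
- move=> x t Ux t0; have [_ ->] := eqn x t Ux t0.
  have E i : partial i (fun y => flux al av P t y 0 i) x =
     Kfun al av (enorm (gradx P t x)) * (hess P t x i i
      - theta al av (enorm (gradx P t x)) * (dotp (gradx P t x) (\row_j hess P t x j i)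
         * gradx P t x 0 i / enorm (gradx P t x) ^+ 2)).
    apply: derive_along.
    have := @flux_curve_is_derive R n _ _ _ dK (Kfun_is_derive al0 allt adm)
      (Kfun_continuous0 al0 allt adm) (fun h => gradx P t (x + h *: ebasis i))
      (\row_j hess P t x j i) i.
    have wi : (\row_j hess P t x j i) 0 i = hess P t x i i by rewrite mxE.
    rewrite scale0r addr0 wi.
    have -> : (fun y => flux al av P t (x + y *: ebasis i) 0 i) = (fun h => Kfun al av (enorm (gradx P t (x + h *: ebasis i))) *
     gradx P t (x + h *: ebasis i) 0 i) by apply/funext => h; rewrite /flux mxE.
    apply=> j; have := C2_gradx_is_derive C2P x (ebasis i) t 0 j.
    rewrite scale0r addr0; congr (is_derive _ _ _ _).
    have := dotp_ebasis (\row_k hess P t x j k) i; rewrite [X in _ = X]mxE.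
    have -> : (\row_k hess P t x k i) 0 j = hess P t x j i by rewrite mxE.
    move=> <-; by apply: eq_bigr => k _; rewrite !mxE.
  rewrite (eq_bigr _ (fun i _ => E i)) -mulr_sumr sumrB /Lop; congr (_ * (_ - _)).
  rewrite -mulr_sumr -mulr_suml; congr (_ * (_ / _)).
  rewrite /qf bf_sum exchange_big /=; apply: eq_bigr => i _.
  rewrite mulr_suml; apply: eq_bigr => j _; rewrite mxE; ring.
- move=> x t bx t0; rewrite -(bd x t bx t0) opprK.
  by rewrite /flux dotpZl.
Qed.

End FlowOf.

(** * Comparison and barriers *)

Section Comparison.
Context {R : realType} {n : nat}.
Variables (K th : R -> R) (a : R) (U : set 'rV[R]_n) (nu : 'rV[R]_n -> 'rV[R]_n)
  (u psi : 'rV[R]_n -> R -> R).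
Hypotheses (dK : diffusivity K th a) (F : flow K th U nu u psi).
Hypotheses (oU : open U) (cU : compact (closure U)).
Hypothesis nu_inward : forall x w, bdry U x -> dotp w (nu x) < 0 ->
  exists2 d : R, 0 < d & forall h, 0 < h < d -> U (x + h *: w).
Hypothesis nu_unit : forall x, bdry U x -> enorm (nu x) = 1.

Implicit Types (v : 'rV[R]_n -> R -> R).

(** Strict supersolution at one point: [g], [Q] and [tau] stand for the gradient, the Hessian and
    the time derivative of v, of which only upper expansions are required, backwards in time for
    [tau]. *)
Definition interior_test v x t := exists tau g Q,
  [/\ forall w, ujet2 (fun h => v (x + h *: w) t) (dotp g w) (qf Q w),
      ujet1 (fun h => v x (t - h)) (- tau) & Lop K th g Q < tau].

(** The normal flux of the barrier strictly exceeds that of u, which is - psi. *)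
Definition boundary_test v x t := exists2 g,
  forall w, ujet1 (fun h => v (x + h *: w) t) (dotp g w) &
  - psi x t < K (enorm g) * dotp g (nu x).

Lemma eq_dotp (x y : 'rV[R]_n) : (forall w, dotp x w = dotp y w) -> x = y.
Proof. by move=> h; apply/rowP => i; rewrite -!dotp_ebasis. Qed.

Lemma openU_line x w : U x -> exists2 d : R, 0 < d & forall h, `|h| < d -> U (x + h *: w).
Proof.
move=> Ux; have /nbhs_ballP[e /= e0 he] := open_nbhs_nbhs (conj oU Ux).
have w0 : 0 < 1 + `|w| by rewrite ltr_pwDl.
exists (e / (1 + `|w|)) => [|h]; first exact: divr_gt0.
rewrite ltr_pdivlMr// => hh; apply: he; rewrite -ball_normE /= opprD addrA subrr add0r.
by rewrite normrN normrZ; apply: le_lt_trans hh; rewrite ler_wpM2l// lerDr.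
Qed.

Lemma flow_ujet1_back x t : ujet1 (fun h => - u x (t - h)) (fdt F x t).
Proof.
move=> e e0; have /is_derive_eps/(_ e e0)[d d0 hd] := flow_dt F x t.
exists d => // h /andP[h0 hlt]; have := hd (- h); rewrite normrN gtr0_norm// => /(_ hlt).
by rewrite subr0 ler_norml => /andP[h1 h2]; lra.
Qed.

Lemma interior_max v x t d : U x -> 0 < t -> 0 < d -> interior_test v x t ->
  (forall y s, U y -> t - d < s -> s <= t -> u y s - v y s <= u x t - v x t) -> False.
Proof.
move=> Ux t0 d0 [tau [g [Q [jv jt lt]]]] hmax.
have spc w : dotp (fgrad F x t) w = dotp g w /\ qf (fhess F x t) w <= qf Q w.
  have [d1 d10 hd1] := openU_line w Ux.
  apply: (jet2_max d10 _ (flow_jet2 F x t w) (jv w)) => h /hd1 Uh.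
  by rewrite scale0r addr0; apply: hmax => //; rewrite ltrBlDr ltrDl.
have gE : fgrad F x t = g by apply: eq_dotp => w; have [] := spc w.
have tle : - fdt F x t <= - tau.
  apply: (@ujet1_max _ (fun h => u x (t - h)) _ _ _ _ d0 _ _ jt) => [h /andP[h0 hd]|].
    by rewrite subr0; apply: hmax => //; lra.
  by rewrite opprK; exact: flow_ujet1_back.
have := Lop_le dK g (fun w => (spc w).2); move: lt; rewrite -gE -(flow_eq F Ux t0); lra.
Qed.

(** At a boundary maximum of u - v the difference of gradients has no positive component in an
    inward direction, so it is a nonnegative multiple of nu. By [flux_monotone] u then has at least
    the normal flux of v. *)
Lemma boundary_max v x t : bdry U x -> 0 < t -> boundary_test v x t ->
  (forall y, U y -> u y t - v y t <= u x t - v x t) -> False.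
Proof.
move=> bx t0 [g jv lt] hmax.
set G := fgrad F x t; set m := nu x.
have inw w : dotp w m < 0 -> dotp (G - g) w <= 0.
  move=> wn; have [d d0 hd] := nu_inward bx wn.
  rewrite dotpBl subr_le0.
  apply: (@ujet1_max _ (fun h => u (x + h *: w) t) _ _ _ _ d0 _ _ (jv w)) => [h /hd Uh|].
    by rewrite scale0r addr0; exact: hmax.
  by apply: ujet2_ujet1; apply: jet2_ujet2; apply: jet2N; exact: flow_jet2.
have m1 : dotp m m = 1 by rewrite -sqr_enorm nu_unit// expr1n.
have [D DE] : exists D, D = G - g by eexists.
rewrite -DE in inw; set lam := dotp D m.
have lam0 : 0 <= lam.
  have := inw (- m); rewrite !(dotpNl, dotpNr) m1 -/lam oppr_lt0 ltr01 => /(_ isT).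
  by rewrite oppr_le0.
have T0 : D - lam *: m = 0.
  have [T TE] : exists T, T = D - lam *: m by eexists.
  have Tm : dotp T m = 0 by rewrite TE dotpBl dotpZl m1 mulr1 subrr.
  have DT : dotp D T = dotp T T.
    by rewrite -{1}(subrK (lam *: m) D) -TE dotpDl dotpZl (dotpC m) Tm mulr0 addr0.
  rewrite -TE.
  apply/eqP; rewrite -enorm_eq0 -sqrf_eq0 sqr_enorm eq_le dotp_ge0 andbT leNgt.
  apply/negP => TT; have l1 : 0 < 1 + lam by rewrite ltr_pwDl.
  (* A nonzero tangential part T, tilted slightly inwards, would be an inward direction w with D.w =
     |T|^2 / (1 + lam) > 0. *)
  have := inw (T - (dotp T T / (1 + lam)) *: m).
  rewrite !(dotpBl, dotpBr, dotpZl, dotpZr) Tm m1 DT -/lam mulr1 sub0r oppr_lt0.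
  have q0 : 0 < dotp T T / (1 + lam) by rewrite divr_gt0.
  have qE : dotp T T / (1 + lam) * (1 + lam) = dotp T T by rewrite divfK ?gt_eqF.
  by rewrite q0 => /(_ isT); lra.
have GE : G = g + lam *: m by apply/eqP; rewrite addrC -subr_eq -subr_eq0 -DE T0.
have := flux_monotone dK g m lam0.
rewrite -GE => h; have := flow_bdry F bx t0; rewrite -/G -/m => E.
by move: lt; rewrite -E ltNge h.
Qed.

(** A positive maximum of u - v over the compact cylinder occurs after t1 and contradicts one of the
    tests. The alternative u <= v spares the tests wherever the barrier is already known to lie
    above u. *)
Lemma comparison v t1 t2 : 0 <= t1 -> t1 <= t2 ->
  continuous (fun z : 'rV[R]_n * R => v z.1 z.2) ->
  (forall x, closure U x -> u x t1 <= v x t1) ->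
  (forall x t, closure U x -> t1 < t -> t <= t2 -> u x t <= v x t \/
     (U x /\ interior_test v x t) \/ (bdry U x /\ boundary_test v x t)) ->
  forall x t, closure U x -> t1 <= t -> t <= t2 -> u x t <= v x t.
Proof.
move=> t10 t12 cv h1 h2 x t Ux tt1 tt2.
pose A : set ('rV[R]_n * R) := closure U `*` `[t1, t2]%classic.
have cA : compact A by apply: compact_setX => //; exact: segment_compact.
pose W (z : 'rV[R]_n * R) := u z.1 z.2 - v z.1 z.2.
have cW : continuous W.
  by move=> z; apply: continuousB; [exact: (flow_continuous F)|exact: cv].
have A0 : A !=set0 by exists (x, t); split => //=; rewrite in_itv /= tt1.
have [[x0 s] /set_mem [/= Ux0]] := compact_EVT_max A0 cA (continuous_subspaceT cW).
rewrite in_itv /= => /andP[s1 s2] hmax.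
have {}hmax y r : closure U y -> t1 <= r -> r <= t2 -> u y r - v y r <= u x0 s - v x0 s.
  move=> Uy r1 r2; have := hmax (y, r); apply; apply: mem_set; split => //=.
  by rewrite in_itv /= r1.
rewrite -subr_le0; apply: (le_trans (hmax _ _ Ux tt1 tt2)).
rewrite subr_le0 leNgt; apply/negP => bad.
have s10 : t1 < s.
  rewrite lt_def s1 andbT; apply/eqP => E; move: bad.
  by rewrite E ltNge h1.
have sp : 0 < s by exact: le_lt_trans s10.
have sub y : U y -> closure U y by exact: subset_closure.
case: (h2 x0 s Ux0 s10 s2) => [|[[U0 it]|[b0 bt]]].
- by rewrite leNgt bad.
- apply: (@interior_max v x0 s (s - t1)) => //; first by rewrite subr_gt0.
  by move=> y r Uy r1 r2; apply: hmax => //; [exact: sub|lra|exact: le_trans s2].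
- apply: (@boundary_max v x0 s) => // y Uy; apply: hmax => //; exact: sub.
Qed.

End Comparison.

(** * Barriers in balls and boundary caps *)

Section Barriers.
Context {R : realType} {n : nat}.
Variables (K th : R -> R) (a : R) (U : set 'rV[R]_n) (nu : 'rV[R]_n -> 'rV[R]_n)
  (u psi : 'rV[R]_n -> R -> R).
Hypotheses (dK : diffusivity K th a) (F : flow K th U nu u psi).
Hypotheses (oU : open U) (cU : compact (closure U)).
Hypothesis nu_inward : forall x w, bdry U x -> dotp w (nu x) < 0 ->
  exists2 d : R, 0 < d & forall h, 0 < h < d -> U (x + h *: w).
Hypothesis nu_unit : forall x, bdry U x -> enorm (nu x) = 1.

(** Quantified star-shapedness about y: on this piece of the boundary a function increasing with the
    distance to y has a definite positive normal derivative. *)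
Definition cap (y : 'rV[R]_n) (r c : R) := forall x, bdry U x -> enorm (x - y) < r ->
  c <= dotp (x - y) (nu x).

Lemma dotp_line (x y w : 'rV[R]_n) h : dotp (x + h *: w - y) (x + h *: w - y) =
  dotp (x - y) (x - y) + 2 * h * dotp (x - y) w + h ^+ 2 * dotp w w.
Proof.
have -> : x + h *: w - y = (x - y) + h *: w by rewrite addrAC.
move: (x - y) => z; rewrite !(dotpDl, dotpDr, dotpZl, dotpZr) (dotpC w z); ring.
Qed.

Lemma enorm_continuous : continuous (@enorm R n).
Proof.
move=> x; apply/continuous_epsP => e e0; have n0 : 0 < 1 + n%:R :> R by rewrite ltr_pwDl.
exists (e / (1 + n%:R)) => [|y]; first exact: divr_gt0.
rewrite ltr_pdivlMr// => hy.
have h : enorm (y - x) < e.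
  apply: le_lt_trans (enorm_le_norm _) _; apply: le_lt_trans hy.
  by rewrite mulrC ler_wpM2l// lerDr.
apply: le_lt_trans h; rewrite ler_norml enormB_sub andbT lerNl opprB.
by rewrite (enorm_distC y x) enormB_sub.
Qed.

Lemma sqdist_continuous (y : 'rV[R]_n) : continuous (fun x : 'rV[R]_n => dotp (x - y) (x - y)).
Proof.
move=> x; have -> : (fun x : 'rV[R]_n => dotp (x - y) (x - y)) =
    (fun r => r * r) \o (@enorm R n \o (fun x : 'rV[R]_n => x - y)).
  by apply/funext => z /=; rewrite -sqr_enorm expr2.
apply: continuous_comp; last by apply: continuousM; exact: cvg_id.
apply: continuous_comp; last exact: enorm_continuous.
by apply: continuousB; [exact: cvg_id|exact: cst_continuous].
Qed.

Lemma sqdist_continuous_fst (y : 'rV[R]_n) :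
  continuous (fun z : 'rV[R]_n * R => dotp (z.1 - y) (z.1 - y)).
Proof.
move=> z; apply: (@continuous_comp _ _ _ (fst : 'rV[R]_n * R -> 'rV[R]_n)
  (fun x : 'rV[R]_n => dotp (x - y) (x - y))); first exact: cvg_fst.
exact: sqdist_continuous.
Qed.

(** Stated for f touched from above by the quadratic, so that minima of several quadratics are
    covered. *)
Lemma quad_ujet2 (f : 'rV[R]_n -> R) A lam (x y w : 'rV[R]_n) :
  (forall z, f z <= A + lam * dotp (z - y) (z - y)) ->
  f x = A + lam * dotp (x - y) (x - y) ->
  ujet2 (fun h => f (x + h *: w)) (dotp ((2 * lam) *: (x - y)) w) (qf (2 * lam)%:M w).
Proof.
move=> hf hx; apply: (@ujet2_le _ _ (fun h => A + lam * dotp (x - y) (x - y)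
   + dotp ((2 * lam) *: (x - y)) w * h + qf (2 * lam)%:M w / 2 * h ^+ 2) _ _ 1) => //.
- by rewrite scale0r addr0 expr0n /= !mulr0 !addr0.
- move=> h _; apply: le_trans (hf _) _; rewrite dotp_line dotpZl qf_scalar le_eqVlt.
  by apply/orP; left; apply/eqP; field.
- exact/jet2_ujet2/jet2_poly.
Qed.

Lemma linear_ujet1_back (v : R -> R) t k : (forall h, 0 < h -> v (t - h) = v t - k * h) ->
  ujet1 (fun h => v (t - h)) (- k).
Proof.
move=> hv e e0; exists 1 => // h /andP[h0 _]; rewrite subr0 hv// mulNr.
by rewrite (_ : _ - _ = 0) ?mulr_ge0 ?ltW//; ring.
Qed.

Lemma Lop_scalar_le (xi : 'rV[R]_n) c : 0 <= c -> Lop K th xi c%:M <= c * n%:R * K 0.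
Proof.
move=> c0; have psd w : 0 <= qf (c%:M : 'M[R]_n) w.
  by rewrite qf_scalar mulr_ge0// dotp_ge0.
have /andP[_ h] := Lop_psd_bounds dK xi psd; apply: (le_trans h).
rewrite mxtrace_scalar -[c *+ n]mulr_natr mulrC ler_wpM2l ?mulr_ge0//.
by rewrite (diff_anti dK)// enorm_ge0.
Qed.

(** The barrier is a rising paraboloid that reaches M on the sphere of radius rho. Since K <= K(0),
    its speed [k] can be fixed whatever its gradient. On the half ball, up to time [tau], the
    quadratic part and the rise each use up at most eta / 4. *)
Lemma persistence c rho eta : 0 < rho -> 0 < eta ->
  (forall x, enorm (x - c) < rho -> U x) ->
  exists2 tau : R, 0 < tau & tau <= 1 /\ forall t0 M, 0 <= t0 ->
    (forall x t, closure U x -> t0 <= t -> t <= t0 + tau -> u x t <= M) ->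
    (forall x, enorm (x - c) < rho -> u x t0 <= M - eta) ->
    forall x t, enorm (x - c) <= rho / 2 -> t0 <= t -> t <= t0 + tau ->
    u x t <= M - eta / 2.
Proof.
move=> rho0 eta0 hU; have rho20 : 0 < rho ^+ 2 by rewrite exprn_gt0.
have [lam lam0 lamE] : exists2 lam, 0 < lam & lam * rho ^+ 2 = eta.
  by exists (eta / rho ^+ 2); rewrite ?divr_gt0// divfK ?gt_eqF.
have k00 : 0 < K 0 by exact: (diff_gt0 dK).
have [k kE] : exists k, k = 2 * lam * n%:R * K 0 + 1 by eexists.
have k0 : 0 < k by rewrite kE ltr_wpDl// !mulr_ge0// ltW.
have [tau [tau0 tau1 ktau]] : exists tau, [/\ 0 < tau, tau <= 1 & k * tau <= eta / 4].
  exists (Num.min 1 (eta / (4 * k))); split.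
  - by rewrite lt_min ltr01 divr_gt0// mulr_gt0.
  - by rewrite ge_min lexx.
  - apply: (@le_trans _ _ (k * (eta / (4 * k)))); first by rewrite ler_wpM2l ?(ltW k0)// ge_min lexx orbT.
    by rewrite le_eqVlt; apply/orP; left; apply/eqP; field; rewrite gt_eqF.
exists tau => //; split=> // t0 M t00 hM h0.
pose v (x : 'rV[R]_n) t := M - eta + k * (t - t0) + lam * dotp (x - c) (x - c).
have far x t : t0 <= t -> rho <= enorm (x - c) -> M <= v x t.
  move=> tt hx; have : eta <= lam * dotp (x - c) (x - c).
    rewrite -sqr_enorm -lamE ler_wpM2l ?(ltW lam0)//.
    by rewrite lerXn2r// nnegrE ?enorm_ge0// ltW.
  have : 0 <= k * (t - t0) by rewrite mulr_ge0 ?(ltW k0)// subr_ge0.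
  by rewrite /v; lra.
have cmp : forall x t, closure U x -> t0 <= t -> t <= t0 + tau -> u x t <= v x t.
  apply: (comparison dK F oU cU nu_inward nu_unit) => //.
  - by rewrite lerDl ltW.
  - move=> z; rewrite /v; apply: cvgD.
      apply: cvgD; first exact: cvg_cst.
      by apply: cvgM; [exact: cvg_cst|apply: cvgB; [exact: cvg_snd|exact: cvg_cst]].
    by apply: cvgM; [exact: cvg_cst|exact: sqdist_continuous_fst].
  - move=> x Ux; have [hx|hx] := ltP (enorm (x - c)) rho.
      apply: (le_trans (h0 _ hx)); rewrite /v subrr mulr0 addr0 lerDl.
      by rewrite mulr_ge0 ?(ltW lam0) ?dotp_ge0.
    by apply: le_trans (far x t0 (lexx _) hx); rewrite hM// lerDl ltW.
  - move=> x t Ux /ltW tt1 tt2; have [hx|hx] := ltP (enorm (x - c)) rho; last first.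
      by left; apply: le_trans (far x t tt1 hx); exact: hM.
    right; left; split; first exact: hU.
    exists k, ((2 * lam) *: (x - c)), (2 * lam)%:M; split=> [w||].
    - by apply: (@quad_ujet2 (fun z => v z t) (M - eta + k * (t - t0)) lam x c).
    - by apply: linear_ujet1_back => h _; rewrite /v; ring.
    - apply: le_lt_trans (Lop_scalar_le _ _) _; first by rewrite mulr_ge0// ltW.
      by rewrite kE ltrDl.
move=> x t hx tt1 tt2.
have Ux : closure U x.
  by apply: subset_closure; apply: hU; apply: (le_lt_trans hx); lra.
apply: (le_trans (cmp x t Ux tt1 tt2)); rewrite /v.
have : lam * dotp (x - c) (x - c) <= eta / 4.
  have -> : eta / 4 = lam * (rho / 2) ^+ 2 by rewrite -lamE; field.
  rewrite -sqr_enorm ler_wpM2l ?(ltW lam0)//.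
  by rewrite lerXn2r// nnegrE ?enorm_ge0// divr_ge0 ?ltW.
have : k * (t - t0) <= eta / 4 by apply: le_trans ktau; rewrite ler_wpM2l ?(ltW k0)//; lra.
lra.
Qed.

Lemma Lop_radial (z : 'rV[R]_n) kap al be : z != 0 -> kap != 0 ->
  Lop K th (kap *: z) (al%:M - be *: (z^T *m z)) =
  K (enorm (kap *: z)) * (al * (n%:R - th (enorm (kap *: z)))
     - be * dotp z z * (1 - th (enorm (kap *: z)))).
Proof.
move=> z0 k0; have e0 : enorm z != 0 by rewrite enorm_eq0.
have E2 : enorm (kap *: z) ^+ 2 = kap ^+ 2 * enorm z ^+ 2.
  by rewrite enormZ exprMn real_normK ?num_real.
rewrite /Lop E2; congr (_ * _).
rewrite linearB linearZ /= mxtrace_scalar tr_outer qfBH qfZH qf_scalar qf_outer.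
rewrite !dotpZr !dotpZl -!sqr_enorm.
by rewrite -[al *+ n]mulr_natr; field; rewrite k0 e0.
Qed.

(** The barrier is M + del - del exp(Lam q), where {q > 0} is a ball about y whose squared radius
    grows linearly from r1^2 to r^2 in time sigma. Outside it the barrier is at least M, and in the
    inner ball it is at least M - delta0, so the tests are due only in the annulus between, where
    the gradient does not vanish. *)
Lemma expansion y r1 r2 r c0 sigma delta0 : 0 < r1 -> r1 < r -> 0 <= r2 -> r2 < r ->
  0 < c0 -> cap y r c0 -> 0 < sigma -> 0 < delta0 ->
  exists delta eps : R, [/\ 0 < delta, 0 < eps & forall t M, sigma <= t ->
    (forall x s, closure U x -> t - sigma <= s -> s <= t -> u x s <= M) ->
    (forall x s, closure U x -> enorm (x - y) <= r1 -> t - sigma <= s -> s <= t ->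
      u x s <= M - delta0) ->
    (forall x s, bdry U x -> t - sigma <= s -> s <= t -> `|psi x s| <= eps) ->
    forall x, closure U x -> enorm (x - y) <= r2 -> u x t <= M - delta].
Proof.
move=> r10 r1r r20 r2r c00 hcap sig0 d00.
have r0 : 0 < r by exact: lt_trans r1r.
pose k1 := K 1; have k10 : 0 < k1 by exact: (diff_gt0 dK).
have [k k0 kE] : exists2 k, 0 < k & k * sigma = r ^+ 2 - r1 ^+ 2.
  exists ((r ^+ 2 - r1 ^+ 2) / sigma); last by rewrite divfK ?gt_eqF.
  by rewrite divr_gt0// subr_gt0 ltrXn2r// ?nnegrE ?ltW.
have a1 : 0 < 1 - a by rewrite subr_gt0 (diff_lt1 dK).
(* The radial second derivative grows with Lam^2 and the others with Lam. Even after the loss of the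
   factor 1 - a, this [Lam] beats both the dimension term and the growth rate [k], the latter with
   margin 1. *)
have [Lam Lam0 LamE] : exists2 Lam, 0 < Lam &
    2 * k1 * (2 * Lam * r1 ^+ 2 * (1 - a) - n%:R) = k + 1.
  exists ((n%:R + (k + 1) / (2 * k1)) / (2 * r1 ^+ 2 * (1 - a))); last first.
    by field; rewrite !gt_eqF.
  by rewrite divr_gt0// ?mulr_gt0 ?exprn_gt0// ltr_wpDl// divr_gt0 ?mulr_gt0// addr_gt0.
pose E0 := expR (Lam * r ^+ 2); have E00 : 0 < E0 by exact: expR_gt0.
(* The first bound keeps the barrier above M - delta0; the second keeps its gradient at most 1,
   where K is at least K(1). *)
have [del [del0 del1 del2]] : exists del, [/\ 0 < del, del * E0 <= delta0 &
    del * (2 * Lam * r * E0) <= 1].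
  exists (Num.min (delta0 / E0) (2 * Lam * r * E0)^-1); split.
  - by rewrite lt_min divr_gt0// invr_gt0 !mulr_gt0.
  - by rewrite -ler_pdivlMr// ge_min lexx.
  - by rewrite -ler_pdivlMr ?mulr_gt0// mul1r ge_min lexx orbT.
(* The drop of the barrier below M at the final time on the sphere of radius r2, and half of the
   least normal flux of the barrier on the cap. *)
exists (del * (expR (Lam * (r ^+ 2 - r2 ^+ 2)) - 1)), (k1 * del * Lam * c0).
have E1 : 1 < expR (Lam * (r ^+ 2 - r2 ^+ 2)).
  by rewrite expR_gt1 mulr_gt0// subr_gt0 ltrXn2r.
split=> [||t M st hM hM1 hpsi x Ux hx]; first by rewrite mulr_gt0// subr_gt0.
  by rewrite !mulr_gt0.
pose q (x : 'rV[R]_n) s := r1 ^+ 2 + k * (s - (t - sigma)) - dotp (x - y) (x - y).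
pose v x s := M + del - del * expR (Lam * q x s).
have qle x' s : s <= t -> q x' s <= r ^+ 2 - dotp (x' - y) (x' - y).
  move=> hs; rewrite /q lerD2r -lerBrDl.
  by rewrite -kE ler_wpM2l ?(ltW k0)//; lra.
have vM x' s : q x' s <= 0 -> M <= v x' s.
  move=> hq; have : expR (Lam * q x' s) <= 1 by rewrite expR_le1 pmulr_rle0.
  by rewrite /v; nra.
have vd x' s : s <= t -> M - delta0 <= v x' s.
  move=> hs; have : expR (Lam * q x' s) <= E0.
    rewrite ler_expR ler_wpM2l ?(ltW Lam0)//; apply: le_trans (qle x' s hs) _.
    by rewrite gerBl dotp_ge0.
  by rewrite /v; nra.
have cmp : forall x' s, closure U x' -> t - sigma <= s -> s <= t -> u x' s <= v x' s.
  apply: (comparison dK F oU cU nu_inward nu_unit) => //.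
  - by rewrite subr_ge0.
  - by rewrite gerBl ltW.
  - have cq : continuous (fun z : 'rV[R]_n * R => Lam * q z.1 z.2).
      move=> z; rewrite /q; apply: cvgM; first exact: cvg_cst.
      apply: cvgB; last exact: sqdist_continuous_fst.
      apply: cvgD; first exact: cvg_cst.
      by apply: cvgM; [exact: cvg_cst|apply: cvgB; [exact: cvg_snd|exact: cvg_cst]].
    move=> z; rewrite /v; apply: cvgB; first exact: cvg_cst.
    apply: cvgM; first exact: cvg_cst.
    exact: (continuous_comp (cq z) (@continuous_expR R _)).
  - move=> x' Ux'; have [h|h] := leP (enorm (x' - y)) r1.
      by apply: le_trans (vd x' _ _); [apply: hM1; rewrite // gerBl ltW|rewrite gerBl ltW].
    apply: le_trans (vM x' _ _); first by apply: hM; rewrite // gerBl ltW.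
    rewrite /q subrr mulr0 addr0 subr_le0 -sqr_enorm lerXn2r ?nnegrE ?enorm_ge0 ?ltW//.
  - move=> x' s Ux' /ltW s1 s2; have [h|h] := leP (enorm (x' - y)) r1.
      by left; apply: le_trans (vd x' s s2); exact: hM1.
    have [hq|hq] := leP (q x' s) 0.
      by left; apply: le_trans (vM x' s hq); exact: hM.
    right; pose z := x' - y; have z0 : z != 0 by rewrite -enorm_gt0 (lt_trans r10).
    pose E := expR (Lam * q x' s); have Ep : 0 < E by exact: expR_gt0.
    have Eg1 : 1 <= E by rewrite ltW// expR_gt1 mulr_gt0.
    have zr : enorm z < r.
      rewrite -(@ltr_pXn2r _ 2)// ?nnegrE ?enorm_ge0 ?(ltW r0)// sqr_enorm -subr_gt0.
      by apply: lt_le_trans hq (qle x' s s2).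
    have EE0 : E <= E0.
      rewrite ler_expR ler_wpM2l ?(ltW Lam0)//; apply: le_trans (qle x' s s2) _.
      by rewrite gerBl dotp_ge0.
    have [kap kapE] : exists kap, kap = 2 * del * Lam * E by eexists.
    have kap0 : 0 < kap by rewrite kapE !mulr_gt0.
    have g1 : enorm (kap *: z) <= 1.
      rewrite enormZ gtr0_norm//; apply: le_trans del2.
      have -> : del * (2 * Lam * r * E0) = 2 * del * Lam * E0 * r by ring.
      rewrite ler_pM ?enorm_ge0 ?(ltW kap0)// ?(ltW zr)// kapE ler_wpM2l//.
      by rewrite !mulr_ge0// ltW.
    have Kg : k1 <= K (enorm (kap *: z)) by apply: (diff_anti dK); rewrite ?enorm_ge0.
    have jet w : ujet2 (fun h => v (x' + h *: w) s) (dotp (kap *: z) w)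
       (qf ((del * E * (2 * Lam))%:M - (del * E * (4 * Lam ^+ 2)) *: (z^T *m z)) w).
      have := jet2Z (- del) (jet2_expR (Lam * q x' s) (Lam * - (2 * dotp z w)) (- Lam * dotp w w)).
      move=> /(jet2D (jet2_poly 0 0 (M + del))).
      rewrite !add0r => /jet2_ujet2; rewrite -/E.
      have -> : - del * (Lam * - (2 * dotp z w) * E) = dotp (kap *: z) w.
        by rewrite dotpZl kapE; ring.
      have -> : - del * ((2 * (- Lam * dotp w w) + (Lam * - (2 * dotp z w)) ^+ 2) * E) =
         qf ((del * E * (2 * Lam))%:M - (del * E * (4 * Lam ^+ 2)) *: (z^T *m z)) w.
        by rewrite qfBH qfZH qf_scalar qf_outer; ring.
      apply: ujet2_le => [||h' _]; [|exact: ltr01|].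
        by rewrite scale0r addr0 expr0n /= ?(mulr0, mul0r, addr0, add0r) /v; ring.
      rewrite /v /q dotp_line -/z le_eqVlt; apply/orP; left; apply/eqP.
      rewrite ?(mul0r, addr0, add0r) mulNr; congr (_ - _ * expR _); ring.
    have [Uin|Unin] := pselect (U x').
      left; split=> //.
      exists (- (del * E * Lam * k)), (kap *: z),
        ((del * E * (2 * Lam))%:M - (del * E * (4 * Lam ^+ 2)) *: (z^T *m z)).
      split=> [w||]; first exact: jet.
        have := jet2Z (- del) (jet2_expR (Lam * q x' s) (- (Lam * k)) 0).
        move=> /(jet2D (jet2_poly 0 0 (M + del))) /jet2_ujet2/ujet2_ujet1.
        rewrite !add0r -/E.
        have -> : - del * (- (Lam * k) * E) = - - (del * E * Lam * k) by ring.
        apply: ujet1_le => [||h' _]; [|exact: ltr01|].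
          by rewrite subr0 expr0n /= ?(mulr0, mul0r, addr0, add0r) /v; ring.
        rewrite /v /q le_eqVlt; apply/orP; left; apply/eqP.
        rewrite ?(mul0r, addr0, add0r) mulNr; congr (_ - _ * expR _); ring.
      rewrite Lop_radial ?gt_eqF//.
      have /andP[th0 tha] := diff_th dK (enorm_ge0 (kap *: z)).
      set t' := th _ in th0 tha *; set k' := K _ in Kg *.
      have zz : r1 ^+ 2 <= dotp z z.
        by rewrite -sqr_enorm lerXn2r ?nnegrE ?enorm_ge0 ?ltW.
      have h1 : 2 * Lam * r1 ^+ 2 * (1 - a) <= 2 * Lam * dotp z z * (1 - t').
        have L2 : 0 <= 2 * Lam by rewrite mulr_ge0// ltW.
        apply: ler_pM; rewrite ?(ltW a1)//; last by lra.
          by rewrite mulr_ge0// sqr_ge0.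
        by rewrite ler_wpM2l.
      have h2 : k + 1 <= 2 * k' * (2 * Lam * dotp z z * (1 - t') - (n%:R - t')).
        rewrite -LamE; apply: ler_pM; rewrite ?mulr_ge0 ?(ltW k10)//.
        - have : 0 < 2 * k1 * (2 * Lam * r1 ^+ 2 * (1 - a) - n%:R) by rewrite LamE ltr_wpDl ?(ltW k0).
          by rewrite pmulr_rgt0 ?mulr_gt0// => /ltW.
        - by rewrite ler_wpM2l.
        - lra.
      have -> : k' * (del * E * (2 * Lam) * (n%:R - t') - del * E * (4 * Lam ^+ 2) * dotp z z * (1 - t'))
        = - (del * E * Lam * (2 * k' * (2 * Lam * dotp z z * (1 - t') - (n%:R - t')))) by ring.
      rewrite ltrN2 ltr_pM2l ?mulr_gt0//; lra.
    right; have bx : bdry U x' by split.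
    split=> //; exists (kap *: z) => [w|]; first exact/ujet2_ujet1/jet.
    have := hpsi x' s bx s1 s2; rewrite ler_norml => /andP[hp _].
    apply: (@le_lt_trans _ _ (k1 * del * Lam * c0)); first by rewrite lerNl.
    have zc : c0 <= dotp z (nu x') by apply: hcap.
    rewrite dotpZl; apply: (@lt_le_trans _ _ (k1 * (kap * c0))); last first.
      by rewrite ler_pM ?mulr_ge0 ?(ltW k10) ?(ltW kap0) ?(ltW c00)// ler_wpM2l ?(ltW kap0).
    have -> : k1 * (kap * c0) = k1 * del * Lam * c0 * (2 * E) by rewrite kapE; ring.
    by rewrite ltr_pMr ?mulr_gt0//; lra.
have tt : t - sigma <= t by rewrite gerBl ltW.
apply: le_trans (cmp x t Ux tt (lexx t)) _.
have : expR (Lam * (r ^+ 2 - r2 ^+ 2)) <= expR (Lam * q x t).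
  rewrite ler_expR ler_wpM2l ?(ltW Lam0)// /q.
  have -> : k * (t - (t - sigma)) = r ^+ 2 - r1 ^+ 2 by rewrite -kE; ring.
  have : dotp (x - y) (x - y) <= r2 ^+ 2 by rewrite -sqr_enorm lerXn2r ?nnegrE ?enorm_ge0.
  by lra.
by rewrite /v; nra.
Qed.

End Barriers.

(** * Growth of the maximum under a small boundary flux *)

Section Growth.
Context {R : realType} {n : nat}.
Implicit Types (js : seq ('rV[R]_n * R)) (x : 'rV[R]_n).

(* Minimum of the defining quadratics of finitely many balls covering the
   boundary: at a boundary point the active quadratic is negative, so its ball
   is one in which the cap condition applies. *)
Definition min_caps js x : R :=
  foldr (fun j acc => Num.min (dotp (x - j.1) (x - j.1) - j.2 ^+ 2) acc) 0 js.

Lemma min_caps_cases js x : min_caps js x = 0 \/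
  exists2 j, j \in js & min_caps js x = dotp (x - j.1) (x - j.1) - j.2 ^+ 2.
Proof.
elim: js => [|j js IH] /=; first by left.
have [h|h] := leP (dotp (x - j.1) (x - j.1) - j.2 ^+ 2) (min_caps js x).
  by right; exists j; rewrite ?mem_head.
by case: IH => [->|[i ij ->]]; [left|right; exists i; rewrite // inE ij orbT].
Qed.

Lemma min_caps_le js x j : j \in js ->
  min_caps js x <= dotp (x - j.1) (x - j.1) - j.2 ^+ 2.
Proof.
elim: js => //= i js IH; rewrite inE ge_min => /orP[/eqP->|/IH->].
  by rewrite lexx.
by rewrite orbT.
Qed.

Lemma min_caps_le0 js x : min_caps js x <= 0.
Proof. by elim: js => //= i js IH; rewrite ge_min IH orbT. Qed.

Lemma min_caps_ge js x : - (\sum_(j <- js) j.2 ^+ 2) <= min_caps js x.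
Proof.
elim: js => [|i js IH] /=; first by rewrite big_nil oppr0.
have s0 : 0 <= \sum_(j <- js) j.2 ^+ 2 by apply: sumr_ge0 => j _; rewrite sqr_ge0.
have := dotp_ge0 (x - i.1); have := sqr_ge0 i.2.
by rewrite big_cons le_min; move: IH => *; apply/andP; split; lra.
Qed.

Lemma min_caps_continuous js : continuous (min_caps js).
Proof.
elim: js => [|i js IH] x; first exact: cst_continuous.
apply: (@continuous_min _ _ (fun x => dotp (x - i.1) (x - i.1) - i.2 ^+ 2) (min_caps js)).
  apply: (@continuousB _ _ _ (fun y : 'rV[R]_n => dotp (y - i.1) (y - i.1)) (cst (i.2 ^+ 2))).
    exact: sqdist_continuous.
  exact: cst_continuous.
exact: IH.
Qed.

Variables (K th : R -> R) (a : R) (U : set 'rV[R]_n) (nu : 'rV[R]_n -> 'rV[R]_n)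
  (u psi : 'rV[R]_n -> R -> R).
Hypotheses (dK : diffusivity K th a) (F : flow K th U nu u psi).
Hypotheses (oU : open U) (cU : compact (closure U)).
Hypothesis nu_inward : forall x w, bdry U x -> dotp w (nu x) < 0 ->
  exists2 d : R, 0 < d & forall h, 0 < h < d -> U (x + h *: w).
Hypothesis nu_unit : forall x, bdry U x -> enorm (nu x) = 1.

(** The barrier adds to M a multiple lam of [min_caps], lifted by H to be nonnegative, and a linear
    growth in time that pays for its Hessian. With lam K(1) c0 = eps its normal flux is at least 2
    eps, which dominates psi. *)
Lemma global_growth js c0 : 0 < c0 ->
  (forall j, j \in js -> 0 < j.2 /\ cap U nu j.1 j.2 c0) ->
  (forall x, bdry U x -> exists2 j, j \in js & enorm (x - j.1) < j.2) ->
  exists C e1 : R, [/\ 0 < C, 0 < e1 & forall eps t1 M, 0 < eps -> eps <= e1 -> 0 <= t1 ->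
    (forall x, closure U x -> u x t1 <= M) ->
    (forall x s, bdry U x -> t1 <= s -> s <= t1 + 2 -> `|psi x s| <= eps) ->
    forall x t, closure U x -> t1 <= t -> t <= t1 + 2 -> u x t <= M + C * eps].
Proof.
move=> c00 hcap hcov; pose k1 := K 1; have k10 : 0 < k1 by exact: (diff_gt0 dK).
have k00 : 0 < K 0 by exact: (diff_gt0 dK).
have [H HE] : exists H, H = \sum_(j <- js) j.2 ^+ 2 by eexists.
have H0 : 0 <= H by rewrite HE; apply: sumr_ge0 => j _; rewrite sqr_ge0.
have jH j : j \in js -> j.2 <= 1 + H.
  move=> jj; have : j.2 ^+ 2 <= H.
    rewrite HE (big_rem j)//= lerDl; apply: sumr_ge0 => i _; exact: sqr_ge0.
  by have := sqr_ge0 (j.2 - 1); nra.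
have [c cE] : exists c, c = 2 * n%:R * K 0 + 1 by eexists.
have c1 : 0 < c by rewrite cE ltr_wpDl// !mulr_ge0// ltW.
have kc : 0 < k1 * c0 by rewrite mulr_gt0.
(* After two units of time the barrier is at most M + lam (H + 2 c). The bound on eps keeps its
   boundary gradient 2 lam |x - j.1| at most 1, so that K is at least K(1) there. *)
exists ((H + 2 * c) / (k1 * c0)), (k1 * c0 / (2 * (1 + H))); split.
- by rewrite divr_gt0// ltr_wpDl// mulr_gt0.
- by rewrite divr_gt0// mulr_gt0// ltr_pwDl.
move=> eps t1 M e0 ee1 t10 hM hpsi.
have [lam lam0 lamE] : exists2 lam, 0 < lam & lam * (k1 * c0) = eps.
  by exists (eps / (k1 * c0)); rewrite ?divr_gt0// divfK ?gt_eqF.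
have lam1 : 2 * lam * (1 + H) <= 1.
  move: ee1; rewrite -lamE ler_pdivlMr ?mulr_gt0 ?ltr_pwDl// => h.
  by rewrite -(ler_pM2r kc) mul1r; apply: le_trans h; rewrite le_eqVlt; apply/orP; left; apply/eqP; ring.
pose v x t := M + lam * (min_caps js x + H) + c * lam * (t - t1).
have cl0 : 0 <= c * lam by rewrite mulr_ge0// ltW.
have cmp : forall x t, closure U x -> t1 <= t -> t <= t1 + 2 -> u x t <= v x t.
  apply: (comparison dK F oU cU nu_inward nu_unit) => //.
  - by rewrite lerDl.
  - have cm : continuous (fun z : 'rV[R]_n * R => min_caps js z.1).
      move=> z; apply: (@continuous_comp _ _ _ (fst : 'rV[R]_n * R -> 'rV[R]_n) (min_caps js)).
        exact: cvg_fst.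
      exact: min_caps_continuous.
    move=> z; rewrite /v; apply: cvgD.
      apply: cvgD; first exact: cvg_cst.
      by apply: cvgM; [exact: cvg_cst|apply: cvgD; [exact: cm|exact: cvg_cst]].
    by apply: cvgM; [exact: cvg_cst|apply: cvgB; [exact: cvg_snd|exact: cvg_cst]].
  - move=> x Ux; apply: le_trans (hM x Ux) _; rewrite /v subrr mulr0 addr0 lerDl.
    by rewrite mulr_ge0 ?(ltW lam0)// -lerBlDr sub0r HE min_caps_ge.
  - move=> x t Ux /ltW s1 s2; right.
    have time : ujet1 (fun h => v x (t - h)) (- (c * lam)).
      by apply: linear_ujet1_back => h _; rewrite /v; ring.
    have quad j : j \in js -> min_caps js x = dotp (x - j.1) (x - j.1) - j.2 ^+ 2 ->
       forall w, ujet2 (fun h => v (x + h *: w) t) (dotp ((2 * lam) *: (x - j.1)) w) (qf (2 * lam)%:M w).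
      move=> jj E w; apply: (@quad_ujet2 _ _ (fun z => v z t)
        (M + lam * (H - j.2 ^+ 2) + c * lam * (t - t1))) => [z|].
        by rewrite /v; have := min_caps_le z jj; nra.
      by rewrite /v E; ring.
    have [Uin|Unin] := pselect (U x).
      left; split=> //; case: (min_caps_cases js x) => [E|[j jj E]].
        exists (c * lam), 0, 0; split=> // [w|].
          have := @quad_ujet2 _ _ (fun z => v z t) (M + lam * H + c * lam * (t - t1)) 0 x x w.
          rewrite mulr0 scale0r raddf0; apply=> [z|]; rewrite /v.
            by have := min_caps_le0 js z; nra.
          by rewrite E; ring.
        by rewrite -(scale0r (1%:M)) LopZr mul0r mulr_gt0.
      exists (c * lam), ((2 * lam) *: (x - j.1)), (2 * lam)%:M; split=> //; first exact: quad.
      apply: le_lt_trans (Lop_scalar_le dK _ _) _; first by rewrite mulr_ge0// ltW.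
      by rewrite cE; nra.
    right; have bx : bdry U x by split.
    split=> //; have [i ij ix] := hcov x bx.
    have neg : min_caps js x < 0.
      apply: (le_lt_trans (min_caps_le x ij)).
      by rewrite subr_lt0 -sqr_enorm ltrXn2r// ?nnegrE ?enorm_ge0// (le_trans (enorm_ge0 _) (ltW ix)).
    case: (min_caps_cases js x) => [E|[j jj E]]; first by move: neg; rewrite E ltxx.
    exists ((2 * lam) *: (x - j.1)) => [w|]; first exact/ujet2_ujet1/quad.
    have [j0 jcap] := hcap j jj.
    have jx : enorm (x - j.1) < j.2.
      move: neg; rewrite E subr_lt0 -sqr_enorm.
      by rewrite ltr_pXn2r// nnegrE ?enorm_ge0// ltW.
    have lam20 : 0 < 2 * lam by rewrite mulr_gt0.
    have g1 : enorm ((2 * lam) *: (x - j.1)) <= 1.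
      rewrite enormZ gtr0_norm//; apply: le_trans lam1.
      by rewrite ler_wpM2l ?(ltW lam20)// (le_trans (ltW jx))// jH.
    have Kg : k1 <= K (enorm ((2 * lam) *: (x - j.1))).
      by apply: (diff_anti dK); rewrite ?enorm_ge0.
    have := hpsi x t bx s1 s2; rewrite ler_norml => /andP[hp _].
    apply: (@le_lt_trans _ _ eps); first by rewrite lerNl.
    rewrite dotpZl; apply: (@lt_le_trans _ _ (k1 * (2 * lam * c0))); last first.
      have l0 := ltW lam20; apply: ler_pM; rewrite ?(ltW k10) ?(mulr_ge0 l0 (ltW c00))//.
      exact: (ler_wpM2l l0 (jcap x bx jx)).
    have : 0 < lam * (k1 * c0) by rewrite mulr_gt0.
    by rewrite -lamE; lra.
move=> x t Ux tt1 tt2; apply: le_trans (cmp x t Ux tt1 tt2) _.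
have h1 : lam * (min_caps js x + H) <= lam * H.
  by rewrite ler_wpM2l ?(ltW lam0)// gerDr min_caps_le0.
have h2 : c * lam * (t - t1) <= c * lam * 2 by rewrite ler_wpM2l//; lra.
have -> : (H + 2 * c) / (k1 * c0) * eps = lam * H + c * lam * 2.
  by rewrite -lamE; field; rewrite !gt_eqF.
by rewrite /v; lra.
Qed.

End Growth.

(** * Oscillation decrease on a small ball *)

Section Closeness.
Context {R : realType} {n : nat}.
Variables (K th : R -> R) (a : R).
Hypothesis dK : diffusivity K th a.
Implicit Types (xi w x y : 'rV[R]_n) (D H X Y : 'M[R]_n).

(** Expand the form at t x - y and divide by t. *)
Lemma psd_young D x y t : (forall w, 0 <= qf D w) -> 0 < t ->
  qf D (x + y) <= (1 + t) * qf D x + (1 + t^-1) * qf D y.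
Proof.
move=> psd t0; have := psd (t *: x - y).
rewrite -scaleN1r /qf !(bfDl, bfDr, bfZl, bfZr) => h.
set A := bf D x x in h *; set B := bf D y y in h *.
set C := bf D x y in h *; set E := bf D y x in h *.
have {}h : 0 <= t^-1 * (t * (t * A) - t * C - (t * E - B)).
  by rewrite mulr_ge0 ?invr_ge0 ?(ltW t0)//; lra.
move: h; have -> : t^-1 * (t * (t * A) - t * C - (t * E - B)) = t * A - C - E + t^-1 * B.
  by field; rewrite gt_eqF.
by lra.
Qed.

Lemma unit_dist xi1 xi2 : xi1 != 0 -> xi2 != 0 ->
  enorm ((enorm xi1)^-1 *: xi1 - (enorm xi2)^-1 *: xi2) <= 2 * enorm (xi1 - xi2) / enorm xi1.
Proof.
move=> x1 x2; have e1 : 0 < enorm xi1 by rewrite enorm_gt0.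
have e2 : 0 < enorm xi2 by rewrite enorm_gt0.
have -> : (enorm xi1)^-1 *: xi1 - (enorm xi2)^-1 *: xi2 =
   (enorm xi1)^-1 *: (xi1 - xi2) + ((enorm xi2 - enorm xi1) / (enorm xi1 * enorm xi2)) *: xi2.
  apply/rowP => i; rewrite !mxE; field; rewrite !gt_eqF//.
apply: (le_trans (enormD _ _)); rewrite !enormZ.
rewrite normrM !normfV (ger0_norm (ltW e1)) normrM (gtr0_norm e1) (gtr0_norm e2).
have h : `|enorm xi2 - enorm xi1| <= enorm (xi1 - xi2).
  have := enormB_sub xi1 xi2; have := enormB_sub xi2 xi1; rewrite (enorm_distC xi2).
  by rewrite ler_norml => *; apply/andP; split; lra.
have -> : `|enorm xi2 - enorm xi1| / (enorm xi1 * enorm xi2) * enorm xi2 =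
  `|enorm xi2 - enorm xi1| / enorm xi1 by field; rewrite !gt_eqF.
rewrite mulrC -mulrDl ler_pM2r ?invr_gt0//; lra.
Qed.

(* The operator is asymptotically scale invariant: for large gradients at
   bounded distance, K varies by a factor close to 1 and th is close to a. *)
Lemma Lop_close kap q0 : 0 < kap -> kap < 1 -> 0 <= q0 ->
  exists2 X, 0 < X & forall xi1 xi2, X <= enorm xi1 -> X <= enorm xi2 ->
    enorm (xi1 - xi2) <= q0 ->
    forall D, (forall w, 0 <= qf D w) -> (1 - kap) * Lop K th xi2 D <= Lop K th xi1 D.
Proof.
move=> kap0 kap1 q00; have a1 : 0 < 1 - a by rewrite subr_gt0 (diff_lt1 dK).
have [th00 tha0] : 0 <= th 0 /\ th 0 <= a by apply/andP; exact: (diff_th dK).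
have a0 : 0 <= a by exact: le_trans tha0.
have [m [m0 m1 mE]] : exists m, [/\ 0 < m, m < 1 & m + 4 * m / (1 - a) = kap].
  have h : 0 < 5 - a by lra.
  exists (kap * (1 - a) / (5 - a)); split.
  - by rewrite divr_gt0// mulr_gt0.
  - by rewrite ltr_pdivrMr// mul1r; nra.
  - by field; rewrite !gt_eqF.
have [X1 X10 hth] := diff_th_infty dK m0.
pose X := X1 + q0 / m + (1 + m^-1) * (2 * q0) / m + 2 * q0 + 1.
have p1 : 0 <= q0 / m by rewrite divr_ge0 ?(ltW m0).
have p2 : 0 <= (1 + m^-1) * (2 * q0) / m.
  by rewrite divr_ge0 ?(ltW m0)// mulr_ge0 ?mulr_ge0// addr_ge0// invr_ge0 ltW.
exists X; first by rewrite /X; lra.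
move=> xi1 xi2 X1x X2x q12 D psd.
have h1X : X1 <= X by rewrite /X; lra.
have Xq : q0 <= m * X.
  have : m * (q0 / m) = q0 by field; rewrite gt_eqF.
  have : 0 <= m * (X - q0 / m) by rewrite mulr_ge0 ?(ltW m0)// /X; lra.
  by lra.
have Xq2 : (1 + m^-1) * (2 * q0) <= m * X.
  have : m * ((1 + m^-1) * (2 * q0) / m) = (1 + m^-1) * (2 * q0) by field; rewrite gt_eqF.
  have : 0 <= m * (X - (1 + m^-1) * (2 * q0) / m) by rewrite mulr_ge0 ?(ltW m0)// /X; lra.
  by lra.
have X2q : 2 * q0 <= X by rewrite /X; lra.
have X0 : 0 < X by rewrite /X; lra.
have e1 : 0 < enorm xi1 by exact: lt_le_trans X1x.
have e2 : 0 < enorm xi2 by exact: lt_le_trans X2x.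
have x1 : xi1 != 0 by rewrite -enorm_gt0.
have x2 : xi2 != 0 by rewrite -enorm_gt0.
clearbody X.
have K2 := diff_gt0 dK (ltW e2).
have Kc : (1 - m) * K (enorm xi2) <= K (enorm xi1).
  have [le|lt] := leP (enorm xi1) (enorm xi2).
    apply: le_trans (diff_anti dK (ltW e1) le).
    by rewrite ler_piMl ?(ltW K2)// gerBl ltW.
  have := diff_flux_le dK (ltW e2) (ltW lt) => h.
  rewrite -(ler_pM2l e1); apply: le_trans h; rewrite mulrA ler_wpM2r ?(ltW K2)//.
  have : enorm xi1 - enorm xi2 <= q0 by apply: le_trans q12; exact: enormB_sub.
  by nra.
rewrite !LopE//; set d1 := qf D (_ *: xi1); set d2 := qf D (_ *: xi2).
set T := \tr D.
have T0 : 0 <= T by apply: sumr_ge0 => i _; rewrite -bf_ebasis; exact: psd.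
have unit1 xi : xi != 0 -> dotp ((enorm xi)^-1 *: xi) ((enorm xi)^-1 *: xi) = 1.
  move=> x0; rewrite dotpZl dotpZr -sqr_enorm; field.
  by rewrite enorm_eq0.
have dT xi : xi != 0 -> qf D ((enorm xi)^-1 *: xi) <= T.
  by move=> x0; have := psd_le_tr ((enorm xi)^-1 *: xi) psd; rewrite unit1// mulr1.
have d2T : d2 <= T by exact: dT.
have d20 : 0 <= d2 by exact: psd.
have mu : enorm ((enorm xi1)^-1 *: xi1 - (enorm xi2)^-1 *: xi2) ^+ 2 <= 2 * q0 / X.
  set e := enorm _; have eh : e <= 2 * q0 / X.
    apply: le_trans (unit_dist x1 x2) _.
    apply: (@le_trans _ _ (2 * q0 / enorm xi1)); first by rewrite ler_pM2r ?invr_gt0// ler_wpM2l.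
    by rewrite ler_wpM2l ?mulr_ge0// lef_pV2.
  have ee : 0 <= e by exact: enorm_ge0.
  have e1' : e <= 1 by apply: (le_trans eh); rewrite ler_pdivrMr// mul1r.
  by rewrite expr2; apply: le_trans eh; rewrite ler_piMr.
have d12 : d1 <= d2 + 2 * m * T.
  have -> : d1 = qf D ((enorm xi2)^-1 *: xi2 + ((enorm xi1)^-1 *: xi1 - (enorm xi2)^-1 *: xi2)).
    by rewrite addrC subrK.
  apply: (le_trans (psd_young _ _ psd m0)); rewrite -/d2.
  have h := psd_le_tr ((enorm xi1)^-1 *: xi1 - (enorm xi2)^-1 *: xi2) psd.
  move: h; rewrite -sqr_enorm -/T; set d3 := qf D _ => h.
  have i0 : 0 <= 1 + m^-1 by rewrite addr_ge0// invr_ge0 ltW.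
  have h2 : (1 + m^-1) * d3 <= m * T.
    apply: (@le_trans _ _ ((1 + m^-1) * (T * (2 * q0 / X)))).
      by rewrite ler_wpM2l//; apply: (le_trans h); rewrite ler_wpM2l.
    have -> : (1 + m^-1) * (T * (2 * q0 / X)) = T * ((1 + m^-1) * (2 * q0) / X) by ring.
    by rewrite [leRHS]mulrC ler_wpM2l// ler_pdivrMr.
  have : m * d2 <= m * T by rewrite ler_wpM2l ?(ltW m0).
  by lra.
have := hth _ (le_trans h1X X1x); have := hth _ (le_trans h1X X2x).
have := diff_th dK (ltW e1); have := diff_th dK (ltW e2).
set t1 := th (enorm xi1); set t2 := th (enorm xi2).
move=> /andP[t20 t2a] /andP[t10 t1a]; rewrite !ler_norml => /andP[t2m _] /andP[_ t1m].
have t1lt : t1 <= 1 by apply: (le_trans t1a); lra.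
have low : (1 - a) * T <= T - t2 * d2 by nra.
have main : (1 - 4 * m / (1 - a)) * (T - t2 * d2) <= T - t1 * d1.
  have s1 : T - t2 * d2 - 4 * m * T <= T - t1 * d1.
    have c1 : t1 * d1 <= t1 * (d2 + 2 * m * T) by rewrite ler_wpM2l.
    have c2 : t1 * (2 * m * T) <= 2 * m * T by rewrite ler_piMl// !mulr_ge0// ltW.
    have c3 : t1 * d2 <= t2 * d2 + 2 * m * d2.
      by rewrite -mulrDl ler_wpM2r//; lra.
    have c4 : m * d2 <= m * T by rewrite ler_wpM2l ?(ltW m0).
    lra.
  apply: le_trans s1; rewrite mulrBl mul1r lerD2l lerN2.
  have : 4 * m / (1 - a) * ((1 - a) * T) <= 4 * m / (1 - a) * (T - t2 * d2).
    by rewrite ler_wpM2l// divr_ge0 ?(ltW a1)// mulr_ge0// ltW.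
  apply: le_trans; rewrite le_eqVlt; apply/orP; left; apply/eqP.
  by field; rewrite gt_eqF.
have P0 : 0 <= T - t2 * d2 by apply: le_trans low; rewrite mulr_ge0 ?(ltW a1).
have M0 : 0 <= T - t1 * d1.
  have : d1 <= T by exact: dT.
  have d10 : 0 <= d1 by exact: psd.
  by have := ler_piMl d10 t1lt; lra.
apply: (@le_trans _ _ ((1 - m) * K (enorm xi2) * (T - t1 * d1))); last first.
  by rewrite ler_wpM2r.
rewrite mulrCA [_ * K _]mulrC -mulrA ler_wpM2l ?(ltW K2)//.
apply: (@le_trans _ _ ((1 - m) * ((1 - 4 * m / (1 - a)) * (T - t2 * d2)))); last first.
  by rewrite ler_wpM2l// subr_ge0 ltW.
rewrite mulrA ler_wpM2r// -mE.
have : 0 <= m * (4 * m / (1 - a)) by rewrite mulr_ge0 ?(ltW m0)// divr_ge0 ?(ltW a1)// mulr_ge0// ltW.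
lra.
Qed.

(** Closeness of the operators is known on semidefinite forms only, so X and Y are written as B - X'
    and Y' - B. The change of operator then costs a multiple of kap B; the gain m lies along the
    gradient, where the operator is weakest, and survives with the factor 1 - a. *)
Lemma Lop_pair_le kap B q m xi1 xi2 X Y : 0 < kap -> kap <= 1 / 2 -> 0 <= B -> 0 <= q -> 0 <= m ->
  xi2 != 0 ->
  (forall D, (forall w, 0 <= qf D w) -> (1 - kap) * Lop K th xi2 D <= Lop K th xi1 D) ->
  (forall D, (forall w, 0 <= qf D w) -> (1 - kap) * Lop K th xi1 D <= Lop K th xi2 D) ->
  (forall w, qf X w <= B * dotp w w) -> (forall w, - qf Y w <= B * dotp w w) ->
  (forall w, qf X w - qf Y w <= 2 * q * dotp w w) ->
  qf X xi2 - qf Y xi2 <= (2 * q - m) * dotp xi2 xi2 ->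
  Lop K th xi1 X - Lop K th xi2 Y <=
    K (enorm xi2) * (4 * kap * n%:R * B + 2 * q * n%:R - (1 - a) * m / 2).
Proof.
move=> kap0 kap2 B0 q0 m0 x2 c12 c21 hX hY hXY he.
have a1 : 0 < 1 - a by rewrite subr_gt0 (diff_lt1 dK).
have e2 : 0 < enorm xi2 by rewrite enorm_gt0.
have K2 := diff_gt0 dK (ltW e2).
pose X' := B%:M - X; pose Y' := B%:M + Y.
have pX w : 0 <= qf X' w by rewrite qfBH qf_scalar subr_ge0.
have pY w : 0 <= qf Y' w by rewrite qfDH qf_scalar; have := hY w; lra.
have pI w : 0 <= qf (1%:M : 'M[R]_n) w by rewrite qf_scalar mul1r dotp_ge0.
have EX xi : Lop K th xi X = B * Lop K th xi 1%:M - Lop K th xi X'.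
  by rewrite -Lop_scalar -LopBr /X' opprB addrC subrK.
have EY xi : Lop K th xi Y = Lop K th xi Y' - B * Lop K th xi 1%:M.
  by rewrite -Lop_scalar -LopBr /Y' addrC addKr.
(* The slack in X - Y <= 2 q: a semidefinite form whose value along xi2 is at least m times the
   squared norm. *)
pose D := (2 * q)%:M - (X - Y).
have pD w : 0 <= qf D w by rewrite /D !qfBH qf_scalar subr_ge0.
have ED : Lop K th xi2 D = 2 * q * Lop K th xi2 1%:M - (Lop K th xi2 X - Lop K th xi2 Y).
  by rewrite -Lop_scalar -!LopBr.
have I2 : Lop K th xi2 1%:M <= K (enorm xi2) * n%:R.
  by have /andP[_] := Lop_psd_bounds dK xi2 pI; rewrite mxtrace_scalar.
have I20 : 0 <= Lop K th xi2 1%:M by exact: (Lop_psd_ge0 dK).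
have D2 : K (enorm xi2) * ((1 - a) * m) <= Lop K th xi2 D.
  rewrite /Lop ler_pM2l//; have /andP[_ dt] := qf_div_tr_ge xi2 pD.
  have dm : m <= qf D xi2 / enorm xi2 ^+ 2.
    rewrite ler_pdivlMr ?exprn_gt0// sqr_enorm /D !qfBH qf_scalar.
    have := he; lra.
  have /andP[t0 ta] := diff_th dK (ltW e2).
  by nra.
have h1 := c12 X' pX; have h2 := c21 _ pI.
have Y20 := Lop_psd_ge0 dK xi2 pY.
move: h1 ED; rewrite !EX !EY => h1 ED.
set L1 := Lop K th xi1 1%:M in h1 h2 ED *; set L2 := Lop K th xi2 1%:M in h1 h2 ED I2 I20 *.
set A1 := Lop K th xi1 X' in h1 *; set A2 := Lop K th xi2 X' in h1 ED *.
set Y2 := Lop K th xi2 Y' in Y20 ED *; set D0 := Lop K th xi2 D in D2 ED *.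
set k := K (enorm xi2) in K2 I2 D2 *.
have L1L2 : L1 <= (1 + 2 * kap) * L2.
  have : 0 <= (1 + 2 * kap) * (L2 - (1 - kap) * L1) by rewrite mulr_ge0 ?subr_ge0// addr_ge0// mulr_ge0// ltW.
  have L10 : 0 <= L1 by exact: (Lop_psd_ge0 dK).
  have : 0 <= L1 * (kap * (1 - 2 * kap)).
    rewrite mulr_ge0// mulr_ge0 ?(ltW kap0)//; lra.
  nra.
have s1 : B * L1 - A1 - (Y2 - B * L2) <= B * L1 + B * L2 - (1 - kap) * (A2 + Y2).
  have : 0 <= kap * Y2 by rewrite mulr_ge0// ltW.
  lra.
apply: (le_trans s1).
have -> : A2 + Y2 = 2 * B * L2 + D0 - 2 * q * L2 by lra.
have s2 : B * L1 <= B * ((1 + 2 * kap) * L2) by rewrite ler_wpM2l.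
have s3 : kap * B * L2 <= kap * B * (k * n%:R) by rewrite ler_wpM2l// mulr_ge0// ltW.
have s4 : q * L2 <= q * (k * n%:R) by rewrite ler_wpM2l.
have D00 : 0 <= D0 by exact: (Lop_psd_ge0 dK).
have s5 : (1 - kap) * D0 >= k * ((1 - a) * m) / 2.
  apply: (@le_trans _ _ (1 / 2 * D0)); first by lra.
  by rewrite ler_wpM2r//; lra.
have s6 : (1 - kap) * (q * L2) <= q * L2.
  by have := mulr_ge0 (ltW kap0) (mulr_ge0 q0 I20); lra.
lra.
Qed.

End Closeness.

(** * The square root penalty *)

Section Modulus.
Context {R : realType} {n : nat}.
Implicit Types (x y z w v : 'rV[R]_n).

(** The left side is the fourth root of |z|^2 (1 + 4 q), and (1 + 4 q)^(1/4) <= 1 + q. *)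
Lemma sqrt_enorm_line_le z w h : z != 0 ->
  Num.sqrt (enorm (z + h *: w)) <= Num.sqrt (enorm z) *
    (1 + (2 * h * dotp z w + h ^+ 2 * dotp w w) / (4 * enorm z ^+ 2)).
Proof.
move=> z0; have r0 : 0 < enorm z by rewrite enorm_gt0.
set r := enorm z in r0 *; set k := 2 * h * _ + _.
have E : enorm (z + h *: w) ^+ 2 = r ^+ 2 + k.
  rewrite !sqr_enorm /k !(dotpDl, dotpDr, dotpZl, dotpZr) (dotpC w z); ring.
have [q qE] : exists q : R, q = k / (4 * r ^+ 2) by eexists.
have kq : k = 4 * q * r ^+ 2 by rewrite qE; field; rewrite gt_eqF.
rewrite -qE; have r20 : 0 < r ^+ 2 by rewrite exprn_gt0.
have q1 : 0 <= 1 + q.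
  have E2 : r ^+ 2 * (1 + 4 * q) = r ^+ 2 + k by rewrite kq; ring.
  have : 0 <= r ^+ 2 * (1 + 4 * q) by rewrite E2 -E sqr_ge0.
  by rewrite pmulr_rge0// => ?; lra.
have h1 : enorm (z + h *: w) <= r * (1 + q) ^+ 2.
  rewrite -(@ler_pXn2r _ 2)// ?nnegrE ?enorm_ge0 ?mulr_ge0 ?sqr_ge0 ?(ltW r0)//.
  rewrite E kq exprMn -[leLHS](_ : r ^+ 2 * (1 + 4 * q) = _); last by ring.
  rewrite ler_wpM2l ?(ltW r20)//.
  have : 0 <= q ^+ 2 * ((q + 2) ^+ 2 + 2) by rewrite mulr_ge0 ?sqr_ge0// addr_ge0// sqr_ge0.
  lra.
apply: (le_trans (ler_wsqrtr h1)).
by rewrite sqrtrM ?(ltW r0)// sqrtr_sqr ger0_norm.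
Qed.

(** Taylor polynomial of third order. The term - h^2 / 2 is the strict concavity on which the gain
    of the doubling rests. *)
Lemma sqrt_stretch_le (h : R) : `|h| <= 1 / 2 ->
  Num.sqrt (1 + 2 * h) <= 1 + h - h ^+ 2 / 2 + h ^+ 3 / 2.
Proof.
rewrite ler_norml => /andP[h1 h2].
have p : 0 <= 1 + h - h ^+ 2 / 2 + h ^+ 3 / 2.
  have : 0 <= h ^+ 2 * (1 + h) by rewrite mulr_ge0 ?sqr_ge0//; lra.
  have : 0 <= (1 / 2 - h) * (1 / 2 + h) by rewrite mulr_ge0//; lra.
  lra.
rewrite -(@ler_pXn2r _ 2)// ?nnegrE ?sqrtr_ge0// sqr_sqrtr; last by lra.
have : 0 <= (h ^+ 2) ^+ 2 by rewrite sqr_ge0.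
have : 0 <= (h ^+ 2 * (1 - h)) ^+ 2 by rewrite sqr_ge0.
lra.
Qed.

Lemma closed_eball_compact (c : 'rV[R]_n) (r : R) : compact [set x | enorm (x - c) <= r].
Proof.
apply: bounded_closed_compact.
  exists (r + `|c|); split; first by rewrite num_real.
  move=> M hM x /= hx; apply/ltW; apply: le_lt_trans hM.
  rewrite -[x](subrK c); apply: (le_trans (ler_normD _ _)); rewrite lerD2r.
  by apply: le_trans (norm_le_enorm _) _.
have -> : [set x | enorm (x - c) <= r] = (fun x => enorm (x - c)) @^-1` [set s | s <= r] by [].
apply: preimage_closed; last exact: closed_le.
move=> x _; apply: (@continuous_comp _ _ _ (fun x : 'rV[R]_n => x - c) (@enorm R n)).
  by apply: continuousB; [exact: cvg_id|exact: cst_continuous].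
exact: enorm_continuous.
Qed.

Variables (K th : R -> R) (a : R) (U : set 'rV[R]_n) (nu : 'rV[R]_n -> 'rV[R]_n)
  (u psi : 'rV[R]_n -> R -> R).
Hypotheses (dK : diffusivity K th a) (F : flow K th U nu u psi).
Hypothesis n0 : (0 < n)%N.

Lemma jet2_pair x y v w t : jet2 (fun h => u (x + h *: v) t - u (y + h *: w) t)
  (dotp (fgrad F x t) v - dotp (fgrad F y t) w)
  (qf (fhess F x t) v - qf (fhess F y t) w).
Proof. by apply: jet2D; [exact: flow_jet2|apply: jet2N; exact: flow_jet2]. Qed.

(* First and second order conditions at a maximum of
   u x - u y - L sqrt|x - y| - Q |x - x0|^2. *)
Lemma doubling_conditions x y x0 t L Q d : 0 < d -> 0 < L -> 0 < Q -> x != y ->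
  (forall v w h, `|h| * (enorm v + enorm w) < d ->
     u (x + h *: v) t - u (y + h *: w) t
       - (L * Num.sqrt (enorm (x + h *: v - (y + h *: w)))
          + Q * dotp (x + h *: v - x0) (x + h *: v - x0)) <=
     u x t - u y t - (L * Num.sqrt (enorm (x - y)) + Q * dotp (x - x0) (x - x0))) ->
  exists2 om, om = L * Num.sqrt (enorm (x - y)) / (2 * enorm (x - y) ^+ 2) &
  [/\ fgrad F y t = om *: (x - y),
      fgrad F x t = fgrad F y t + (2 * Q) *: (x - x0),
      forall w, qf (fhess F x t) w <= (om + 2 * Q) * dotp w w,
      forall w, - qf (fhess F y t) w <= (om + 2 * Q) * dotp w w &
      (forall w, qf (fhess F x t) w - qf (fhess F y t) w <= 2 * Q * dotp w w) /\
      qf (fhess F x t) (x - y) - qf (fhess F y t) (x - y) <=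
        (2 * Q - 2 * om) * dotp (x - y) (x - y)].
Proof.
move=> d0 L0 Q0 xy hmax.
have z0 : x - y != 0 by rewrite subr_eq0.
have r0 : 0 < enorm (x - y) by rewrite enorm_gt0.
(* The gradient of L sqrt|z| is om z. *)
set r := enorm (x - y) in r0 *; set om := L * _ / _; exists om => //.
have om0 : 0 <= om by rewrite divr_ge0 ?mulr_ge0 ?sqrtr_ge0 ?sqr_ge0 ?(ltW L0).
have omE : L * Num.sqrt r = 2 * om * r ^+ 2 by rewrite /om; field; rewrite gt_eqF.
(* The maximum test along the line (x + h v, y + h w), given any upper expansion of the penalty. It
   serves for equal shifts, for x alone, for y alone and for opposite shifts. *)
have key v w (A B : R) :
    (forall h, `|h| <= 1 / 2 -> L * Num.sqrt (enorm (x + h *: v - (y + h *: w))) <=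
       L * Num.sqrt r + A * h + B / 2 * h ^+ 2 + (L * Num.sqrt r / 2) * `|h| ^+ 3) ->
    dotp (fgrad F x t) v - dotp (fgrad F y t) w = A + 2 * Q * dotp (x - x0) v /\
    qf (fhess F x t) v - qf (fhess F y t) w <= B + 2 * Q * dotp v v.
  move=> hAB; have s0 : 0 < 1 + enorm v + enorm w.
    by rewrite -addrA ltr_pwDl// addr_ge0 ?enorm_ge0.
  have dd : 0 < d / (1 + enorm v + enorm w) by rewrite divr_gt0.
  apply: (jet2_max dd _ (jet2_pair x y v w t)
    (_ : ujet2 (fun h => L * Num.sqrt (enorm (x + h *: v - (y + h *: w)))
          + Q * dotp (x + h *: v - x0) (x + h *: v - x0)) _ _)).
    move=> h; rewrite ltr_pdivlMr// => hh; rewrite !scale0r !addr0; apply: hmax.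
    by apply: le_lt_trans hh; rewrite ler_wpM2l// -addrA lerDr.
  apply: ujet2D.
    apply: (@ujet2_cubic _ _ _ _ (L * Num.sqrt r / 2) (1 / 2)) => // h /ltW/hAB.
    by rewrite !scale0r !addr0.
  have -> : 2 * Q * dotp (x - x0) v = dotp ((2 * Q) *: (x - x0)) v by rewrite dotpZl.
  rewrite -qf_scalar; apply: (@quad_ujet2 _ _ (fun x => Q * dotp (x - x0) (x - x0)) 0) => [z|].
    by rewrite add0r.
  by rewrite add0r.
have cub (h : R) : 0 <= (L * Num.sqrt r / 2) * `|h| ^+ 3.
  by rewrite mulr_ge0 ?exprn_ge0// divr_ge0// mulr_ge0 ?sqrtr_ge0 ?(ltW L0).
have both w := key w w 0 0.
have {}both w : dotp (fgrad F x t) w - dotp (fgrad F y t) w = 0 + 2 * Q * dotp (x - x0) w /\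
    qf (fhess F x t) w - qf (fhess F y t) w <= 0 + 2 * Q * dotp w w.
  apply: both => h _; have -> : x + h *: w - (y + h *: w) = x - y.
    by rewrite opprD addrACA subrr addr0.
  by have := cub h; rewrite -/r; lra.
have line v (h : R) : L * Num.sqrt (enorm (x - y + h *: v)) <=
   L * Num.sqrt r + om * dotp (x - y) v * h + (om * dotp v v) / 2 * h ^+ 2.
  apply: (le_trans (ler_wpM2l (ltW L0) (sqrt_enorm_line_le v h z0))); rewrite -/r.
  rewrite mulrA omE le_eqVlt; apply/orP; left; apply/eqP; field; rewrite gt_eqF//.
have onlyx v : dotp (fgrad F x t) v - dotp (fgrad F y t) 0 = om * dotp (x - y) v + 2 * Q * dotp (x - x0) v /\
    qf (fhess F x t) v - qf (fhess F y t) 0 <= om * dotp v v + 2 * Q * dotp v v.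
  apply: key => h _; have -> : x + h *: v - (y + h *: 0) = x - y + h *: v.
    by rewrite scaler0 addr0 addrAC.
  by have := line v h; have := cub h; lra.
have onlyy w : dotp (fgrad F x t) 0 - dotp (fgrad F y t) w = om * dotp (x - y) (- w) + 2 * Q * dotp (x - x0) 0 /\
    qf (fhess F x t) 0 - qf (fhess F y t) w <= om * dotp (- w) (- w) + 2 * Q * dotp (0 : 'rV[R]_n) 0.
  apply: key => h _; have -> : x + h *: 0 - (y + h *: w) = x - y + h *: (- w).
    by rewrite scaler0 addr0 opprD addrA scalerN.
  by have := line (- w) h; have := cub h; lra.
have q0 (H : 'M[R]_n) : qf H 0 = 0 by rewrite -(scale0r (0 : 'rV[R]_n)) qfZ expr0n mul0r.
have gy : fgrad F y t = om *: (x - y).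
  apply: eq_dotp => w; have [] := onlyy w.
  by rewrite (dotpC _ 0) !dotp0l (dotpC _ 0) dotp0l dotpNr dotpZl; lra.
split=> // [|w|w|].
- by apply: eq_dotp => w; rewrite dotpDl dotpZl; have [] := both w; lra.
- by have [_] := onlyx w; rewrite q0; lra.
- have [_] := onlyy w; rewrite q0 dotpNl dotpNr opprK dotp0l.
  have : 0 <= 2 * Q * dotp w w by rewrite mulr_ge0 ?dotp_ge0// mulr_ge0 ?(ltW Q0).
  lra.
split=> [w|]; first by have [_] := both w; lra.
(* Opposite shifts along x - y stretch the distance by 1 + 2 h, and [sqrt_stretch_le] makes the
   second order term negative. *)
have [] := key (x - y) (- (x - y)) (2 * om * r ^+ 2) (- (2 * om * r ^+ 2)).
  move=> h h12; have -> : x + h *: (x - y) - (y + h *: (- (x - y))) = (1 + 2 * h) *: (x - y).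
    by apply/rowP => i; rewrite !mxE; ring.
  have hp : 0 <= 1 + 2 * h by move: h12; rewrite ler_norml => /andP[]; lra.
  rewrite enormZ ger0_norm// sqrtrM// -/r mulrCA omE.
  have S0 : 0 <= 2 * om * r ^+ 2 by rewrite -omE mulr_ge0 ?sqrtr_ge0 ?(ltW L0).
  rewrite mulrC; apply: (le_trans (ler_wpM2l S0 (sqrt_stretch_le h12))).
  have : 2 * om * r ^+ 2 * h ^+ 3 <= 2 * om * r ^+ 2 * `|h| ^+ 3.
    by rewrite ler_wpM2l// -normrX ler_norm.
  lra.
move=> _; have -> : qf (fhess F y t) (- (x - y)) = qf (fhess F y t) (x - y).
  by rewrite -[- (x - y)]scaleN1r qfZ sqrrN expr1n mul1r.
rewrite -!sqr_enorm -/r; lra.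
Qed.

End Modulus.

(** * Doubling of variables *)

Section IshiiLions.
Context {R : realType} {n : nat}.
Variables (K th : R -> R) (a : R) (U : set 'rV[R]_n) (nu : 'rV[R]_n -> 'rV[R]_n)
  (u psi : 'rV[R]_n -> R -> R).
Hypotheses (dK : diffusivity K th a) (F : flow K th U nu u psi) (n0 : (0 < n)%N).

Lemma flow_ujet1_back_pair x y t :
  ujet1 (fun h => - (u x (t - h) - u y (t - h))) (fdt F x t - fdt F y t).
Proof.
move=> e e0; have e20 : 0 < e / 2 by rewrite divr_gt0.
have /is_derive_eps/(_ _ e20)[d1 d10 h1] := flow_dt F x t.
have /is_derive_eps/(_ _ e20)[d2 d20 h2] := flow_dt F y t.
exists (Num.min d1 d2); first by rewrite lt_min d10.
move=> h /andP[h0]; rewrite lt_min => /andP[hd1 hd2].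
have := h1 (- h); rewrite normrN gtr0_norm// => /(_ hd1).
have := h2 (- h); rewrite normrN gtr0_norm// => /(_ hd2).
by rewrite subr0 !ler_norml => /andP[? ?] /andP[? ?]; lra.
Qed.

Lemma sqrt_powers (r : R) : 0 < r -> exists2 s, 0 < s & Num.sqrt r = s /\ r = s ^+ 2.
Proof.
move=> r0; exists (Num.sqrt r); first by rewrite sqrtr_gt0.
by rewrite sqr_sqrtr// ltW.
Qed.

(* Doubling of variables: the gain eta/2 over the a priori oscillation O is
   uniform in O because only the top part, of height 2 eta, of the oscillation
   is penalised. *)
Lemma oscillation_gain c rho eta : 0 < rho -> 0 < eta ->
  (forall x, enorm (x - c) <= 3 * rho -> U x) ->
  exists2 r1, 0 < r1 & r1 <= rho /\ forall t0 O, 1 <= t0 -> eta <= O ->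
    (forall x y t, U x -> U y -> t0 - 1 <= t -> t <= t0 -> u x t - u y t <= O + eta) ->
    forall x y, enorm (x - c) <= r1 -> enorm (y - c) <= r1 ->
    u x t0 - u y t0 <= O - eta / 2.
Proof.
move=> rho0 eta0 hU; have a1 : 0 < 1 - a by rewrite subr_gt0 (diff_lt1 dK).
have a0 : 0 <= a by have /andP[h1 h2] := diff_th dK (lexx 0); exact: le_trans h2.
have nn : 1 <= n%:R :> R by rewrite ler1n.
have np : 0 < n%:R :> R by rewrite ltr0n.
(* Each of the three penalties is normalised to reach 2 eta at the edge of its range: this one at |x
   - x0| = rho, the square root at distance r0, and the one in time at t0 - 1. *)
have [Q Q0 QE] : exists2 Q, 0 < Q & Q * rho ^+ 2 = 2 * eta.
  by exists (2 * eta / rho ^+ 2); rewrite ?divr_gt0 ?mulr_gt0 ?exprn_gt0// divfK// gt_eqF// exprn_gt0.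
(* Exchanging the operators then costs at most half of the concavity gain (1 - a) om, up to a
   multiple of Q. *)
have [kap [kap0 kap2 kapE]] : exists kap, [/\ 0 < kap, kap <= 1 / 2 & 4 * kap * n%:R = (1 - a) / 2].
  exists ((1 - a) / (8 * n%:R)); split.
  - by rewrite divr_gt0// mulr_gt0.
  - by rewrite ler_pdivrMr ?mulr_gt0//; lra.
  - by field; rewrite gt_eqF.
have kap1 : kap < 1 by lra.
have q00 : 0 <= 2 * Q * rho by rewrite !mulr_ge0// ltW.
have [X X0 close] := @Lop_close R n K th a dK kap _ kap0 kap1 q00.
have [X2 X20 hflux] := diff_flux_infty dK (8 * eta / (1 - a) + 1).
(* [Z] will bound the gradient at y from below. The conditions put both gradients in the range of
   [Lop_close], make the flux large, let om absorb the terms with Q, and make r0 = eta / Z at most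
   rho and at most 1. *)
have [Z [ZX ZX2 ZQ Zr Zeta]] : exists Z, [/\ X + 2 * Q * rho <= Z, X2 <= Z,
    (2 * n%:R + 1) * Q <= (1 - a) * Z / 4, eta <= Z * rho & eta <= Z].
  pose W := 4 * (2 * n%:R + 1) * Q / (1 - a).
  have W0 : 0 <= W by rewrite divr_ge0 ?(ltW a1)// !mulr_ge0 ?addr_ge0 ?mulr_ge0 ?(ltW Q0).
  have WE : (1 - a) * W / 4 = (2 * n%:R + 1) * Q by rewrite /W; field; rewrite gt_eqF.
  have er0 : 0 <= eta / rho by rewrite divr_ge0 ?ltW.
  have erE : eta / rho * rho = eta by rewrite divfK// gt_eqF.
  clearbody W; exists (X + 2 * Q * rho + X2 + W + eta / rho + eta); split; try lra.
  - have : 0 <= (1 - a) * (X + 2 * Q * rho + X2 + eta / rho + eta).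
      by rewrite mulr_ge0 ?(ltW a1)//; lra.
    lra.
  - have : 0 <= (X + 2 * Q * rho + X2 + W + eta) * rho by rewrite mulr_ge0 ?(ltW rho0)//; lra.
    by rewrite -[X in _ -> X <= _]erE; lra.
have Z0 : 0 < Z by exact: lt_le_trans Zeta.
have [r0 r00 r0E] : exists2 r0, 0 < r0 & Z * r0 = eta.
  by exists (eta / Z); rewrite ?divr_gt0// mulrCA divff ?mulr1// gt_eqF.
have r01 : r0 <= 1 by rewrite -(ler_pM2l Z0) r0E mulr1.
have r0rho : r0 <= rho by rewrite -(ler_pM2l Z0) r0E.
have [s0 s00 [s0E r0s]] := sqrt_powers r00.
(* At distances up to r0 the penalty L sqrt|z| then has slope at least L / (2 s0) = eta / r0 = Z. *)
have [L L0 LE] : exists2 L, 0 < L & L * s0 = 2 * eta.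
  by exists (2 * eta / s0); rewrite ?divr_gt0 ?mulr_gt0// divfK// gt_eqF.
(* Two points of this ball are within r0 / 16, where the square root penalty is at most a quarter of
   2 eta; this leaves O - eta / 2. *)
exists (r0 / 32); first by rewrite divr_gt0.
split=> [|t0 O t01 etaO hosc x0 y0 hx0 hy0]; first by lra.
pose W (p : ('rV[R]_n * 'rV[R]_n) * R) := u p.1.1 p.2 - u (p.1.1 - p.1.2) p.2
  - ((O - eta) + L * Num.sqrt (enorm p.1.2) + Q * dotp (p.1.1 - x0) (p.1.1 - x0)
     + 2 * eta * (t0 - p.2)).
pose A : set (('rV[R]_n * 'rV[R]_n) * R) := ([set x | enorm (x - x0) <= rho] `*`
  [set z | enorm (z - 0) <= r0]) `*` `[t0 - 1, t0]%classic.
suff WA : forall x z t, enorm (x - x0) <= rho -> enorm z <= r0 -> t0 - 1 <= t -> t <= t0 ->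
    W ((x, z), t) <= 0.
  have z0 : enorm (x0 - y0) <= r0 / 16.
    have -> : x0 - y0 = (x0 - c) - (y0 - c) by rewrite opprB addrA subrK.
    by apply: (le_trans (enormD _ _)); rewrite enormN; lra.
  have := WA x0 (x0 - y0) t0; rewrite subrr enorm0 => /(_ (ltW rho0) _ _ (lexx _)).
  have -> : enorm (x0 - y0) <= r0 by lra.
  have -> : t0 - 1 <= t0 by lra.
  move=> /(_ isT isT); rewrite /W /= subKr subrr dotp0l !mulr0 !addr0.
  have : L * Num.sqrt (enorm (x0 - y0)) <= L * (s0 / 4).
    rewrite ler_wpM2l ?(ltW L0)//; apply: (le_trans (ler_wsqrtr z0)).
    have -> : r0 / 16 = (s0 / 4) ^+ 2 by rewrite r0s; field.
    by rewrite sqrtr_sqr ger0_norm// divr_ge0 ?(ltW s00).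
  have -> : L * (s0 / 4) = eta / 2 by rewrite mulrA LE; field.
  lra.
have cA : compact A.
  by apply: compact_setX; [apply: compact_setX; exact: closed_eball_compact|exact: segment_compact].
have A0 : A !=set0.
  exists ((x0, 0), t0); split; [split|] => /=.
  - by rewrite subrr enorm0 ltW.
  - by rewrite subrr enorm0 ltW.
  - by rewrite in_itv /= lexx andbT; lra.
have cW : continuous W.
  have c11 : continuous (fun p : ('rV[R]_n * 'rV[R]_n) * R => p.1.1).
    by move=> p; apply: (@continuous_comp _ _ _ fst fst); exact: cvg_fst.
  have c12 : continuous (fun p : ('rV[R]_n * 'rV[R]_n) * R => p.1.2).
    by move=> p; apply: (@continuous_comp _ _ _ fst snd); [exact: cvg_fst|exact: cvg_snd].
  have c2 : continuous (fun p : ('rV[R]_n * 'rV[R]_n) * R => p.2) by move=> p; exact: cvg_snd.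
  have cu (f : ('rV[R]_n * 'rV[R]_n) * R -> 'rV[R]_n) : continuous f ->
      continuous (fun p => u (f p) p.2).
    move=> cf p; apply: (@continuous_comp _ _ _ (fun p => (f p, p.2)) (fun z => u z.1 z.2)).
      exact: (cvg_pair (cf p) (c2 p)).
    exact: (flow_continuous F).
  have ce : continuous (fun p : ('rV[R]_n * 'rV[R]_n) * R => Num.sqrt (enorm p.1.2)).
    move=> p; apply: (@continuous_comp _ _ _ (fun p : ('rV[R]_n * 'rV[R]_n) * R => p.1.2) (Num.sqrt \o @enorm R n)).
      exact: c12.
    by apply: continuous_comp; [exact: enorm_continuous|exact: sqrt_continuous].
  have cd : continuous (fun p : ('rV[R]_n * 'rV[R]_n) * R => dotp (p.1.1 - x0) (p.1.1 - x0)).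
    move=> p; apply: (@continuous_comp _ _ _ (fun p : ('rV[R]_n * 'rV[R]_n) * R => p.1.1) (fun x : 'rV[R]_n => dotp (x - x0) (x - x0))).
      exact: c11.
    exact: sqdist_continuous.
  move=> p; rewrite /W; apply: cvgB.
    apply: cvgB; apply: cu; first exact: c11.
    by move=> q; apply: cvgB; [exact: c11|exact: c12].
  apply: cvgD; last by apply: cvgM; [exact: cvg_cst|apply: cvgB; [exact: cvg_cst|exact: c2]].
  apply: cvgD; last by apply: cvgM; [exact: cvg_cst|exact: cd].
  by apply: cvgD; [exact: cvg_cst|apply: cvgM; [exact: cvg_cst|exact: ce]].
have [[[x z] s] /set_mem [[/= Ax]]] := compact_EVT_max A0 cA (continuous_subspaceT cW).
rewrite /= subr0 in_itv /= => Az /andP[s1 s2] hmax.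
have {}hmax x' z' t : enorm (x' - x0) <= rho -> enorm z' <= r0 -> t0 - 1 <= t -> t <= t0 ->
    W ((x', z'), t) <= W ((x, z), s).
  move=> h1 h2 h3 h4; apply: hmax; apply: mem_set; split; first by split; rewrite //= subr0.
  by rewrite /= in_itv /= h3.
suff Wmax : W ((x, z), s) <= 0.
  by move=> x' z' t h1 h2 h3 h4; apply: le_trans Wmax; exact: hmax.
rewrite leNgt; apply/negP => Wpos.
have inU x' : enorm (x' - x0) <= rho + r0 -> U x'.
  move=> h; apply: hU; have -> : x' - c = (x' - x0) + (x0 - c) by rewrite addrA subrK.
  by apply: (le_trans (enormD _ _)); clear -F dK n0 h hx0 r0rho r00; lra.
pose y := x - z; have zE : x - y = z by rewrite /y subKr.
have Ux : U x by apply: inU; clear -F dK n0 Ax r00; lra.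
have Uy : U y.
  apply: inU; have -> : y - x0 = (x - x0) - z by rewrite /y addrAC.
  by apply: (le_trans (enormD _ _)); rewrite enormN; clear -F dK n0 Ax Az; lra.
have oxy := hosc x y s Ux Uy s1 s2.
have L1 : 0 <= L * Num.sqrt (enorm z) by rewrite mulr_ge0 ?sqrtr_ge0 ?(ltW L0).
have Q1 : 0 <= Q * dotp (x - x0) (x - x0) by rewrite mulr_ge0 ?dotp_ge0 ?(ltW Q0).
have T1 : 0 <= 2 * eta * (t0 - s) by rewrite mulr_ge0 ?mulr_ge0 ?(ltW eta0)// subr_ge0.
(* Since u x - u y <= O + eta, no single penalty can be as large as 2 eta, so the maximum lies off
   the edges of A, except possibly at s = t0, where the backward test in time still works. The case
   z = 0 is excluded by O >= eta. *)
have Wp : O - eta + L * Num.sqrt (enorm z) + Q * dotp (x - x0) (x - x0) + 2 * eta * (t0 - s)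
    < u x s - u y s by move: Wpos; rewrite /W /= -/y; clear -F dK n0; lra.
have z0 : z != 0.
  by apply/eqP => z0; move: Wp L1; rewrite /y z0 subr0; clear -F dK n0 Q1 T1 etaO; lra.
have s1' : t0 - 1 < s.
  rewrite lt_def s1 andbT; apply/eqP => sE; move: Wp oxy; rewrite sE.
  have -> : t0 - (t0 - 1) = 1 by clear -F dK n0; lra.
  by clear -F dK n0 L1 Q1; lra.
have xlt : enorm (x - x0) < rho.
  rewrite lt_def Ax andbT; apply/eqP => xE; move: Wp.
  by rewrite -sqr_enorm -xE QE; clear -F dK n0 oxy L1 T1; lra.
have zlt : enorm z < r0.
  rewrite lt_def Az andbT; apply/eqP => zE'; move: Wp.
  by rewrite -zE' s0E LE; clear -F dK n0 oxy Q1 T1; lra.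
have sp : 0 < s by clear -F dK n0 s1' t01; lra.
have xy : x != y by rewrite -subr_eq0 zE.
pose d := Num.min (rho - enorm (x - x0)) (r0 - enorm z).
have d0 : 0 < d by rewrite lt_min !subr_gt0 xlt.
have cond := @doubling_conditions _ _ _ _ _ _ _ _ F x y x0 s L Q d d0 L0 Q0 xy.
have {cond}[|om omE [gy gx hX hY [hXY he]]] := cond.
  move=> v w h; rewrite lt_min mulrDr => /andP[hd1 hd2].
  have v0 : 0 <= `|h| * enorm v by rewrite mulr_ge0 ?enorm_ge0.
  have w0 : 0 <= `|h| * enorm w by rewrite mulr_ge0 ?enorm_ge0.
  have := hmax (x + h *: v) (x + h *: v - (y + h *: w)) s.
  rewrite /W /= !subKr -/y ?zE s2 s1.
  have -> : enorm (x + h *: v - x0) <= rho.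
    rewrite addrAC; apply: (le_trans (enormD _ _)); rewrite enormZ.
    by clear -F dK n0 hd1 w0; lra.
  have -> : enorm (x + h *: v - (y + h *: w)) <= r0.
    have -> : x + h *: v - (y + h *: w) = z + (h *: v - h *: w) by rewrite opprD addrACA ?zE.
    apply: (le_trans (enormD _ _)); rewrite -lerBrDl; apply: (le_trans (enormD _ _)).
    by rewrite enormN !enormZ; clear -F dK n0 hd2; lra.
  by move=> /(_ isT isT isT isT); clear -F dK n0; lra.
rewrite zE in omE gy he *.
have r00' : 0 < enorm z by rewrite enorm_gt0.
have [sr sr0 [srE rE]] := sqrt_powers r00'.
have srs : sr <= s0 by rewrite -srE -s0E; apply: ler_wsqrtr; exact: ltW.
have omr : om * sr ^+ 2 * sr * 2 = L.
  by rewrite omE srE rE; field; rewrite gt_eqF.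
have om0 : 0 < om by rewrite omE divr_gt0 ?mulr_gt0 ?exprn_gt0// srE.
have n2 : enorm (fgrad F y s) = om * sr ^+ 2 by rewrite gy enormZ gtr0_norm// rE.
have ZE : Z * s0 * 2 = L.
  apply: (mulIf (lt0r_neq0 s00)); rewrite LE -r0E r0s; ring.
have gz : Z <= om * sr ^+ 2.
  have s3 : Z * sr <= Z * s0 by rewrite ler_wpM2l ?(ltW Z0).
  by rewrite -(ler_pM2r sr0); clear -F dK n0 s3 omr ZE; lra.
have sr1 : sr ^+ 2 <= 1 by rewrite -rE (le_trans (ltW zlt)).
have omZ : Z <= om by apply: (le_trans gz); rewrite ler_piMr ?(ltW om0).
have dist : enorm (fgrad F x s - fgrad F y s) <= 2 * Q * rho.
  rewrite gx addrAC subrr add0r enormZ gtr0_norm ?mulr_gt0//.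
  by rewrite ler_wpM2l// mulr_ge0 ?(ltW Q0).
have n2Z : Z <= enorm (fgrad F y s) by rewrite n2.
have n1X : X <= enorm (fgrad F x s).
  have := enormB_sub (fgrad F y s) (fgrad F x s); rewrite enorm_distC.
  by clear -F dK n0 n2Z dist ZX; lra.
have n2X : X <= enorm (fgrad F y s) by clear -F dK n0 n2Z ZX q00; lra.
have dist' : enorm (fgrad F y s - fgrad F x s) <= 2 * Q * rho by rewrite enorm_distC.
have g2 : fgrad F y s != 0 by rewrite -enorm_gt0 (lt_le_trans Z0 n2Z).
have B0 : 0 <= om + 2 * Q by clear -F dK n0 om0 Q0; lra.
have m0 : 0 <= 2 * om by clear -F dK n0 om0; lra.
have he' : qf (fhess F x s) (fgrad F y s) - qf (fhess F y s) (fgrad F y s) <=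
    (2 * Q - 2 * om) * dotp (fgrad F y s) (fgrad F y s).
  rewrite gy !qfZ dotpZl dotpZr -mulrBr.
  have := ler_wpM2l (sqr_ge0 om) he; clear -F dK n0; lra.
have bound := Lop_pair_le dK kap0 kap2 B0 (ltW Q0) m0 g2 (close _ _ n1X n2X dist)
  (close _ _ n2X n1X dist') hX hY hXY he'.
move: bound; rewrite -(flow_eq F Ux sp) -(flow_eq F Uy sp) kapE.
set k := K _; have k0 : 0 < k by apply: (diff_gt0 dK); exact: enorm_ge0.
(* |x - y| <= 1 gives om >= |Dp|, so k om dominates the flux K(|Dp|) |Dp|, which [X2] made large. *)
have kom : 8 * eta / (1 - a) + 1 <= k * om.
  have := hflux _ (le_trans ZX2 n2Z); rewrite -/k n2.
  have : om * sr ^+ 2 * k <= om * k by rewrite ler_wpM2r ?(ltW k0)// ler_piMr ?(ltW om0).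
  clear -F dK n0; lra.
have kom' : 8 * eta + (1 - a) <= (1 - a) * (k * om).
  apply: le_trans (ler_wpM2l (ltW a1) kom); rewrite mulrDr mulr1 lerD2r.
  by have -> : (1 - a) * (8 * eta / (1 - a)) = 8 * eta by field; rewrite gt_eqF.
have brk : (1 - a) / 2 * (om + 2 * Q) + 2 * Q * n%:R - (1 - a) * (2 * om) / 2 <= - ((1 - a) * om / 4).
  have : (1 - a) * Z <= (1 - a) * om by rewrite ler_wpM2l ?(ltW a1).
  have : 0 <= a * Q by rewrite mulr_ge0 ?(ltW Q0).
  clear -F dK n0 ZQ; lra.
have := ler_wpM2l (ltW k0) brk => kb h1.
have time : - (fdt F x s - fdt F y s) <= 2 * eta.
  have ds : 0 < s - (t0 - 1) by rewrite subr_gt0.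
  apply: (@ujet1_max _ (fun h => u x (s - h) - u y (s - h)) (fun h => 2 * eta * h) _ _ _ ds).
  - move=> h /andP[h0 hd]; rewrite !subr0.
    have := hmax x z (s - h) (ltW xlt) (ltW zlt); rewrite /W /= -/y.
    have -> : t0 - 1 <= s - h by clear -F dK n0 hd; lra.
    have -> : s - h <= t0 by clear -F dK n0 h0 s2; lra.
    by move=> /(_ isT isT); clear -F dK n0; lra.
  - by rewrite opprK; exact: flow_ujet1_back_pair.
  - move=> e e0; exists 1 => // h /andP[h0 _].
    by rewrite mulr0 subr0 subrr mulr_ge0 ?(ltW e0) ?(ltW h0).
(* The time penalty bounds the difference of time derivatives below by - 2 eta, while the equation
   makes it at most - (8 eta + 1 - a) / 4. *)
clear -F dK n0 time h1 kb kom' a1 eta0; lra.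
Qed.

End IshiiLions.

(** * The boundary *)

Section Geometry.
Context {R : realType} {n : nat}.
Variables (U : set 'rV[R]_n) (nu : 'rV[R]_n -> 'rV[R]_n).
Hypothesis C2 : C2_boundary_normal U nu.
Implicit Types (x y z w : 'rV[R]_n).

Lemma norm_le_coord (v : 'rV[R]_n) e : 0 <= e -> (forall i, `|v 0 i| <= e) -> `|v| <= e.
Proof.
move=> e0 h; rewrite [leLHS]/Num.norm/= mx_normrE (bigmax_le _ e0)//= => -[i j] _.
by rewrite ord1.
Qed.

Section Chart.
Variable rho : 'rV[R]_n -> R.
Hypothesis C2rho : Ck 2 rho.

Let drho i x : derivable rho x (ebasis i).
Proof. by have [_ h] := @C2rho [::] isT; apply: h. Qed.

Let crho i : continuous (partial i rho).
Proof. by have [h _] := @C2rho [:: i] isT. Qed.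

Lemma chart_is_derive x w (s : R) :
  is_derive s 1 (fun r : R => rho (x + r *: w)) (dotp (grad rho (x + s *: w)) w).
Proof. exact: C1_is_derive. Qed.

Lemma chart_continuous : continuous rho.
Proof. exact: C1_continuous. Qed.

Lemma grad_close z e : 0 < e -> exists2 d : R, 0 < d &
  forall x, enorm (x - z) < d -> enorm (grad rho x - grad rho z) <= e.
Proof.
move=> e0; have e1 : 0 < e / (1 + n%:R) by rewrite divr_gt0// ltr_pwDl.
have h i : \forall y \near z, `|partial i rho y - partial i rho z| < e / (1 + n%:R).
  have /cvgrPdist_lt/(_ _ e1)/filterS := @crho i z.
  by apply => y; rewrite distrC.
have := filter_forall (nbhs_filter z) h; rewrite /prop_near1.
move=> /nbhs_ballP[d d0 hd]; exists d => // x xd.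
apply: (le_trans (enorm_le_norm _)).
apply: (@le_trans _ _ (n%:R * (e / (1 + n%:R)))).
  rewrite ler_wpM2l//; apply: norm_le_coord => [|i]; first exact: ltW.
  rewrite !mxE; apply/ltW; apply: hd; rewrite -ball_normE /= -normrN opprB.
  by apply: le_lt_trans xd; exact: norm_le_enorm.
rewrite mulrCA ler_piMr ?(ltW e0)// ler_pdivrMr ?ltr_pwDl// mul1r lerDr//.
Qed.

(** The factor 3 is crude room for the segment from x to y: its points are within r + 2 r of z. *)
Lemma chart_mean z g (om r : R) : (forall x, enorm (x - z) <= 3 * r -> enorm (grad rho x - g) <= om) ->
  forall x y, enorm (x - z) <= r -> enorm (y - z) <= r ->
  `|rho y - rho x - dotp g (y - x)| <= om * enorm (y - x).
Proof.
move=> h x y hx hy; have [c] := mean_value 0 1 (chart_is_derive x (y - x)).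
rewrite !subr0 normr1 => c1; rewrite scale1r scale0r addr0 mulr1.
rewrite [x + (y - x)]addrC subrK => ->; rewrite -dotpBl.
apply: (le_trans (norm_dotp_le _ _)); rewrite ler_wpM2r ?enorm_ge0//; apply: h.
have -> : x + c *: (y - x) - z = (x - z) + c *: ((y - z) - (x - z)).
  by rewrite opprB [y - z + _]addrA subrK addrAC.
apply: (le_trans (enormD _ _)); rewrite enormZ.
have := enormD (y - z) (- (x - z)); rewrite enormN => h2.
have : `|c| * enorm (y - z - (x - z)) <= enorm (y - z - (x - z)).
  by rewrite ler_piMl ?enorm_ge0.
lra.
Qed.

End Chart.

(** A negative value would put x in U; a positive one would persist nearby and keep x out of the
    closure. *)
Lemma chart_zero z r (rho : 'rV[R]_n -> R) : Ck 2 rho ->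
  (forall x, ball z r x -> (U x <-> rho x < 0)) ->
  forall x, ball z r x -> bdry U x -> rho x = 0.
Proof.
move=> C2rho hU x bx [cx nx]; apply/eqP; rewrite eq_le; apply/andP; split; last first.
  by rewrite leNgt; apply/negP => h; apply: nx; apply/hU.
rewrite leNgt; apply/negP => rx.
have crx : {for x, continuous rho} by exact: chart_continuous.
have [d d0 hd] := (continuous_epsP rho x).1 crx _ rx.
have N : nbhs x (ball z r `&` ball x d).
  apply: filterI; last exact: nbhsx_ballx.
  by apply: open_nbhs_nbhs; split => //; exact: ball_open.
have [y [Uy [by1 by2]]] := cx _ N.
have := (hU y by1).1 Uy; rewrite ltNge => /negP; apply.
have := hd y; move: by2; rewrite -ball_normE /= => xy.
rewrite -normrN opprB => /(_ xy); rewrite ltr_norml => /andP[h _].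
by apply/ltW; lra.
Qed.

Lemma nu_unit x : bdry U x -> enorm (nu x) = 1.
Proof.
move=> bx; have [r [r0 [rho [_ [g0 [_ nuE]]]]]] := C2 bx.
have xb : ball x r x by exact: ballxx.
rewrite nuE// enormZ ger0_norm ?invr_ge0 ?enorm_ge0// mulVf//.
by rewrite enorm_eq0 g0.
Qed.

Lemma nu_inward x w : bdry U x -> dotp w (nu x) < 0 ->
  exists2 d : R, 0 < d & forall h, 0 < h < d -> U (x + h *: w).
Proof.
move=> bx; have [r [r0 [rho [C2rho [g0 [hU nuE]]]]]] := C2 bx.
have xb : ball x r x by exact: ballxx.
have gp : 0 < enorm (grad rho x) by rewrite enorm_gt0 g0.
rewrite nuE// dotpZr pmulr_rlt0 ?invr_gt0// => wg.
have rx := chart_zero C2rho hU xb bx.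
have wg2 : 0 < - dotp w (grad rho x) / 2 by rewrite divr_gt0// oppr_gt0.
have := chart_is_derive C2rho x w 0; rewrite scale0r addr0.
move=> /is_derive_eps/(_ _ wg2)[d d0 hd].
have w1 : 0 < 1 + `|w| by rewrite ltr_pwDl.
exists (Num.min d (r / (1 + `|w|))); first by rewrite lt_min d0 divr_gt0.
move=> h /andP[h0]; rewrite lt_min ltr_pdivlMr// => /andP[hdd hr].
apply/hU.
  rewrite -ball_normE /= opprD addrA subrr add0r normrN normrZ gtr0_norm//.
  by apply: le_lt_trans hr; rewrite ler_wpM2l ?(ltW h0)// lerDr.
have := hd h; rewrite gtr0_norm// => /(_ hdd); rewrite add0r scale0r addr0 rx subr0.
rewrite (dotpC _ w) ler_norml => /andP[_ hh].
have : dotp w (grad rho x) / 2 * h < 0 by rewrite pmulr_llt0//; lra.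
lra.
Qed.

(** Near z the boundary is almost flat. A ball centred at depth d below z and of radius barely above
    d meets it only close to z, where (x - y).nu is nearly d. *)
Lemma cap_exists z : bdry U z ->
  exists y r c0, [/\ 0 < r, 0 < c0, U y, enorm (z - y) < r & cap U nu y r c0].
Proof.
move=> bz; have [r [r0 [rho [C2rho [g0 [hU nuE]]]]]] := C2 bz.
have zb : ball z r z by exact: ballxx.
have gp : 0 < enorm (grad rho z) by rewrite enorm_gt0 g0.
set g := grad rho z in gp.
have om0 : 0 < enorm g / 100 by rewrite divr_gt0.
have [d' d'0 hd'] := grad_close C2rho z om0.
have [d [d0 dd' dr]] : exists d : R, [/\ 0 < d, 12 * d < d' & 12 * d < r].
  exists (Num.min d' r / 24); have : 0 < Num.min d' r by rewrite lt_min d'0.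
  have : Num.min d' r <= d' by rewrite ge_min lexx.
  have : Num.min d' r <= r by rewrite ge_min lexx orbT.
  by move=> *; split; lra.
have inball x : enorm (x - z) <= 4 * d -> ball z r x.
  move=> h; rewrite -ball_normE /= -normrN opprB.
  by apply: le_lt_trans (norm_le_enorm _) _; lra.
have gclose x : enorm (x - z) <= 3 * (4 * d) -> enorm (grad rho x - g) <= enorm g / 100.
  by move=> h; apply: hd'; lra.
have mean := chart_mean C2rho gclose.
have rz := chart_zero C2rho hU zb bz.
have nz : nu z = (enorm g)^-1 *: g by exact: nuE.
have unz : enorm (nu z) = 1 by exact: nu_unit.
have gnz : dotp g (nu z) = enorm g.
  by rewrite nz dotpZr -sqr_enorm expr2 mulKf// gt_eqF.
clearbody g.
have zz : enorm (z - z) <= 4 * d by rewrite subrr enorm0; lra.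
(* With a tilt of one per cent, the radius excess d / 1000 confines the boundary points to within d
   / 10 of z, and d / 2 leaves room for all the errors. *)
exists (z - d *: nu z), (d + d / 1000), (d / 2); split; try lra.
- have yz : enorm (z - d *: nu z - z) <= 4 * d.
    by rewrite addrAC subrr add0r enormN enormZ unz gtr0_norm//; lra.
  apply/hU; first exact: inball.
  have := mean z (z - d *: nu z) zz yz.
  rewrite rz subr0 [z - _ - z]addrAC subrr add0r dotpNr dotpZr gnz enormN enormZ unz (gtr0_norm d0) mulr1 opprK.
  rewrite ler_norml => /andP[_ h].
  have : 0 < d * enorm g by rewrite mulr_gt0.
  lra.
- by rewrite opprB addrC subrK enormZ unz gtr0_norm//; lra.
move=> x bx xy.
have xzE : x - (z - d *: nu z) = (x - z) + d *: nu z.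
  by apply/rowP => i; rewrite !mxE; ring.
rewrite xzE in xy *.
have xz3 : enorm (x - z) <= 4 * d.
  have -> : x - z = (x - z + d *: nu z) - d *: nu z by rewrite addrK.
  apply: (le_trans (enormD _ _)); rewrite enormN enormZ unz gtr0_norm//; lra.
have bxx : ball z r x by exact: inball.
have rx := chart_zero C2rho hU bxx bx.
set t := enorm (x - z) in xz3.
have t0 : 0 <= t by exact: enorm_ge0.
have gt : - (t / 100) <= dotp (nu z) (x - z).
  have := mean z x zz xz3; rewrite rx rz subrr sub0r normrN -/t ler_norml => /andP[h _].
  by rewrite nz dotpZl ler_pdivlMl//; lra.
have t10 : t <= d / 10.
  have : enorm (x - z + d *: nu z) ^+ 2 < (d + d / 1000) ^+ 2.
    by rewrite ltrXn2r// ?nnegrE ?enorm_ge0//; lra.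
  have expand w : dotp (w + d *: nu z) (w + d *: nu z) =
      dotp w w + 2 * d * dotp (nu z) w + d ^+ 2 * dotp (nu z) (nu z).
    by rewrite !(dotpDl, dotpDr, dotpZl, dotpZr) (dotpC w); ring.
  rewrite sqr_enorm expand -!sqr_enorm unz -/t.
  set q := dotp (nu z) (x - z) in gt * => h.
  rewrite leNgt; apply/negP => td.
  have : d * (- (t / 100)) <= d * q by rewrite ler_wpM2l ?(ltW d0).
  have : 0 <= (t - d / 10) * (t + d / 10 - d / 50) by rewrite mulr_ge0//; lra.
  have : 0 < d * d by rewrite mulr_gt0.
  clear -t0 d0 gt td h; nra.
have G0 : 0 < enorm (grad rho x) by rewrite enorm_gt0 g0.
have Gg : enorm (grad rho x - g) <= enorm g / 100 by apply: gclose; rewrite -/t; clear -t10 d0; lra.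
have Gle : enorm (grad rho x) <= 101 / 100 * enorm g.
  by have := enormB_sub (grad rho x) g; clear -Gg; lra.
have nG : 99 / 100 * enorm g <= dotp (nu z) (grad rho x).
  rewrite -[grad rho x](subrK g) dotpDr [dotp _ g]dotpC gnz.
  have := norm_dotp_le (nu z) (grad rho x - g); rewrite unz mul1r ler_norml => /andP[h _].
  by clear -h Gg; lra.
rewrite (nuE x bxx bx) dotpZr ler_pdivlMl// dotpDl dotpZl.
have := norm_dotp_le (x - z) (grad rho x); rewrite -/t ler_norml => /andP[h _].
have h1 : t * enorm (grad rho x) <= d / 10 * (101 / 100 * enorm g).
  by apply: ler_pM => //; exact: enorm_ge0.
have h2 : d * (99 / 100 * enorm g) <= d * dotp (nu z) (grad rho x) by rewrite ler_wpM2l ?(ltW d0).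
have h3 : enorm (grad rho x) * (d / 2) <= 101 / 100 * enorm g * (d / 2).
  by rewrite ler_wpM2r// divr_ge0// ltW.
have h4 : 0 < d * enorm g by rewrite mulr_gt0.
clear -h h1 h2 h3 h4; lra.
Qed.

End Geometry.

(** * Decay of the oscillation *)

Section CompactUniform.
Context {R : realType} {n : nat}.
Implicit Types (x y z c : 'rV[R]_n).

Lemma nbhs_eball x (r : R) : 0 < r -> nbhs x [set y | enorm (y - x) < r].
Proof.
move=> r0; have /continuous_epsP/(_ r r0)[d d0 hd] := @enorm_continuous R n 0.
apply/nbhs_ballP; exists d => // y; rewrite -ball_normE /= => xy.
have := hd (y - x); rewrite subr0 -normrN opprB => /(_ xy).
by rewrite enorm0 subr0 ger0_norm ?enorm_ge0.
Qed.

Lemma open_eball x (r : R) : open [set y | enorm (y - x) < r].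
Proof.
rewrite openE => y /= hy; have : 0 < r - enorm (y - x) by rewrite subr_gt0.
move=> /(nbhs_eball y); apply: filterS => z /= hz.
have -> : z - x = (z - y) + (y - x) by rewrite addrA subrK.
by apply: le_lt_trans (enormD _ _) _; lra.
Qed.

Lemma open_eball_sub (U : set 'rV[R]_n) x : open U -> U x ->
  exists2 r : R, 0 < r & forall y, enorm (y - x) < r -> U y.
Proof.
move=> oU Ux; have /nbhs_ballP[e /= e0 he] := open_nbhs_nbhs (conj oU Ux).
exists e => // y hy; apply: he; rewrite -ball_normE /= -normrN opprB.
by apply: le_lt_trans hy; exact: norm_le_enorm.
Qed.

(** Because P survives shrinking e, local values of e combine through the covering form of
    compactness along e -> 0+. *)
Lemma compact_uniform (A : set 'rV[R]_n) (P : R -> 'rV[R]_n -> Prop) : compact A ->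
  (forall e e' x, 0 < e' -> e' <= e -> P e x -> P e' x) ->
  (forall x, A x -> exists r e : R, [/\ 0 < r, 0 < e &
     forall x', enorm (x' - x) < r -> P e x']) ->
  exists2 e, 0 < e & forall x, A x -> P e x.
Proof.
move=> /compact_near_coveringP cA mono loc.
have := cA R (0^'+)%R P (at_right_proper_filter 0).
have H : forall x, A x -> \forall x' \near x & i \near 0^'+, P i x'.
  move=> x /loc[r [e [r0 e0 hP]]].
  exists ([set y | enorm (y - x) < r], [set i | 0 < i <= e]) => /=.
    split; first exact: nbhs_eball.
    by near=> i; apply/andP; split; near: i; [exact: nbhs_right_gt|exact: nbhs_right_le].
  by move=> [y i] /= [hy /andP[i0 ie]]; apply: (mono e) => //; exact: hP.
move=> /(_ H); rewrite near_withinE => /nbhs_ballP[d /= d0 hd].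
exists (d / 2); first by rewrite divr_gt0.
have d20 : 0 < d / 2 by rewrite divr_gt0.
apply: (hd (d / 2)) => //; rewrite -ball_normE /= sub0r normrN gtr0_norm//; lra.
Unshelve. all: by end_near. Qed.

End CompactUniform.

(** * A finite cover of the boundary by caps *)

Section CapCover.
Context {R : realType} {n : nat}.
Variables (U : set 'rV[R]_n) (nu : 'rV[R]_n -> 'rV[R]_n).
Hypotheses (oU : open U) (cU : compact (closure U)) (C2 : C2_boundary_normal U nu).

Lemma bdry_compact : compact (bdry U).
Proof.
apply: (subclosed_compact _ cU); last by move=> x [].
rewrite /bdry setDE; apply: closedI; first exact: closed_closure.
exact: open_closedC.
Qed.

Lemma cap_cover : exists (js : seq ('rV[R]_n * R)) (c0 : R), [/\ 0 < c0,
  forall j, j \in js -> 0 < j.2 /\ cap U nu j.1 j.2 c0 &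
  forall x, bdry U x -> exists2 j, j \in js & enorm (x - j.1) < j.2].
Proof.
pose D : set ('rV[R]_n * R) := [set j | 0 < j.2 /\ exists2 c0, 0 < c0 & cap U nu j.1 j.2 c0].
pose f (j : 'rV[R]_n * R) := [set x | enorm (x - j.1) < j.2].
have := bdry_compact; rewrite compact_cover => /(_ _ D f)[||js jsD hcov].
- by move=> j _; exact: open_eball.
- move=> z bz; have [y [r [c0 [r0 c00 _ zy hcap]]]] := cap_exists C2 bz.
  by exists (y, r) => //; split=> //; exists c0.
have common (s : seq ('rV[R]_n * R)) : (forall j, j \in s -> D j) ->
    exists2 c0 : R, 0 < c0 & forall j, j \in s -> 0 < j.2 /\ cap U nu j.1 j.2 c0.
  elim: s => [_|j s IH hD]; first by exists 1.
  have [i si|c1 c10 h1] := IH; first by apply: hD; rewrite inE si orbT.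
  have [j0 [c2 c20 h2]] := hD j (mem_head _ _).
  exists (Num.min c1 c2); first by rewrite lt_min c10.
  move=> i; rewrite inE => /orP[/eqP->|/h1[i0 hi]]; split => // x bx hx.
    by apply: le_trans (h2 x bx hx); rewrite ge_min lexx orbT.
  by apply: le_trans (hi x bx hx); rewrite ge_min lexx.
have [j jj|c0 c00 hc0] := common (finmap.enum_fset js); first by apply: set_mem; exact: jsD.
exists (finmap.enum_fset js), c0; split => //.
Qed.

End CapCover.

(** * Propagation of a gain through the domain *)

Section Spread.
Context {R : realType} {n : nat}.
Variables (K th : R -> R) (a : R) (U : set 'rV[R]_n) (nu : 'rV[R]_n -> 'rV[R]_n).
Hypotheses (dK : diffusivity K th a) (oU : open U) (cU : compact (closure U))
  (coU : connected U) (C2 : C2_boundary_normal U nu).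
Variables (u psi : 'rV[R]_n -> R -> R) (F : flow K th U nu u psi).
Variables (c : 'rV[R]_n) (rho eta tau : R).
Hypotheses (Uc : U c) (rho0 : 0 < rho) (eta0 : 0 < eta) (tau0 : 0 < tau).

Definition scenario t0 M eps := [/\
  forall x t, closure U x -> t0 <= t -> t <= t0 + tau -> u x t <= M,
  forall x t, closure U x -> enorm (x - c) <= rho -> t0 <= t -> t <= t0 + tau ->
    u x t <= M - eta &
  forall x t, bdry U x -> t0 <= t -> t <= t0 + tau -> `|psi x t| <= eps].

Lemma scenario_le t0 M e e' : e <= e' -> scenario t0 M e -> scenario t0 M e'.
Proof.
by move=> ee [h1 h2 h3]; split=> // x t bx s1 s2; apply: le_trans ee; exact: h3.
Qed.

(** Each passage to a neighbouring point takes some time. Asking for every delay [sigma] lets a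
    passage spend half of the delay and ask its predecessor for the other half. The constants [r]
    and [e] are uniform in t0 and M. *)
Definition lowered (y : 'rV[R]_n) := forall sigma, 0 < sigma -> sigma <= tau ->
  exists r e : R, [/\ 0 < r, 0 < e & forall t0 M, 0 <= t0 -> scenario t0 M e ->
    forall x t, closure U x -> enorm (x - y) <= r -> t0 + sigma <= t -> t <= t0 + tau ->
    u x t <= M - e].

Lemma lowered_center : lowered c.
Proof.
move=> sigma s0 st; exists rho, eta; split=> // t0 M t00 [_ h _] x t Ux hx t1 t2.
by apply: h => //; lra.
Qed.

(** The first half of sigma lowers u near y; during the second half [expansion] carries the gain to
    radius r2, chosen midway between |z - y| and r. *)
Lemma lowered_cap y r c0 : 0 < r -> 0 < c0 -> cap U nu y r c0 -> lowered y ->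
  forall z, enorm (z - y) < r -> lowered z.
Proof.
move=> r0 c00 hcap ly z zy sigma s0 st.
have s20 : 0 < sigma / 2 by rewrite divr_gt0.
have [|r1 [e1 [r10 e10 h1]]] := ly (sigma / 2) s20; first by lra.
pose r1' := Num.min r1 (r / 2); pose r2 := (enorm (z - y) + r) / 2.
have r1'0 : 0 < r1' by rewrite lt_min r10 divr_gt0.
have r1'r : r1' < r by rewrite gt_min; apply/orP; right; lra.
have zy0 := enorm_ge0 (z - y).
have r20 : 0 <= r2 by rewrite /r2; lra.
have r2r : r2 < r by rewrite /r2; lra.
have [delta [eps [d0 eps0 hexp]]] := expansion dK F oU cU (nu_inward C2) (nu_unit C2)
  r1'0 r1'r r20 r2r c00 hcap s20 e10.
pose e := Num.min delta (Num.min eps e1).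
have e0 : 0 < e by rewrite !lt_min d0 eps0.
exists ((r - enorm (z - y)) / 2), e; split=> //; first by rewrite divr_gt0// subr_gt0.
move=> t0 M t00 sc x t Ux hx t1 t2.
have ed : e <= delta by rewrite ge_min lexx.
have ee : e <= eps by rewrite !ge_min lexx orbT.
have ee1 : e <= e1 by rewrite !ge_min lexx !orbT.
have [A1 _ A3] := sc.
apply: (@le_trans _ _ (M - delta)); last by lra.
apply: hexp => //.
- by lra.
- by move=> x' s Ux' s1 s2; apply: A1 => //; lra.
- move=> x' s Ux' hx' s1 s2; apply: (h1 t0 M t00 (scenario_le ee1 sc)) => //; last 2 first.
  + by lra.
  + by lra.
  by apply: (le_trans hx'); rewrite ge_min lexx.
- by move=> x' s bx' s1 s2; apply: le_trans ee; apply: A3 => //; lra.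
have -> : x - y = (x - z) + (z - y) by rewrite addrA subrK.
by apply: (le_trans (enormD _ _)); rewrite /r2; lra.
Qed.

(** A ball inside U meets no boundary point, so interior expansion is a case of the cap argument
    with an arbitrary constant. *)
Lemma cap_inside y r : (forall z, enorm (z - y) < r -> U z) -> cap U nu y r 1.
Proof. by move=> h x [_ nx] /h. Qed.

(** Connectedness: the lowered points of U contain c and are both open and closed in U. *)
Lemma lowered_interior y : U y -> lowered y.
Proof.
pose B := U `&` lowered.
suff -> : U = B by move=> [].
apply/esym; apply: coU.
- by exists c; split => //; exact: lowered_center.
- exists [set y | U y /\ lowered y]; last by rewrite /B; apply/seteqP; split => [z [? ?]|z [? []]].
  rewrite openE => y0 /= [Uy ly]; have [r r0 hr] := open_eball_sub oU Uy.
  have := nbhs_eball y0 r0; apply: filterS => z /= hz; split; first exact: hr.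
  exact: (lowered_cap r0 ltr01 (cap_inside hr)).
(* If z is a limit point with a ball of radius r in U, a lowered w within r / 2 of z has its own
   ball of radius r / 2 in U, and this ball contains z. *)
exists (closure B); first exact: closed_closure.
apply/seteqP; split => [z Bz|z [Uz cz]]; first by split; [case: Bz|exact: subset_closure].
split=> //; have [r r0 hr] := open_eball_sub oU Uz.
have r20 : 0 < r / 2 by rewrite divr_gt0.
have [w [[Uw lw] /= hw]] := cz _ (nbhs_eball z r20).
have hr2 x : enorm (x - w) < r / 2 -> U x.
  move=> hx; apply: hr; have -> : x - z = (x - w) + (w - z) by rewrite addrA subrK.
  by apply: le_lt_trans (enormD _ _) _; lra.
by apply: (lowered_cap r20 ltr01 (cap_inside hr2) lw); rewrite enorm_distC.
Qed.

Lemma lowered_closure y : closure U y -> lowered y.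
Proof.
move=> cy; have [Uy|nUy] := pselect (U y); first exact: lowered_interior.
have [z [r [c0 [r0 c00 Uz zy hcap]]]] := cap_exists C2 (conj cy nUy).
by apply: (lowered_cap r0 c00 hcap (lowered_interior Uz)).
Qed.

Lemma spread : exists2 e, 0 < e & forall t0 M, 0 <= t0 -> scenario t0 M e ->
  forall x, closure U x -> u x (t0 + tau) <= M - e.
Proof.
have [|x Ux|e e0 he] := @compact_uniform R n (closure U) (fun e x => forall t0 M, 0 <= t0 ->
  scenario t0 M e -> closure U x -> u x (t0 + tau) <= M - e) cU.
- move=> e e' x e'0 ee h t0 M t00 sc Ux.
  by have := h t0 M t00 (scenario_le ee sc) Ux; lra.
- have [r [e [r0 e0 h]]] := lowered_closure Ux tau0 (lexx _).
  exists r, e; split=> // x' hx' t0 M t00 sc Ux'.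
  exact: (h t0 M t00 sc x' (t0 + tau) Ux' (ltW hx') (lexx _) (lexx _)).
by exists e => // t0 M t00 sc x Ux; exact: he.
Qed.

End Spread.

(** * Decrease of the oscillation in time *)

Section Decay.
Context {R : realType} {n : nat}.
Variables (K th : R -> R) (a : R) (U : set 'rV[R]_n) (nu : 'rV[R]_n -> 'rV[R]_n).
Hypotheses (dK : diffusivity K th a) (oU : open U) (cU : compact (closure U))
  (coU : connected U) (C2 : C2_boundary_normal U nu).

Definition psi_le (psi : 'rV[R]_n -> R -> R) e t0 :=
  forall x t, bdry U x -> t0 <= t -> `|psi x t| <= e.

Lemma psi_leN psi e t0 : psi_le psi e t0 -> psi_le (fun x t => - psi x t) e t0.
Proof. by move=> h x t bx tt; rewrite normrN; exact: h. Qed.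

Lemma psi_le_trans psi e e' t0 t1 : e <= e' -> t0 <= t1 -> psi_le psi e t0 -> psi_le psi e' t1.
Proof. by move=> ee tt h x t bx t1t; apply: le_trans ee; apply: h => //; exact: le_trans t1t. Qed.

Lemma growth u psi : flow K th U nu u psi ->
  exists C e1 : R, [/\ 0 < C, 0 < e1 & forall e t1 M, 0 < e -> e <= e1 -> 0 <= t1 ->
    (forall x, closure U x -> u x t1 <= M) -> psi_le psi e t1 ->
    forall x t, closure U x -> t1 <= t -> t <= t1 + 2 -> u x t <= M + C * e].
Proof.
move=> F; have [js [c0 [c00 hcap hcov]]] := cap_cover oU cU C2.
have [C [e1 [C0 e10 h]]] := global_growth dK F oU cU (nu_inward C2) (nu_unit C2) c00 hcap hcov.
exists C, e1; split=> // e t1 M e0 ee t10 hM hpsi; apply: h => //.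
by move=> x s bx s1 _; exact: hpsi.
Qed.

(** [persistence] keeps u low on the half ball for a time tau, [spread] turns this into a gain e on
    all of U at t0 + tau, and [growth] loses at most half of it up to t0 + 1. *)
Lemma improvement u psi c rho eta : flow K th U nu u psi -> 0 < rho -> 0 < eta ->
  (forall x, enorm (x - c) < rho -> U x) ->
  exists delta e0 : R, [/\ 0 < delta, 0 < e0 & forall t0 M, 0 <= t0 ->
    (forall x t, closure U x -> t0 <= t -> t <= t0 + 1 -> u x t <= M) ->
    (forall x, enorm (x - c) < rho -> u x t0 <= M - eta) -> psi_le psi e0 t0 ->
    forall x, closure U x -> u x (t0 + 1) <= M - delta].
Proof.
move=> F rho0 eta0 hU.
have [tau tau0 [tau1 pers]] := persistence dK F oU cU (nu_inward C2) (nu_unit C2) rho0 eta0 hU.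
have Uc : U c by apply: hU; rewrite subrr enorm0.
have r20 : 0 < rho / 2 by rewrite divr_gt0.
have e20 : 0 < eta / 2 by rewrite divr_gt0.
have [e e0 spr] := spread dK oU cU coU C2 F Uc r20 e20 tau0.
have [C [e1 [C0 e10 gr]]] := growth F.
pose e' := Num.min e (Num.min e1 (e / (2 * C))).
have e'0 : 0 < e' by rewrite !lt_min e0 e10 divr_gt0// mulr_gt0.
have e'e : e' <= e by rewrite ge_min lexx.
have e'1 : e' <= e1 by rewrite !ge_min lexx orbT.
have e'C : C * e' <= e / 2.
  have : e' <= e / (2 * C) by rewrite !ge_min lexx !orbT.
  by rewrite ler_pdivlMr ?mulr_gt0//; lra.
exists (e / 2), e'; split=> //; first by rewrite divr_gt0.
move=> t0 M t00 hM h0 hpsi x Ux.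
have tail : u x (t0 + 1) <= M - e + C * e'.
  apply: (gr e' (t0 + tau)) => //; try lra.
    move=> y Uy; apply: spr => //; split.
    - by move=> z t Uz s1 s2; apply: hM => //; lra.
    - move=> z t Uz hz s1 s2; apply: (pers t0 M) => //.
      by move=> z' t' Uz' s1' s2'; apply: hM => //; lra.
    - by move=> z t bz s1 s2; apply: le_trans e'e; exact: hpsi.
  by apply: psi_le_trans hpsi => //; lra.
by lra.
Qed.

Definition osc_le (u : 'rV[R]_n -> R -> R) t O := exists m, forall x, closure U x ->
  m <= u x t <= m + O.

(** After one unit of time the oscillation on a small ball is at most O - eta / 2, so there u stays
    away either from the top or from the bottom of its range. In the second unit [improvement] is
    applied to u or to - u accordingly. *)
Lemma osc_step u psi eta : flow K th U nu u psi -> (0 < n)%N -> U !=set0 -> 0 < eta ->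
  exists delta e0 : R, [/\ 0 < delta, 0 < e0 & forall t1 O, 0 <= t1 -> eta <= O ->
    psi_le psi e0 t1 -> osc_le u t1 O ->
    osc_le u (t1 + 2) (O - delta) /\
    forall t, t1 <= t -> t <= t1 + 2 -> osc_le u t (O + eta)].
Proof.
move=> F n0 [c Uc] eta0; have F' := flowN F.
have [r r0 hr] := open_eball_sub oU Uc.
have rho0 : 0 < r / 4 by rewrite divr_gt0.
have hr' x : enorm (x - c) <= 3 * (r / 4) -> U x by move=> h; apply: hr; lra.
have [r1 r10 [r1r gain]] := oscillation_gain dK F n0 rho0 eta0 hr'.
have hr1 x : enorm (x - c) < r1 -> U x by move=> h; apply: hr'; lra.
have e80 : 0 < eta / 8 by rewrite divr_gt0.
have [d1 [e1 [d10 e10 imp1]]] := improvement F r10 e80 hr1.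
have [d2 [e2 [d20 e20 imp2]]] := improvement F' r10 e80 hr1.
have [C1 [e3 [C10 e30 gr1]]] := growth F.
have [C2' [e4 [C20 e40 gr2]]] := growth F'.
pose C := C1 + C2'; have C0 : 0 < C by rewrite addr_gt0.
pose d := Num.min d1 d2; have d0 : 0 < d by rewrite lt_min d10.
have dd1 : d <= d1 by rewrite ge_min lexx.
have dd2 : d <= d2 by rewrite ge_min lexx orbT.
(* The flux widens the range by C e at either end: d / 4 leaves half of the gain d, and eta / 8
   keeps the oscillation below O + eta and leaves room for the alternative below. *)
have [e [e0 [ee1 ee2 ee3 ee4] [eC1 eC2]]] : exists e, [/\ 0 < e,
    [/\ e <= e1, e <= e2, e <= e3 & e <= e4] & C * e <= d / 4 /\ C * e <= eta / 8].
  exists (Num.min (Num.min (Num.min e1 e2) (Num.min e3 e4)) (Num.min (d / (4 * C)) (eta / (8 * C)))).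
  set w := Num.min _ _; have w1 : w <= d / (4 * C) by rewrite !ge_min lexx !orbT.
  have w2 : w <= eta / (8 * C) by rewrite !ge_min lexx !orbT.
  split.
  - by rewrite !lt_min e10 e20 e30 e40 !divr_gt0// mulr_gt0.
  - by split; rewrite !ge_min lexx ?orbT.
  - move: w1 w2; rewrite !ler_pdivlMr ?mulr_gt0//; lra.
have le1 : C1 * e <= C * e by rewrite ler_wpM2r ?(ltW e0)// lerDl ltW.
have le2 : C2' * e <= C * e by rewrite ler_wpM2r ?(ltW e0)// lerDr ltW.
clearbody C d; clear hr rho0 hr' r10 r1r hr1 e80 d10 d20 C10 C20 e10 e20 e30 e40.
exists (d / 2), e; split=> //; first by rewrite divr_gt0.
move=> t1 O t10 etaO hpsi [m hm].
have up x t : closure U x -> t1 <= t -> t <= t1 + 2 -> u x t <= m + O + C * e.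
  move=> Ux s1 s2; apply: le_trans (_ : _ <= m + O + C1 * e) _; last by lra.
  by apply: (gr1 e t1) => // y /hm/andP[].
have dn x t : closure U x -> t1 <= t -> t <= t1 + 2 -> m - C * e <= u x t.
  move=> Ux s1 s2; rewrite -lerN2 opprB; apply: le_trans (_ : _ <= - m + C2' * e) _; last by lra.
  apply: (gr2 e t1) => //; last exact: psi_leN.
  by move=> y /hm/andP[h _]; rewrite lerN2.
have t1t : t1 <= t1 + 1 by lra.
have t11 : 1 <= t1 + 1 by lra.
have C0e : 0 <= C * e by rewrite mulr_ge0 ?ltW.
split; last first.
  move=> t s1 s2; exists (m - C * e) => x Ux; rewrite dn//=.
  by apply: le_trans (up x t Ux s1 s2) _; lra.
have g : forall x y, enorm (x - c) <= r1 -> enorm (y - c) <= r1 ->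
    u x (t1 + 1) - u y (t1 + 1) <= O - eta / 2.
  apply: gain => // x y t Ux Uy s1 s2.
  have s1' : t1 <= t by lra.
  have s2' : t <= t1 + 2 by lra.
  have := up x t (subset_closure Ux) s1' s2'; have := dn y t (subset_closure Uy) s1' s2'.
  lra.
have t2E : t1 + 1 + 1 = t1 + 2 by lra.
have t01 : 0 <= t1 + 1 by lra.
(* If some point of the ball is within eta / 8 of the top, the small oscillation keeps the whole
   ball at least eta / 8 above the bottom. *)
have [hi|nhi] := pselect (forall x, enorm (x - c) < r1 -> u x (t1 + 1) <= m + O + C * e - eta / 8).
  exists (m - C * e) => x Ux; rewrite dn ?lexx//=; last by lra.
  rewrite -t2E; apply: le_trans (imp1 (t1 + 1) (m + O + C * e) t01 _ hi _ x Ux) _; last by lra.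
    by move=> y t Uy s1 s2; apply: up => //; lra.
  exact: psi_le_trans hpsi.
have [x0 [hx0 bx0]] : exists x, enorm (x - c) < r1 /\ m + O + C * e - eta / 8 < u x (t1 + 1).
  move: nhi => /existsNP[x /not_implyP[hx /negP]]; rewrite -ltNge => h.
  by exists x.
have lo x : enorm (x - c) < r1 -> - u x (t1 + 1) <= - (m - C * e) - eta / 8.
  by move=> hx; have := g x0 x (ltW hx0) (ltW hx); lra.
exists (m - C * e + d2) => x Ux; apply/andP; split; last first.
  by have := up x (t1 + 2) Ux; move=> /(_ _ (lexx _)) h; apply: le_trans (h _) _; lra.
rewrite -t2E -lerN2; apply: le_trans (imp2 (t1 + 1) (- (m - C * e)) t01 _ lo _ x Ux) _; last by lra.
  by move=> y t Uy s1 s2; rewrite lerN2; apply: dn => //; lra.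
by apply: psi_leN; exact: psi_le_trans hpsi.
Qed.

Lemma osc_iterate u eta t1 O0 delta : 0 <= eta -> 0 < delta -> 0 <= t1 ->
  (forall t O, t1 <= t -> eta <= O -> osc_le u t O -> osc_le u (t + 2) (O - delta)) ->
  osc_le u t1 O0 -> exists k0, forall k, (k0 <= k)%N -> osc_le u (t1 + 2 * k%:R) eta.
Proof.
move=> eta0 d0 t10 step h0; have mono t O O' : O <= O' -> osc_le u t O -> osc_le u t O'.
  by move=> OO [m hm]; exists m => x /hm/andP[-> h] /=; lra.
have main k : osc_le u (t1 + 2 * k%:R) (Num.max eta (O0 - k%:R * delta)).
  elim: k => [|k IH]; first by rewrite mulr0 addr0 mul0r subr0; apply: mono h0; rewrite le_max lexx orbT.
  have -> : t1 + 2 * k.+1%:R = t1 + 2 * k%:R + 2 by rewrite -natr1; ring.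
  have e1 : eta <= Num.max eta (O0 - k%:R * delta) by rewrite le_max lexx.
  have tt : t1 <= t1 + 2 * k%:R by rewrite lerDl mulr_ge0.
  apply: mono (step _ _ tt e1 IH).
  rewrite lerBlDr ge_max -!lerBlDr; apply/andP; split.
    by rewrite le_max; apply/orP; left; lra.
  by rewrite le_max -natr1; apply/orP; right; lra.
exists (Num.bound (`|O0| / delta)) => k hk.
apply: mono (main k); rewrite ge_max lexx /= lerBlDr.
have : `|O0| / delta < k%:R.
  apply: lt_le_trans (archi_boundP _) _; first by rewrite divr_ge0// ltW.
  by rewrite ler_nat.
rewrite ltr_pdivrMr// => h; have := ler_norm O0; lra.
Qed.

Lemma osc_tendsto u psi : flow K th U nu u psi -> (0 < n)%N -> U !=set0 ->
  (forall e, 0 < e -> exists2 T, 0 <= T & psi_le psi e T) ->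
  forall eta, 0 < eta -> exists2 T, 0 <= T & forall t, T <= t -> osc_le u t eta.
Proof.
move=> F n0 U0 hpsi eta eta0; have e20 : 0 < eta / 2 by rewrite divr_gt0.
have [delta [e0 [d0 e00 step]]] := osc_step F n0 U0 e20.
have [t1 t10 pt1] := hpsi e0 e00.
have [c Uc] := U0; have clU0 : closure U !=set0 by exists c; exact: subset_closure.
have cu : continuous (fun x => u x t1).
  move=> x; apply: (@continuous_comp _ _ _ (fun x => (x, t1)) (fun z => u z.1 z.2)).
    by apply: (@cvg_pair _ _ _ (nbhs x) (nbhs x) (nbhs t1) _ _ _ id (cst t1)); [exact: cvg_id|exact: cvg_cst].
  exact: (flow_continuous F).
have [xM _ hM] := compact_EVT_max clU0 cU (continuous_subspaceT cu).
have [xm _ hm] := compact_EVT_min clU0 cU (continuous_subspaceT cu).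
have h0 : osc_le u t1 (u xM t1 - u xm t1).
  exists (u xm t1) => x Ux; rewrite hm ?inE//=.
  by have := hM x; rewrite inE => /(_ Ux) /= h; lra.
have step' t O : t1 <= t -> eta / 2 <= O -> osc_le u t O -> osc_le u (t + 2) (O - delta).
  move=> tt hO osc; have [] // := step t O _ hO _ osc; first exact: le_trans tt.
  exact: psi_le_trans pt1.
have [k0 hk0] := osc_iterate (ltW e20) d0 t10 step' h0.
exists (t1 + 2 * k0%:R) => [|t ht]; first by rewrite addr_ge0// mulr_ge0.
have x0 : 0 <= (t - t1) / 2 by have : 0 <= k0%:R :> R by []; lra.
(* The oscillation is at most eta / 2 at the last grid time before t, and within the step it grows
   by at most another eta / 2. *)
have [k k1 k2] : exists2 k : nat, k%:R <= (t - t1) / 2 & (t - t1) / 2 < k%:R + 1.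
  by have /andP[k1 k2] := truncn_itv x0; exists (Num.truncn ((t - t1) / 2)); rewrite // natr1.
have kk : (k0 <= k)%N.
  have : k0%:R < k.+1%:R :> R by rewrite -natr1; lra.
  by rewrite ltr_nat.
have osc := hk0 k kk; have kp : 0 <= k%:R :> R by [].
have tk0 : 0 <= t1 + 2 * k%:R by lra.
have pk : psi_le psi e0 (t1 + 2 * k%:R) by apply: psi_le_trans pt1 => //; lra.
have [_ h] := step _ _ tk0 (lexx _) pk osc.
have := h t; have -> : eta / 2 + eta / 2 = eta by lra.
by apply; lra.
Qed.

End Decay.

(** * Iterated integrals and mean values *)

Section IntegralLine.
Context {R : realType}.
Implicit Types (f g : R -> R) (L B : R).
Local Notation leb := (@lebesgue_measure R).

Lemma Rintegral_support f L : (forall s, L < `|s| -> f s = 0) ->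
  Rintegral leb setT f = Rintegral leb `[(- L), L] f.
Proof.
move=> fL; rewrite [RHS]Rintegral_mkcond; congr (Rintegral _ _ _).
apply/funext => s; rewrite patchE; case: ifPn => // sL.
apply: fL; rewrite ltNge; apply: contra sL => sL.
by rewrite inE /= in_itv /= -ler_norml.
Qed.

Lemma integrable_segment f L : continuous f -> leb.-integrable `[(- L), L] (EFin \o f).
Proof.
move=> cf; apply: continuous_compact_integrable; first exact: segment_compact.
exact: continuous_subspaceT.
Qed.

Lemma measure_segment L : 0 <= L -> fine (leb `[(- L), L]) = 2 * L.
Proof.
move=> L0; rewrite lebesgue_measure_itv /= lte_fin.
case: ltP => [_|h] /=; first by rewrite opprK; lra.
by move: L0 h => *; lra.
Qed.

Lemma le_Rintegral_support f g L : continuous f -> continuous g ->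
  (forall s, L < `|s| -> f s = 0) -> (forall s, L < `|s| -> g s = 0) ->
  (forall s, f s <= g s) -> Rintegral leb setT f <= Rintegral leb setT g.
Proof.
move=> cf cg fL gL fg; rewrite (Rintegral_support fL) (Rintegral_support gL).
by apply: le_Rintegral => //; exact: integrable_segment.
Qed.

Lemma Rintegral_supportZ c f L : continuous f -> (forall s, L < `|s| -> f s = 0) ->
  Rintegral leb setT (fun s => c * f s) = c * Rintegral leb setT f.
Proof.
move=> cf fL; rewrite (Rintegral_support fL) (@Rintegral_support (fun s => c * f s) L).
  by rewrite RintegralZl//; exact: integrable_segment.
by move=> s /fL ->; rewrite mulr0.
Qed.

Lemma Rintegral_support_bound f L B : 0 <= L -> continuous f ->
  (forall s, L < `|s| -> f s = 0) -> (forall s, `|f s| <= B) ->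
  `|Rintegral leb setT f| <= B * (2 * L).
Proof.
move=> L0 cf fL fB; rewrite (Rintegral_support fL) -(measure_segment L0).
rewrite -Rintegral_cst//; apply: le_trans (le_normr_Rintegral _ _) _ => //.
  exact: integrable_segment.
apply: le_Rintegral => //.
  have cn : continuous (fun s : R => `|f s| : R) by move=> s; apply: cvg_norm; exact: cf.
  exact: (integrable_segment L cn).
have cc : continuous (fun _ : R => B) by move=> s; exact: cvg_cst.
exact: (integrable_segment L cc).
Qed.

Lemma Rintegral_support_cvg (fk : nat -> R -> R) f L B : 0 <= L ->
  (forall k, continuous (fk k)) ->
  (forall k s, L < `|s| -> fk k s = 0) -> (forall k s, `|fk k s| <= B) ->
  (forall s, fk ^~ s @ \oo --> f s) ->
  (fun k => Rintegral leb setT (fk k)) @ \oo --> Rintegral leb setT f.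
Proof.
move=> L0 cf fL fB fc.
have fL' s : L < `|s| -> f s = 0.
  move=> sL; apply: (cvg_unique _ (fc s)) => //.
  have -> : (fun k => fk k s) = (fun=> 0) by apply/funext => k; exact: fL.
  exact: cvg_cst.
rewrite (Rintegral_support fL').
have -> : (fun k => Rintegral leb setT (fk k)) = (fun k => Rintegral leb `[(- L), L] (fk k)).
  by apply/funext => k; exact: (Rintegral_support (fL k)).
have mD : measurable `[(- L), L]%classic by exact: measurable_itv.
have mk k : measurable_fun `[(- L), L]%classic (fk k).
  by apply: measurable_funTS; exact: continuous_measurable_fun.
have mf : measurable_fun `[(- L), L]%classic f.
  by apply: (@measurable_fun_cvg _ _ _ _ fk) => // s _; exact: fc.
have iB : leb.-integrable `[(- L), L] (EFin \o (fun=> B)).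
  have cc : continuous (fun _ : R => B) by move=> s; exact: cvg_cst.
  exact: (integrable_segment L cc).
pose D : set R := `[(- L), L]%classic.
have [if_ _ dc] : [/\ leb.-integrable D (EFin \o f),
    (fun k => \int[leb]_(x in D) `|(EFin \o fk k) x - (EFin \o f) x|)%E @ \oo --> 0%E &
    (fun k => \int[leb]_(x in D) (EFin \o fk k) x)%E @ \oo -->
      (\int[leb]_(x in D) (EFin \o f) x)%E].
  apply: (@dominated_convergence _ _ R leb D mD (fun k => EFin \o fk k) (EFin \o f)
    (EFin \o (fun=> B)) _ _ _ iB).
  - by move=> k; apply/measurable_EFinP; exact: mk.
  - by apply/measurable_EFinP; exact: mf.
  - by apply: aeW => s _; apply: cvg_EFin; [exact: nearW|exact: fc].
  - by apply: aeW => s k _; rewrite lee_fin.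
apply: fine_cvg.
rewrite fineK; last exact: integrable_fin_num.
exact: dc.
Qed.

End IntegralLine.

(** * Iterated integrals of functions supported in a cube *)

Section IteratedIntegral.
Context {R : realType}.

(** This class passes to slices with the same constants, which allows induction on the dimension. *)
Definition cbox m (B L : R) (f : 'rV[R]_m -> R) := [/\ continuous f,
  forall x, `|f x| <= B & forall (x : 'rV[R]_m) (i : 'I_m), L < `|x 0 i| -> f x = 0].

Definition slice m (f : 'rV[R]_m.+1 -> R) (s : R) : 'rV[R]_m -> R :=
  fun y => f (row_mx (const_mx s : 'rV[R]_1) y).

Lemma iter_intS m (f : 'rV[R]_m.+1 -> R) :
  iter_int f = Rintegral (@lebesgue_measure R) setT (fun s => iter_int (slice f s)).
Proof. by []. Qed.

Lemma cons_row_continuous m :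
  continuous (fun z : R * 'rV[R]_m => row_mx (const_mx z.1 : 'rV[R]_1) z.2 : 'rV[R]_m.+1).
Proof.
move=> [t x]; apply/cvgrPdist_lt => e e0.
near=> z.
have [h1 h2] : `|t - z.1| < e /\ `|x - z.2| < e.
  split; near: z.
    have : {for (t, x), continuous (fst : R * 'rV[R]_m -> R)} by exact: cvg_fst.
    by move=> /cvgrPdist_lt/(_ e e0).
  have : {for (t, x), continuous (snd : R * 'rV[R]_m -> 'rV[R]_m)} by exact: cvg_snd.
  by move=> /cvgrPdist_lt/(_ e e0).
rewrite [ltLHS]/Num.norm/= mx_normrE (bigmax_lt _ e0)//= => -[i j] _ /=.
rewrite ord1 !mxE; case: (@split_ordP 1 m j) => k _.
  by rewrite !mxE.
by apply: le_lt_trans h2; have := coord_le_norm (x - z.2) k; rewrite !mxE.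
Unshelve. all: by end_near. Qed.

Lemma slice_continuous_l m (f : 'rV[R]_m.+1 -> R) y : continuous f ->
  continuous (fun s => slice f s y).
Proof.
move=> cf s.
apply: (@continuous_comp _ _ _ (fun s => (s, y)) (fun z : R * 'rV[R]_m => slice f z.1 z.2)).
  by apply: (@cvg_pair _ _ _ (nbhs s) (nbhs s) (nbhs y) _ _ _ id (cst y)); [exact: cvg_id|exact: cvg_cst].
apply: (@continuous_comp _ _ _ (fun z : R * 'rV[R]_m => row_mx (const_mx z.1 : 'rV[R]_1) z.2 : 'rV[R]_m.+1) f).
  exact: cons_row_continuous.
exact: cf.
Qed.

Lemma slice_cbox m B L (f : 'rV[R]_m.+1 -> R) s : cbox B L f -> cbox B L (slice f s).
Proof.
move=> [cf fB fL]; split=> [y|y|y i yi].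
- apply: (@continuous_comp _ _ _ (fun y => (s, y)) (fun z : R * 'rV[R]_m => slice f z.1 z.2)).
    by apply: (@cvg_pair _ _ _ (nbhs y) (nbhs s) (nbhs y) _ _ _ (cst s) id); [exact: cvg_cst|exact: cvg_id].
  apply: (@continuous_comp _ _ _ (fun z : R * 'rV[R]_m => row_mx (const_mx z.1 : 'rV[R]_1) z.2 : 'rV[R]_m.+1) f).
    exact: cons_row_continuous.
  exact: cf.
- exact: fB.
- apply: (fL _ (rshift 1 i : 'I_m.+1)).
  apply: (lt_le_trans yi); rewrite le_eqVlt; apply/orP; left; apply/eqP; congr (`|_|).
  by have := row_mxEr (const_mx s : 'rV[R]_1) y 0 i.
Qed.

Lemma slice_out m B L (f : 'rV[R]_m.+1 -> R) s y : cbox B L f -> L < `|s| -> slice f s y = 0.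
Proof.
move=> [_ _ fL] sL; apply: (fL _ (lshift m (0 : 'I_1) : 'I_m.+1)).
apply: (lt_le_trans sL); rewrite le_eqVlt; apply/orP; left; apply/eqP; congr (`|_|).
transitivity ((const_mx s : 'rV[R]_1) 0 0); first by rewrite mxE.
by symmetry; exact: (row_mxEl (const_mx s : 'rV[R]_1) y 0 0).
Qed.

(** Bound and bounded convergence go together because the next dimension needs both for the slices.
    The limit [f] may be discontinuous, like a function cut off sharply at the boundary of U. *)
Definition iter_int_ok m := forall B L, 0 <= L ->
  (forall f : 'rV[R]_m -> R, cbox B L f -> `|iter_int f| <= B * (2 * L) ^+ m) /\
  (forall (fk : nat -> 'rV[R]_m -> R) f, (forall k, cbox B L (fk k)) ->
    (forall x, fk ^~ x @ \oo --> f x) ->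
    (fun k => iter_int (fk k)) @ \oo --> iter_int f).

(** Continuity in s is the convergence statement one dimension lower, applied to the slices along a
    sequence of values of s. *)
Lemma iter_int_slice_ok m : iter_int_ok m -> forall B L (f : 'rV[R]_m.+1 -> R), 0 <= L ->
  cbox B L f -> [/\ continuous (fun s => iter_int (slice f s)),
    forall s, `|iter_int (slice f s)| <= B * (2 * L) ^+ m &
    forall s, L < `|s| -> iter_int (slice f s) = 0].
Proof.
move=> ok B L f L0 cb; split=> [s|s|s sL].
- apply/continuous_withinNx/cvgr_dnbhsP => v [_ vs]; have [_ h] := ok B L L0; apply: h => [k|y].
    exact: slice_cbox.
  have cs : {for s, continuous (fun s => slice f s y)}.
    by apply: slice_continuous_l; case: cb.
  exact: (cvg_comp _ _ vs cs).
- by have [h _] := ok B L L0; apply: h; exact: slice_cbox.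
- have [h _] := ok 0 L L0; have /h : cbox 0 L (slice f s).
    have E : slice f s = fun=> 0 by apply/funext => y; exact: slice_out y cb sL.
    by rewrite E; split => [x|x|//]; [exact: cst_continuous|rewrite normr0].
  by rewrite mul0r normr_le0 => /eqP.
Qed.

Lemma iter_int_okP m : iter_int_ok m.
Proof.
elim: m => [|m ok] B L L0.
  split=> [f [_ fB _]|fk f _ h]; first by rewrite expr0 mulr1; exact: fB.
  exact: (h 0).
split=> [f cb|fk f cb hf].
  have [c1 c2 c3] := iter_int_slice_ok ok L0 cb.
  rewrite iter_intS exprSr (mulrA B).
  exact: (@Rintegral_support_bound R _ L (B * (2 * L) ^+ m) L0 c1 c3 c2).
rewrite iter_intS.
have -> : (fun k => iter_int (fk k)) = (fun k => Rintegral (@lebesgue_measure R) setT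
   (fun s => iter_int (slice (fk k) s))) by [].
apply: (@Rintegral_support_cvg R (fun k s => iter_int (slice (fk k) s)) _ L (B * (2 * L) ^+ m)) => //.
- by move=> k; have [] := iter_int_slice_ok ok L0 (cb k).
- by move=> k; have [] := iter_int_slice_ok ok L0 (cb k).
- by move=> k; have [] := iter_int_slice_ok ok L0 (cb k).
move=> s; have [_ h] := ok B L L0; apply: h => [k|y]; first exact: slice_cbox.
exact: hf.
Qed.

Lemma iter_int_le m B L (f g : 'rV[R]_m -> R) : 0 <= L -> cbox B L f -> cbox B L g ->
  (forall x, f x <= g x) -> iter_int f <= iter_int g.
Proof.
move=> L0; elim: m f g => [|m IH] f g cf cg fg; first exact: fg.
have [f1 _ f3] := iter_int_slice_ok (@iter_int_okP m) L0 cf.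
have [g1 _ g3] := iter_int_slice_ok (@iter_int_okP m) L0 cg.
rewrite !iter_intS; apply: (@le_Rintegral_support R _ _ L) => // s.
by apply: IH => [||y]; [exact: slice_cbox|exact: slice_cbox|exact: fg].
Qed.

Lemma iter_intZ m B L (c : R) (f : 'rV[R]_m -> R) : 0 <= L -> cbox B L f ->
  iter_int (fun x => c * f x) = c * iter_int f.
Proof.
move=> L0; elim: m f => [|m IH] f cf //.
have [f1 _ f3] := iter_int_slice_ok (@iter_int_okP m) L0 cf.
rewrite !iter_intS -(@Rintegral_supportZ R c _ L)//; congr (Rintegral _ _ _).
by apply/funext => s; rewrite -IH//; exact: slice_cbox.
Qed.

Lemma Rintegral_support_gt0 (f : R -> R) L s0 : continuous f ->
  (forall s, L < `|s| -> f s = 0) -> (forall s, 0 <= f s) -> 0 < f s0 ->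
  0 < Rintegral (@lebesgue_measure R) setT f.
Proof.
move=> cf fL f0 fs0.
have f20 : 0 < f s0 / 2 by rewrite divr_gt0.
have /continuous_epsP/(_ _ f20)[d d0 hd] := cf s0.
pose L' := `|L| + `|s0| + d.
have L'0 : 0 <= L' by rewrite !addr_ge0// ltW.
have fL' s : L' < `|s| -> f s = 0.
  move=> h; apply: fL; apply: le_lt_trans h; apply: le_trans (ler_norm L) _.
  by rewrite /L' -addrA lerDl addr_ge0// ltW.
rewrite (Rintegral_support fL').
pose I : set R := `[(s0 - d / 2), (s0 + d / 2)]%classic.
have fI s : I s -> f s0 / 2 <= f s.
  rewrite /I /= in_itv /= => /andP[h1 h2].
  have : `|s - s0| < d by rewrite ltr_norml; apply/andP; split; lra.
  by move=> /hd; rewrite ltr_norml => /andP[h _]; lra.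
have ID : I `<=` `[(- L'), L']%classic.
  move=> s; rewrite /I /= !in_itv /= => /andP[h1 h2].
  have := ler_norm s0; have := ler_norm (- s0); rewrite normrN => h3 h4.
  have := normr_ge0 L; rewrite /L' => h5.
  by apply/andP; split; lra.
have mI : measurable I by exact: measurable_itv.
have mD : measurable (`[(- L'), L']%classic : set R) by exact: measurable_itv.
have intD := integrable_segment L' cf.
have intI : (@lebesgue_measure R).-integrable I (EFin \o f).
  exact: (integrableS (mu := @lebesgue_measure R) mD mI ID intD).
have le1 : Rintegral (@lebesgue_measure R) I f <= Rintegral (@lebesgue_measure R) `[(- L'), L'] f.
  rewrite /Rintegral fine_le//.
  - exact: integrable_fin_num.
  - exact: integrable_fin_num.
  - apply: ge0_subset_integral => //.
    + by case/integrableP : intD.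
    + by move=> s _; rewrite lee_fin.
apply: lt_le_trans le1.
have intc : (@lebesgue_measure R).-integrable I (EFin \o (fun=> f s0 / 2)).
  have cc : continuous (fun _ : R => f s0 / 2) by move=> s; exact: cvg_cst.
  exact: (integrableS (mu := @lebesgue_measure R) mD mI ID (integrable_segment L' cc)).
apply: lt_le_trans (_ : 0 < Rintegral (@lebesgue_measure R) I (fun=> f s0 / 2)) _; last first.
  exact: le_Rintegral.
have h : 0 < fine (@lebesgue_measure R `[(s0 - d / 2), (s0 + d / 2)]).
  rewrite lebesgue_measure_itv /= lte_fin.
  have -> : s0 - d / 2 < s0 + d / 2 by lra.
  by rewrite /=; lra.
by rewrite Rintegral_cst//; apply: mulr_gt0.
Qed.

Lemma iter_int_gt0 m B L (f : 'rV[R]_m -> R) x0 : 0 <= L -> cbox B L f ->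
  (forall x, 0 <= f x) -> 0 < f x0 -> 0 < iter_int f.
Proof.
move=> L0; elim: m f x0 => [|m IH] f x0 cf f0 fx0.
  by have -> : iter_int f = f x0; rewrite //=; congr f; apply/rowP => -[].
have [f1 _ f3] := iter_int_slice_ok (@iter_int_okP m) L0 cf.
rewrite iter_intS.
pose s0 := x0 0 0; pose y0 : 'rV[R]_m := rsubmx (x0 : 'rV[R]_(1 + m)).
apply: (@Rintegral_support_gt0 _ L s0) => //.
  move=> s; have c0 : cbox B L (fun _ : 'rV[R]_m => 0 : R).
    split=> // [x|x]; first exact: cst_continuous.
    by rewrite normr0; case: cf => _ /(_ x0) h _; exact: le_trans h.
  have z0 : iter_int (fun _ : 'rV[R]_m => 0 : R) = 0.
    rewrite -[RHS](mul0r (iter_int (fun _ : 'rV[R]_m => 0 : R))) -(iter_intZ 0 L0 c0).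
    by congr iter_int; apply/funext => y; rewrite mul0r.
  rewrite -z0; apply: (iter_int_le L0 c0 (slice_cbox s cf)) => y; exact: f0.
apply: (IH _ y0); [exact: slice_cbox|by move=> y; exact: f0|].
have E : row_mx (const_mx s0 : 'rV[R]_1) y0 = x0 :> 'rV[R]_(1 + m).
  rewrite -[RHS](@hsubmxK _ 1 1 m); congr (row_mx _ _).
  by apply/rowP => i; rewrite !mxE ord1; congr (x0 0 _); apply/val_inj.
have -> : slice f s0 y0 = f x0 by congr f; exact: E.
by [].
Qed.

End IteratedIntegral.

(** * Volume and mean values over the domain *)

Section MeanFree.
Context {R : realType} {n : nat}.
Variables (U : set 'rV[R]_n).
Hypotheses (n0 : (0 < n)%N) (oU : open U) (bU : bounded_set U) (U0 : U !=set0).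

(** The distance to the complement, finite because U is bounded and the dimension positive. *)
Definition bdist (x : 'rV[R]_n) : R := fine (edist_inf (~` U) x).
(** Continuous functions increasing to the indicator of the open set U. They reduce integrals over U
    to limits of integrals of [cbox] functions. *)
Definition cutoff (k : nat) (x : 'rV[R]_n) : R := Num.min 1 (k%:R * bdist x).

Lemma bounded_box : exists2 L : R, 0 <= L & forall x, U x -> forall i, `|x 0 i| <= L.
Proof.
have [L L0 hL] := ex_strict_bound_gt0 bU.
exists L => [|x Ux i]; first exact: ltW.
apply: le_trans (coord_le_norm x i) _; apply: ltW; exact: hL.
Qed.

Lemma bdist_fin (x : 'rV[R]_n) : edist_inf (~` U) x \is a fin_num.
Proof.
have [L L0 hL] := bounded_box.
pose y : 'rV[R]_n := const_mx (L + 1).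
have Uy : ~ U y.
  move=> /hL/(_ (Ordinal n0)); rewrite mxE ger0_norm; [lra|].
  by rewrite addr_ge0.
rewrite ge0_fin_numE ?edist_inf_ge0//.
apply: (@le_lt_trans _ _ (edist (x, y))); first by apply: ereal_inf_lbound; exists y.
rewrite -ge0_fin_numE ?edist_ge0//; apply/edist_finP; exists (`|x - y| + 1) => /=.
  by rewrite ltr_wpDl.
by rewrite -ball_normE /= ltrDl.
Qed.

Lemma bdist_continuous : continuous bdist.
Proof.
move=> x; apply: (@fine_cvg R _ (nbhs x) _ (edist_inf (~` U)) (bdist x)).
have -> : (bdist x)%:E = edist_inf (~` U) x by rewrite fineK// bdist_fin.
exact: edist_inf_continuous.
Qed.

Lemma bdist_ge0 x : 0 <= bdist x.
Proof. by apply: fine_ge0; exact: edist_inf_ge0. Qed.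

Lemma bdist_out x : ~ U x -> bdist x = 0.
Proof. by move=> Ux; rewrite /bdist edist_inf0. Qed.

Lemma bdist_gt0 x : U x -> 0 < bdist x.
Proof.
move=> Ux; have /nbhs_ballP[r /= r0 hr] : nbhs x U by exact: open_nbhs_nbhs.
apply: (lt_le_trans r0); rewrite -lee_fin /bdist fineK; last exact: bdist_fin.
apply: le_ereal_inf_tmp => _ [y /= Uy <-]; rewrite leNgt; apply/negP => h.
by apply: Uy; apply: hr; exact: (edist_lt_ball h).
Qed.

Lemma cutoff_continuous k : continuous (cutoff k).
Proof.
move=> x.
apply: (@continuous_min R _ (fun=> 1 : R^o) (fun x => k%:R * bdist x : R^o) x).
  exact: cst_continuous.
apply: (@cvgM _ _ (nbhs x) _ (fun=> k%:R) bdist); last exact: bdist_continuous.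
exact: cst_continuous.
Qed.

Lemma cutoff_bound k x : 0 <= cutoff k x <= 1.
Proof. by rewrite le_min ler01 mulr_ge0 ?bdist_ge0//= ge_min lexx. Qed.

Lemma cutoff_out k x : ~ U x -> cutoff k x = 0.
Proof. by move=> Ux; rewrite /cutoff bdist_out// mulr0 min_r. Qed.

Lemma cutoff_cvg x : U x -> \forall k \near \oo, cutoff k x = 1.
Proof.
move=> /bdist_gt0 d0; near=> k; apply: min_l.
rewrite -ler_pdivrMr// mul1r.
by near: k; exact: nbhs_infty_ger.
Unshelve. all: by end_near. Qed.

Lemma cutoff_cbox (h : 'rV[R]_n -> R) B L k : 0 <= B -> continuous h ->
  (forall x, U x -> `|h x| <= B) -> (forall x, U x -> forall i, `|x 0 i| <= L) ->
  cbox B L (fun x => cutoff k x * h x).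
Proof.
move=> B0 ch hB hL; split.
- move=> x; apply: (@cvgM _ _ (nbhs x) _ (cutoff k) h); last exact: ch.
  exact: cutoff_continuous.
- move=> x; have [Ux|Ux] := pselect (U x); last by rewrite cutoff_out// mul0r normr0.
  have /andP[c0 c1] := cutoff_bound k x; rewrite normrM ger0_norm//.
  by apply: le_trans (hB x Ux); rewrite ler_piMl.
- move=> x i xi; rewrite cutoff_out ?mul0r// => /hL/(_ i).
  by rewrite leNgt xi.
Qed.

Lemma integral_cutoff (h : 'rV[R]_n -> R) B L : 0 <= B -> 0 <= L -> continuous h ->
  (forall x, U x -> `|h x| <= B) -> (forall x, U x -> forall i, `|x 0 i| <= L) ->
  (fun k => iter_int (fun x => cutoff k x * h x)) @ \oo --> integral_over U h.
Proof.
move=> B0 L0 ch hB hL; have [_ ok] := @iter_int_okP R n B L L0.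
apply: (ok (fun k x => cutoff k x * h x)) => [k|x]; first exact: cutoff_cbox.
case: asboolP => Ux.
  apply: cvg_near_cst; near=> k.
  by rewrite (_ : cutoff k x = 1) ?mul1r//; near: k; exact: cutoff_cvg.
rewrite (_ : (fun k => _) = fun=> 0); first exact: cvg_cst.
by apply/funext => k; rewrite cutoff_out// mul0r.
Unshelve. all: by end_near. Qed.

Lemma integral_over_bounds (h : 'rV[R]_n -> R) a b : continuous h ->
  (forall x, U x -> a <= h x <= b) ->
  a * vol U <= integral_over U h <= b * vol U.
Proof.
move=> ch hab; have [L L0 hL] := bounded_box.
have [x0 Ux0] := U0.
pose B := `|a| + `|b|; have B0 : 0 <= B by rewrite addr_ge0.
have hB x : U x -> `|h x| <= B.
  move=> /hab/andP[ah hb]; rewrite /B ler_norml.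
  have := ler_norm b; have := ler_norm (- a); rewrite normrN.
  have := normr_ge0 a; have := normr_ge0 b => *.
  by apply/andP; split; lra.
have c1 : continuous (fun _ : 'rV[R]_n => 1 : R) by exact: cst_continuous.
have b1 x : U x -> `|1 : R| <= 1 by rewrite normr1.
have cv1 := integral_cutoff ler01 L0 c1 b1 hL.
have cvh := integral_cutoff B0 L0 ch hB hL.
have cb1 k := cutoff_cbox k ler01 c1 b1 hL.
have main (c : R) : (fun k => iter_int (fun x => cutoff k x * c)) @ \oo --> c * vol U.
  rewrite (_ : (fun k => _) = fun k => c * iter_int (fun x => cutoff k x * 1)).
    by apply: cvgM; [exact: cvg_cst|exact: cv1].
  apply/funext => k; rewrite -(iter_intZ c L0 (cb1 k)); congr iter_int.
  by apply/funext => x; rewrite mulr1 mulrC.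
have le k (f g : 'rV[R]_n -> R) : continuous f -> continuous g ->
    (exists C, forall x, U x -> `|f x| <= C) -> (exists C, forall x, U x -> `|g x| <= C) ->
    (forall x, U x -> f x <= g x) ->
    iter_int (fun x => cutoff k x * f x) <= iter_int (fun x => cutoff k x * g x).
  move=> cf cg [C1 h1] [C2 h2] fg.
  have C10 : 0 <= C1 by apply: le_trans (h1 x0 Ux0).
  have C20 : 0 <= C2 by apply: le_trans (h2 x0 Ux0).
  apply: (@iter_int_le _ _ (C1 + C2) L) => //.
  - apply: cutoff_cbox => // [|x Ux]; first exact: addr_ge0.
    by apply: le_trans (h1 x Ux) _; rewrite lerDl.
  - apply: cutoff_cbox => // [|x Ux]; first exact: addr_ge0.
    by apply: le_trans (h2 x Ux) _; rewrite lerDr.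
  - move=> x; have [Ux|Ux] := pselect (U x); last by rewrite cutoff_out// !mul0r.
    have /andP[c0 _] := cutoff_bound k x; apply: ler_wpM2l => //; exact: fg.
have cc (c : R) : continuous (fun _ : 'rV[R]_n => c) by exact: cst_continuous.
have bc (c : R) : exists C, forall x, U x -> `|c| <= C by exists `|c|.
have bh : exists C, forall x, U x -> `|h x| <= C by exists B.
apply/andP; split.
  apply: (ler_cvg_to (main a) cvh); apply: nearW => k.
  by apply: (le k (fun=> a) h) => // x /hab/andP[].
apply: (ler_cvg_to cvh (main b)); apply: nearW => k.
by apply: (le k h (fun=> b)) => // x /hab/andP[].
Qed.

(** The integral of the first cutoff is positive, and those of the later ones are no smaller. *)
Lemma vol_gt0 : 0 < vol U.
Proof.
have [L L0 hL] := bounded_box.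
have [x0 Ux0] := U0.
have c1 : continuous (fun _ : 'rV[R]_n => 1 : R) by exact: cst_continuous.
have b1 x : U x -> `|1 : R| <= 1 by rewrite normr1.
have cv1 := integral_cutoff ler01 L0 c1 b1 hL.
have cb1 k := cutoff_cbox k ler01 c1 b1 hL.
have pos : 0 < iter_int (fun x => cutoff 1 x * 1).
  apply: (iter_int_gt0 (x0 := x0) L0 (cb1 1%N)) => [x|].
    by rewrite mulr1; have /andP[] := cutoff_bound 1 x.
  by rewrite mulr1 lt_min ltr01 mul1r bdist_gt0.
apply: (lt_le_trans pos); apply: (cvgr_to_ge cv1); near=> k.
apply: (iter_int_le L0 (cb1 1%N) (cb1 k)) => x; rewrite !mulr1.
rewrite /cutoff le_min ge_min lexx /= ge_min; apply/orP; right.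
apply: ler_wpM2r; first exact: bdist_ge0.
by rewrite ler_nat; near: k; exact: nbhs_infty_ge.
Unshelve. all: by end_near. Qed.

Lemma mean_free_le (h : 'rV[R]_n -> R) m e x : continuous h ->
  (forall y, U y -> m <= h y <= m + e) ->
  U x -> `|mean_free U h x| <= e.
Proof.
move=> ch hm Ux; have /andP[h1 h2] := integral_over_bounds ch hm.
have /andP[h3 h4] := hm x Ux; have v0 := vol_gt0.
have i1 : m <= (vol U)^-1 * integral_over U h by rewrite mulrC ler_pdivlMr.
have i2 : (vol U)^-1 * integral_over U h <= m + e by rewrite mulrC ler_pdivrMr.
by rewrite /mean_free ler_norml; apply/andP; split; lra.
Qed.

End MeanFree.

(** * Decay of the flux *)

Section TailDecay.
Context {R : realType}.
Local Notation leb := (@lebesgue_measure R).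

(** [f_data] and [ft_data] are suprema over the boundary whose measurability is not established, so
    monotonicity is taken from the definition of the integral as a supremum over simple
    functions. *)
Lemma ge0_le_integral_lower (D : set R) (f g : R -> \bar R) :
  (forall x, D x -> (0 <= f x)%E) -> (forall x, D x -> (f x <= g x)%E) ->
  (\int[leb]_(x in D) f x <= \int[leb]_(x in D) g x)%E.
Proof.
move=> f0 fg; rewrite !ge0_integralE//; last by move=> x Dx; apply: le_trans (fg x Dx); exact: f0.
apply: ereal_sup_le => _ [h /= hf <-]; exists h => //= x; apply: le_trans (hf x) _.
by rewrite !patchE; case: ifPn => // /set_mem/fg.
Qed.

(** Integrate Young's inequality y <= k y^2 + 1 / (4 k). *)
Lemma increment_le (F y : R -> R) (s t k M : R) : s < t -> 0 < k ->
  (forall x : R, is_derive x 1 F (y x)) -> continuous y ->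
  (\int[leb]_(x in `[s, t]) (y x ^+ 2)%:E <= M%:E)%E ->
  F t - F s <= k * M + (t - s) / (4 * k).
Proof.
move=> st k0 dF cy hM.
have cy2 : continuous (fun x => y x ^+ 2).
  by move=> x; rewrite (_ : (fun x => y x ^+ 2) = y \* y)//; apply: cvgM; exact: cy.
have cF : continuous F.
  by move=> x; apply: differentiable_continuous; apply/derivable1_diffP; have [] := dF x.
have intc (g : R -> R) : continuous g -> leb.-integrable `[s, t] (EFin \o g).
  move=> cg; apply: continuous_compact_integrable; first exact: segment_compact.
  exact: continuous_subspaceT.
have ftc : (\int[leb]_(x in `[s, t]) (y x)%:E = (F t)%:E - (F s)%:E)%E.
  apply: continuous_FTC2 => //.
  - exact: continuous_subspaceT.
  - split.
    + by move=> x _; have [] := dF x.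
    + exact: cvg_at_right_filter (cF s).
    + exact: cvg_at_left_filter (cF t).
  - by move=> x _; rewrite derive1E; have [_] := dF x.
have mst : fine (leb `[s, t]) = t - s.
  by rewrite lebesgue_measure_itv /= lte_fin st.
have -> : F t - F s = Rintegral leb `[s, t] y by rewrite /Rintegral ftc.
have i2 : Rintegral leb `[s, t] (fun x => y x ^+ 2) <= M.
  by rewrite -lee_fin /Rintegral fineK//; exact: integrable_fin_num (intc _ cy2).
apply: (@le_trans _ _ (k * Rintegral leb `[s, t] (fun x => y x ^+ 2) + (t - s) / (4 * k))).
  rewrite -RintegralZl//; last exact: intc.
  rewrite -mst [_ / _]mulrC -Rintegral_cst// -RintegralD//.
  - apply: le_Rintegral => //; [exact: intc| |].
      apply: intc => x; apply: cvgD; last exact: cvg_cst.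
      by apply: cvgM; [exact: cvg_cst|exact: cy2].
    move=> x _ /=.
    have -> : (4 * k)^-1 = k * (2 * k)^-1 ^+ 2 by field; exact: lt0r_neq0.
    have e : y x = k * (2 * (y x * (2 * k)^-1)) by field; exact: lt0r_neq0.
    rewrite [leLHS]e -mulrDr ler_pM2l//.
    have := sqr_ge0 (y x - (2 * k)^-1); nra.
  - by apply: intc => x; apply: cvgM; [exact: cvg_cst|exact: cy2].
  - by apply: intc => x; exact: cvg_cst.
by rewrite lerD2r ler_pM2l.
Qed.

(** A value |G x t| > e forces |G x| >= e / 2, hence f >= (e / 2)^2, on the whole interval
    [t - d, t]. If such t were unbounded, with x varying at will, infinitely many disjoint intervals
    would contradict the integrability of f. *)
Lemma tail_decay (I : Type) (G g : I -> R -> R) (f ft : R -> R) (M : R) :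
  (forall x (t : R), is_derive t 1 (G x) (g x t)) -> (forall x, continuous (g x)) ->
  (forall x t, G x t ^+ 2 <= f t) -> (forall x t, g x t ^+ 2 <= ft t) -> (forall t, 0 <= f t) ->
  (\int[leb]_(t in [set t : R | (0 <= t)%R]) (f t)%:E < +oo)%E ->
  (forall t, 2 <= t -> (eint (t - 2) t ft <= M%:E)%E) ->
  forall e, 0 < e -> exists2 T, 0 <= T & forall x t, T <= t -> `|G x t| <= e.
Proof.
move=> dG cg Gf gft f0 If Ift e e0.
(* With this [k] and the [d] below, an increment of G over a time at most d is bounded by k M + d /
   (4 k) <= e / 4 + e / 4. *)
pose k := e / (4 * (`|M| + 1)).
have M1 : 0 < `|M| + 1 by rewrite ltr_wpDl.
have k0 : 0 < k by rewrite divr_gt0// mulr_gt0.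
have kM : k * M <= e / 4.
  have : k * M <= k * (`|M| + 1).
    by rewrite ler_pM2l//; apply: le_trans (ler_norm M) _; rewrite lerDl.
  have -> : k * (`|M| + 1) = e / 4 by rewrite /k; field; exact: lt0r_neq0.
  by [].
pose d := Num.min 1 (k * e).
have d0 : 0 < d by rewrite lt_min ltr01 mulr_gt0.
have d1 : d <= 1 by rewrite ge_min lexx.
have dk : d / (4 * k) <= e / 4.
  rewrite ler_pdivrMr ?mulr_gt0//.
  have -> : e / 4 * (4 * k) = k * e by field.
  by rewrite ge_min lexx orbT.
have Iy x (s t : R) : 2 <= t -> t - d <= s -> s < t ->
    (\int[leb]_(u in `[s, t]) (g x u ^+ 2)%:E <= M%:E)%E.
  move=> t2 ds st; apply: le_trans (Ift t t2); rewrite /eint.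
  have c2 : continuous (fun u => g x u ^+ 2).
    move=> u; rewrite (_ : (fun u => g x u ^+ 2) = g x \* g x)//.
    by apply: cvgM; exact: cg.
  have E : [set u | (t - 2 <= u <= t)%R] = `[(t - 2), t]%classic :> set R.
    by apply/seteqP; split=> u /=; rewrite in_itv.
  rewrite E; apply: (@le_trans _ _ (\int[leb]_(u in `[(t - 2)%R, t]) (g x u ^+ 2)%:E)%E).
    apply: ge0_subset_integral => //.
    - by apply/measurable_EFinP; apply: measurable_funTS; exact: continuous_measurable_fun.
    - by move=> u _; rewrite lee_fin sqr_ge0.
    - move=> u /=; rewrite !in_itv /= => /andP[h1 h2]; rewrite h2 andbT; lra.
  by apply: ge0_le_integral_lower => u _; rewrite lee_fin// sqr_ge0.
pose c := (e / 2) ^+ 2.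
have c0 : 0 < c by rewrite exprn_gt0// divr_gt0.
pose good t := forall s, t - d <= s <= t -> c <= f s.
have step x t : 2 <= t -> e < `|G x t| -> good t.
  move=> t2 et s /andP[s1 s2].
  apply: le_trans (Gf x s); rewrite -[G x s ^+ 2]real_normK ?num_real//.
  rewrite ler_sqr ?nnegrE ?normr_ge0//; last by rewrite divr_ge0// ltW.
  move: s2; rewrite le_eqVlt => /orP[/eqP ->|s2]; first lra.
  have dts : (t - s) / (4 * k) <= e / 4.
    by apply: le_trans dk; rewrite ler_pM2r ?invr_gt0 ?mulr_gt0//; lra.
  have h1 := increment_le s2 k0 (dG x) (cg x) (Iy x s t t2 s1 s2).
  have h2 : - G x t - - G x s <= k * M + (t - s) / (4 * k).
    apply: (@increment_le (- G x) (- g x)) => //.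
    - by move=> u; apply: cvgN; exact: cg.
    - under eq_integral do rewrite sqrrN.
      exact: Iy.
  move: et; rewrite ltr_normr => /orP[et|et].
    by apply: le_trans (ler_norm _); lra.
  by rewrite -normrN; apply: le_trans (ler_norm _); lra.
apply: contrapT => noT.
have goods T : exists2 t, T <= t & good t.
  apply: contrapT => no; apply: noT; exists (Num.max 2 T); first by rewrite le_max ler0n.
  move=> x t; rewrite ge_max => /andP[t2 Tt]; rewrite leNgt; apply/negP => et.
  by apply: no; exists t => //; exact: (step x).
have sets N : exists (E : set R) (T : R), [/\ measurable E,
    forall s, E s -> [/\ 0 <= s, s <= T & c <= f s] & ((d *+ N)%:E <= leb E)%E].
  elim: N => [|N [E [T [mE hE lE]]]].
    by exists set0, 0; split=> [//|s []|]; rewrite measure0.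
  (* The new interval [t - d, t] starts beyond T, so it is disjoint from E, and after time 0. *)
  have [t Tt gt] := goods (Num.max (T + 1) 1 + d).
  have [h1 h2] : T + 1 <= t - d /\ 1 <= t - d.
    by split; rewrite lerBrDr; apply: le_trans Tt; rewrite lerD2r le_max lexx ?orbT.
  have mI : measurable (`[(t - d), t]%classic : set R) by exact: measurable_itv.
  exists (E `|` `[(t - d), t]%classic), t; split.
  - exact: measurableU.
  - move=> s [/hE[s0 sT cs]|/=]; first by split=> //; lra.
    by rewrite in_itv /= => /andP[a1 a2]; split=> //; [lra|apply: gt; rewrite a1].
  - have dj (s : R) : E s -> t - d <= s -> False.
      by move=> /hE[_ sT _]; apply/negP; rewrite -ltNge; lra.
    have -> : leb (E `|` `[(t - d), t]%classic) = (leb E + leb `[(t - d)%R, t])%E.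
      apply: measureU => //; apply/seteqP; split=> // s [Es] /=.
      by rewrite in_itv /= => /andP[a1 _]; exact: (dj s).
    have -> : leb `[(t - d), t] = d%:E.
      rewrite lebesgue_measure_itv /= lte_fin.
      have -> : t - d < t by lra.
      by rewrite -EFinB; congr EFin; lra.
    by rewrite mulrSr EFinD leeD.
have big N : ((c * (d *+ N))%:E <= \int[leb]_(t in [set t : R | (0 <= t)%R]) (f t)%:E)%E.
  have [E [T [mE hE lE]]] := sets N.
  have mD : measurable ([set t : R | (0 <= t)%R]).
    have -> : [set t : R | (0 <= t)%R] = `[0, +oo[%classic.
      by apply/seteqP; split=> u /=; rewrite in_itv /= andbT.
    exact: measurable_itv.
  apply: (@le_trans _ _ (\int[leb]_(t in [set t : R | (0 <= t)%R]) (c%:E * (\1_E t)%:E))%E).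
    have m1 : measurable_fun [set t : R | (0 <= t)%R] (fun t => (\1_E t : R)%:E).
      by apply/measurable_EFinP; apply: measurable_funTS; exact: measurable_indic.
    rewrite ge0_integralZl_EFin//; last exact: ltW.
    rewrite integral_indic// EFinM lee_pmul2l ?lte_fin//.
    by rewrite (_ : E `&` _ = E)//; apply/seteqP; split=> [s []//|s Es]; split=> //; have [] := hE s Es.
  apply: ge0_le_integral_lower => t _; rewrite -EFinM lee_fin.
    by rewrite mulr_ge0 ?ler0n// ltW.
  rewrite indicE; case: (boolP (t \in E)); rewrite ?mulr0 ?mulr1//.
  by move=> /set_mem/hE[].
set J := (\int[leb]_(t in _) _)%E in If big.
have J0 : (0 <= J)%E by apply: integral_ge0 => t _; rewrite lee_fin.
have Jf : J \is a fin_num by rewrite ge0_fin_numE.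
have cd0 : 0 < c * d by rewrite mulr_gt0.
have [N hN] : exists N : nat, fine J / (c * d) < N%:R.
  exists (Num.bound (fine J / (c * d))).
  by apply: archi_boundP; rewrite divr_ge0 ?fine_ge0// ltW.
have := big N; rewrite -(fineK Jf) lee_fin leNgt => /negP; apply.
by rewrite mulrnAr -mulr_natl -ltr_pdivrMr.
Qed.

End TailDecay.

(** * Decay of the prescribed boundary flux *)

Section FluxDecay.
Context {R : realType} {n : nat}.
Variables (U : set 'rV[R]_n) (Psi : 'rV[R]_(n + 1) -> R).
Hypotheses (oU : open U) (cU : compact (closure U)) (C2Psi : Ck 2 Psi).

(** Compactness makes the supremum finite, so [fine] returns it and not its default value. *)
Lemma sup_abs_ge (A : set 'rV[R]_n) (h : 'rV[R]_n -> R) x : compact A -> continuous h ->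
  A x -> `|h x| <= sup_abs A h.
Proof.
move=> cA ch Ax.
have /compact_bounded bA : compact (h @` A).
  by apply: continuous_compact => //; exact: continuous_subspaceT.
have [M _ hM] := ex_strict_bound_gt0 bA.
have hx : ((`|h x|)%:E <= esup_abs A h)%E by apply: ereal_sup_ubound; exists x.
rewrite -lee_fin /sup_abs fineK// fin_numElt; apply/andP; split.
  by apply: lt_le_trans hx; exact: ltNyr.
apply: (@le_lt_trans _ _ M%:E); last exact: ltry.
by apply: ge_ereal_sup => _ [y Ay <-]; rewrite lee_fin ltW//; apply: hM; exists y.
Qed.

Lemma st_slice_continuous (Q : 'rV[R]_(n + 1) -> R) t : continuous Q ->
  continuous (fun x => Q (st x t)).
Proof.
move=> cQ x.
apply: (@continuous_comp _ _ _ (fun x => (x, t)) (fun z : 'rV[R]_n * R => Q (st z.1 z.2))).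
  by apply: (@cvg_pair _ _ _ (nbhs x) (nbhs x) (nbhs t) _ _ _ id (cst t)); [exact: cvg_id|exact: cvg_cst].
by apply: continuous_comp; [exact: st_continuous|exact: cQ].
Qed.

Lemma st_time_continuous (Q : 'rV[R]_(n + 1) -> R) x : continuous Q ->
  continuous (fun t => Q (st x t)).
Proof.
move=> cQ t.
apply: (@continuous_comp _ _ _ (fun t => (x, t)) (fun z : 'rV[R]_n * R => Q (st z.1 z.2))).
  by apply: (@cvg_pair _ _ _ (nbhs t) (nbhs x) (nbhs t) _ _ _ (cst x) id); [exact: cvg_cst|exact: cvg_id].
by apply: continuous_comp; [exact: st_continuous|exact: cQ].
Qed.

Lemma time_derivE x t : time_deriv Psi x t = partial (rshift n ord0) Psi (st x t).
Proof.
rewrite /time_deriv /partial /derive.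
have -> : (fun h : R => h^-1 *: (((fun s => Psi (st x s)) \o shift t) (h *: 1) - Psi (st x t)))
   = (fun h : R => h^-1 *: ((Psi \o shift (st x t)) (h *: ebasis (rshift n ord0)) - Psi (st x t))).
  by apply/funext => h /=; rewrite [_ + t]addrC -[_ *: 1]/(h * 1) mulr1 st_time [_ + st x t]addrC.
by [].
Qed.

Lemma flux_decay a : (Ups2 U a Psi < +oo)%E -> (Ups7 U a Psi < +oo)%E ->
  forall e, 0 < e -> exists2 T, 0 <= T & psi_le U (fun x t => Psi (st x t)) e T.
Proof.
move=> U2 U7 e e0; have cb := bdry_compact oU cU.
have dcont : continuous (partial (rshift n ord0) Psi) by exact: C2_partial_continuous.
have f0 t : 0 <= f_data U a Psi t by rewrite addr_ge0 ?sqr_ge0 ?powR_ge0.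
have ft0 t : 0 <= ft_data U a Psi t by rewrite addr_ge0 ?sqr_ge0 ?powR_ge0.
have int_f : (\int[@lebesgue_measure R]_(t in [set t : R | (0 <= t)%R]) (f_data U a Psi t)%:E < +oo)%E.
  by apply: le_lt_trans U2; rewrite /Ups2 leeDr.
set S := ereal_sup [set eint (t - 2) t (ft_data U a Psi) | t in [set t : R | (2 <= t)%R]].
have e_ge0 t : (0 <= eint (t - 2) t (ft_data U a Psi))%E.
  by apply: integral_ge0 => s _; rewrite lee_fin.
have S0 : (0 <= S)%E.
  by apply: le_trans (e_ge0 2) _; apply: ereal_sup_ubound; exists 2 => /=.
have Sfin : S \is a fin_num.
  by rewrite ge0_fin_numE//; apply: le_lt_trans U7; rewrite /Ups7 leeDr.
have int_ft t : 2 <= t -> (eint (t - 2) t (ft_data U a Psi) <= (fine S)%:E)%E.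
  by move=> t2; rewrite fineK//; apply: ereal_sup_ubound; exists t.
have psi_sqr (x : {x | bdry U x}) t : Psi (st (sval x) t) ^+ 2 <= f_data U a Psi t.
  case: x => x bx /=; apply: (@le_trans _ _ (psi_norm U Psi t ^+ 2)); last by rewrite lerDl powR_ge0.
  have h := sup_abs_ge cb (@st_slice_continuous Psi t (C2_continuous C2Psi)) bx.
  by rewrite -[leLHS]real_normK ?num_real// lerXn2r ?nnegrE//; exact: le_trans h.
have psit_sqr (x : {x | bdry U x}) t : time_deriv Psi (sval x) t ^+ 2 <= ft_data U a Psi t.
  case: x => x bx /=; apply: (@le_trans _ _ (psit_norm U Psi t ^+ 2)); last by rewrite lerDl powR_ge0.
  have ct : continuous (fun x => time_deriv Psi x t).
    rewrite (_ : (fun x => _) = fun x => partial (rshift n ord0) Psi (st x t)).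
      exact: st_slice_continuous.
    by apply/funext => y; rewrite time_derivE.
  have h := sup_abs_ge cb ct bx.
  by rewrite -[leLHS]real_normK ?num_real// lerXn2r ?nnegrE//; exact: le_trans h.
have cd (x : {x | bdry U x}) : continuous (fun t => time_deriv Psi (sval x) t).
  rewrite (_ : (fun t => _) = fun t => partial (rshift n ord0) Psi (st (sval x) t)).
    exact: st_time_continuous.
  by apply/funext => t; rewrite time_derivE.
have dt (x : {x | bdry U x}) (t : R) :
  is_derive t 1 (fun s => Psi (st (sval x) s)) (time_deriv Psi (sval x) t).
  exact: C2_time_is_derive.
have [T T0 hT] := tail_decay dt cd psi_sqr psit_sqr f0 int_f int_ft e0.
by exists T => // x t bx Tt; exact: (hT (exist _ x bx)).
Qed.

End FluxDecay.

(** * Passage to the limit superior *)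

Section Limit.
Context {R : realType}.

Lemma limsup_oo_le0 (g : R -> \bar R) :
  (forall e, 0 < e -> exists T, forall t, T <= t -> (g t <= e%:E)%E) -> (limsup_oo g <= 0)%E.
Proof.
move=> h; apply/lee_addgt0Pr => e /h[T hT]; rewrite add0e.
apply: (@le_trans _ _ (ereal_sup [set g t | t in [set t | T <= t]])).
  by apply: ereal_inf_lbound; exists T.
by apply: ge_ereal_sup => _ [t /= /hT ? <-].
Qed.

Lemma mean_free_tendsto (n N : nat) (U : set 'rV[R]_n) (nu : 'rV[R]_n -> 'rV[R]_n)
    (al : 'I_N.+1 -> R) (av : 'rV[R]_N.+1) (b : R) (Psi P : 'rV[R]_(n + 1) -> R) :
  (0 < n)%N -> (1 <= N)%N -> open U -> bounded_set U -> connected U -> U !=set0 ->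
  C2_boundary_normal U nu -> al ord0 = 0 ->
  (forall i j : 'I_N.+1, (i < j)%N -> al i < al j) -> admissible av -> Ck 2 Psi ->
  is_solution U nu al av Psi P ->
  (Ups2 U b Psi < +oo)%E -> (Ups7 U b Psi < +oo)%E ->
  forall e, 0 < e -> exists T, forall t, T <= t ->
    forall x, U x -> `|mean_free U (fun y => P (st y t)) x| <= e.
Proof.
move=> n0 N1 oU bU coU U0 C2 al0 allt adm C2Psi sol U2 U7 e e0.
have cU : compact (closure U).
  have [L _ hL] := ex_strict_bound_gt0 bU.
  have cB : compact [set x : 'rV[R]_n | enorm (x - 0) <= n%:R * L] by exact: closed_eball_compact.
  apply: (subclosed_compact (@closed_closure _ U) cB).
  rewrite [X in _ `<=` X](closure_id _).1; last exact: compact_closed (@norm_hausdorff _ _) cB.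
  apply: closureS => x /hL xL; rewrite /= subr0.
  by apply: le_trans (enorm_le_norm x) _; rewrite ler_wpM2l// ltW.
have [T _ hT] := osc_tendsto (Kfun_diffusivity N1 al0 allt adm) oU cU coU C2
  (flow_of_solution N1 al0 allt adm sol) n0 U0 (flux_decay oU cU C2Psi U2 U7) e0.
exists T => t /hT[m hm] x Ux.
have cP : continuous P by case: sol => C2P _; exact: C2_continuous.
apply: (mean_free_le n0 oU bU U0 (@st_slice_continuous R n P t cP)) Ux => y Uy.
by apply: hm; exact: subset_closure.
Qed.

End Limit.

Theorem theorem5p5 (R : realType) (n : nat) (U U' : set 'rV[R]_n)
  (nu : 'rV[R]_n -> 'rV[R]_n) (N : nat) (alpha : 'I_N.+1 -> R) (mu M : R) :
  (2 <= n)%N -> (1 <= N)%N ->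
  open U -> bounded_set U -> connected U -> U !=set0 ->
  C2_boundary_normal U nu ->
  compact (closure U') -> closure U' `<=` U ->
  alpha ord0 = 0 -> (forall i j : 'I_N.+1, (i < j)%N -> alpha i < alpha j) ->
  (* strict degree condition *)
  aexp alpha < 4 / (n%:R + 2) ->
  mu5 n (aexp alpha) / (mu5 n (aexp alpha) - 2) < mu ->
  exists C : R,
  forall (D : set 'rV[R]_N.+1) (a1 a2 : 'rV[R]_N.+1)
         (Psi P1 P2 : 'rV[R]_(n + 1) -> R),
    compact D -> D `<=` admissible ->
    (forall v, D v -> chi v <= M) -> (exists2 v, D v & chi v = M) ->
    D a1 -> D a2 ->
    Cinf Psi ->
    is_solution U nu alpha a1 Psi P1 ->
    is_solution U nu alpha a2 Psi P2 ->
    (Ups2 U (aexp alpha) Psi < +oo)%E ->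
    (Ups3 U Psi < +oo)%E ->
    (Ups7 U (aexp alpha) Psi < +oo)%E ->
    (limsup_oo (fun t => esup_abs U' (barP U P1 P2 t))
     <= (C * Ups9 U (aexp alpha) mu Psi P1 P2
           * (enorm (a1 - a2)
              + enorm (a1 - a2) `^ (gamma1 n (aexp alpha) mu
                                      / (gamma1 n (aexp alpha) mu + 1))) `^ (1 / 2))%:E)%E.
Proof.
move=> n2 N1 oU bU coU U0 C2 _ U'U al0 allt _ _; exists 0.
move=> D a1 a2 Psi P1 P2 _ Dadm _ _ D1 D2 CPsi sol1 sol2 U2 _ U7.
rewrite !mul0r; apply: limsup_oo_le0 => e e0.
have n0 : (0 < n)%N by exact: leq_trans n2.
have e20 : 0 < e / 2 by rewrite divr_gt0.
have [T1 h1] := mean_free_tendsto n0 N1 oU bU coU U0 C2 al0 allt (Dadm _ D1) (CPsi 2%N) sol1 U2 U7 e20.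
have [T2 h2] := mean_free_tendsto n0 N1 oU bU coU U0 C2 al0 allt (Dadm _ D2) (CPsi 2%N) sol2 U2 U7 e20.
exists (Num.max T1 T2) => t; rewrite ge_max => /andP[t1 t2].
apply: ge_ereal_sup => _ [x U'x <-].
have Ux : U x by apply: U'U; exact: subset_closure.
rewrite lee_fin /barP [leRHS]splitr; apply: le_trans (ler_normB _ _) _.
by rewrite lerD ?h1 ?h2.
Qed.
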